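(* Let $V$ be a finite-dimensional real normed space, $m\ge 1$ an integer and $p>1$ a real number. Let $Y$ be an element of $C^{p\text{-}var}(G^{m}(V))$. Then $Y$ belongs to $C^{0,p\text{-}var}(G^{m}(V))$ if and only if $$\lim_{\delta\to 0}\ \sup_{\substack{D=(0=t_{0}<\cdots<t_{n}=1)\\ |D|\le\delta}}\ \sum_{i=0}^{n-1}\delta_{Y}^{p}(t_{i},t_{i+1})=0,$$ where the supremum is over finite subdivisions $D$ of $[0,1]$ with mesh $|D|=\max_i (t_{i+1}-t_i)$ at most $\delta$, and for $0\le s\le t\le1$ $$\delta_{Y}^{p}(s,t)=\sup_{(s\le u_{0}<\cdots<u_{l}\le t)}\sum_{j=0}^{l-1}\left\Vert Y_{u_{j},u_{j+1}}\right\Vert_{m}^{p}.$$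
   Context: $T^{(m)}(V)=\bigoplus_{n=0}^{m}V^{\otimes n}$ is the truncated tensor algebra with (truncated) product $\otimes$; $\mathcal{G}^{m}(V)$ is its Lie subalgebra generated by $V$ for the bracket $[a,b]=a\otimes b-b\otimes a$; $G^{m}(V)=\exp(\mathcal{G}^{m}(V))$ is the free nilpotent Lie group of step $m$ over $V$, with product $\otimes$ and neutral element $1$. The dilation is $\delta_{t}(1+v_{1}+\dots+v_{m})=1+tv_{1}+\dots+t^{m}v_{m}$, $v_i\in V^{\otimes i}$, $t\in\mathbb{R}$. $\|\cdot\|_{m}$ is a fixed symmetric subadditive homogeneous norm on $G^{m}(V)$, i.e. a function $G^m(V)\to[0,\infty)$ with $\|g\|_m=0$ iff $g=1$, $\|\delta_t g\|_m=|t|\,\|g\|_m$, $\|g\otimes h\|_m\le\|g\|_m+\|h\|_m$, $\|g^{-1}\|_m=\|g\|_m$ (for instance the Carnot–Caratheodory norm; all such norms are equivalent since $\dim V<\infty$). Set $d_{m}(g,h)=\|g^{-1}\otimes h\|_{m}$. A $G^m(V)$-valued path is a continuous map $[0,1]\to G^{m}(V)$ starting at $1$; for such a path $Y_{s,t}:=Y_{s}^{-1}\otimes Y_{t}$. For a smooth path $y:[0,1]\to V$, the signature is $S_{m}(y)_{s,t}=1+\sum_{k=1}^{m}\int_{s<u_{1}<\dots<u_{k}<t}dy_{u_{1}}\otimes\dots\otimes dy_{u_{k}}\in G^{m}(V)$, and $S_m(y)$ denotes the $G^m(V)$-valued path $t\mapsto S_m(y)_{0,t}$. $d_{p\text{-}var}(x,y)=\sup_{D=(0=t_{0}<\cdots<t_{n}=1)}\big(\sum_{i=0}^{n-1}d_{m}(x_{t_{i},t_{i+1}},y_{t_{i},t_{i+1}})^{p}\big)^{1/p}$,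 $\|x\|_{p\text{-}var}$ is $d_{p\text{-}var}$ between $x$ and the constant path $1$. $C^{p\text{-}var}(G^{m}(V))$ is the set of $G^m(V)$-valued paths $x$ with $\|x\|_{p\text{-}var}<\infty$, and $C^{0,p\text{-}var}(G^{m}(V))$ is the $d_{p\text{-}var}$-closure of $\{S_{m}(x): x \text{ a smooth } V\text{-valued path}\}$. *)

(* Defs.v *)
From HB Require Import structures.
From mathcomp Require Import all_boot all_order all_algebra.
From mathcomp Require Import all_classical all_reals all_analysis.

Set Implicit Arguments.
Unset Strict Implicit.
Unset Printing Implicit Defensive.

Import Order.TTheory GRing.Theory Num.Theory.
Import numFieldNormedType.Exports.

Local Open Scope classical_set_scope.
Local Open Scope ring_scope.

#[short(type="normedVectType")]
HB.structure Definition NormedVector (K : numFieldType) :=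
  {V of NormedModule K V & Vector K V}.

(* The truncated free associative algebra on d generators. A tensor of degree
   k is given by its coordinates indexed by the words of length k, so an
   element is a function on words of length at most m; the product
   extends concatenation of words and kills the words longer than m. *)
Definition trunc_tensor (R : comNzRingType) (d m : nat) :=
  {ffun {bseq m of 'I_d} -> R^o}.

Definition coeff_tensor (R : comNzRingType) (d m : nat)
  (f : {bseq m of 'I_d} -> R) : trunc_tensor R d m := finfun f.

Section TruncTensor.
Context {R : comNzRingType} {d m : nat}.
Local Notation T := (trunc_tensor R d m).
Implicit Types (a b c : T) (w : {bseq m of 'I_d}).

HB.instance Definition _ := GRing.Lmodule.on T.

Definition tone : T := [ffun w : {bseq m of 'I_d} => (size w == 0%N)%:R].

Definition tmul a b : T :=
  [ffun w : {bseq m of 'I_d} =>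
    \sum_(u : {bseq m of 'I_d}) \sum_(v : {bseq m of 'I_d} |
      u ++ v == w :> seq _) a u * b v].

Lemma tmulA : associative tmul.
Proof.
move=> a b c; apply/ffunP => w; rewrite !ffunE.
pose F (u v x : {bseq m of 'I_d}) := a u * (b v * c x).
transitivity (\sum_(u : {bseq m of 'I_d})
  \sum_(v : {bseq m of 'I_d}) \sum_(x : {bseq m of 'I_d} | u ++ v ++ x == w :> seq _) F u v x).
  apply: eq_bigr => u _.
  under eq_bigr => y _ do rewrite ffunE mulr_sumr.
  rewrite exchange_big; apply: eq_bigr => v _ /=.
  under eq_bigr => y _ do rewrite mulr_sumr.
  rewrite (exchange_big_dep xpredT) //= [RHS]big_mkcond; apply: eq_bigr => x _.
  case: ifP => /eqP e; last first.
    by rewrite big1 // => y /andP[/eqP uy /eqP vx]; case: e; rewrite vx.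
  have sz : (size (v ++ x) <= m)%N.
    by rewrite (leq_trans _ (size_bseq w)) // -e [X in (_ <= X)%N]size_cat leq_addl.
  rewrite (big_pred1 (Bseq sz)) // => y /=; rewrite -val_eqE /= andbC eq_sym.
  by case: eqP => //= ->; rewrite e eqxx.
symmetry; under eq_bigr => y _ do under eq_bigr => x _ do rewrite ffunE mulr_suml.
under eq_bigr => y _ do rewrite exchange_big.
rewrite exchange_big; apply: eq_bigr => u _ /=.
under eq_bigr => y _ do under eq_bigr => x _ do rewrite mulr_suml.
under eq_bigr => y _ do rewrite (exchange_big_dep xpredT) //=.
rewrite exchange_big; apply: eq_bigr => v _ /=.
rewrite (exchange_big_dep xpredT) //= [RHS]big_mkcond; apply: eq_bigr => x _.
case: ifP => /eqP e; last first.
  by rewrite big1 // => y /andP[/eqP yx /eqP uv]; case: e; rewrite catA uv.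
have sz : (size (u ++ v) <= m)%N.
  by rewrite (leq_trans _ (size_bseq w)) // -e catA [X in (_ <= X)%N]size_cat leq_addr.
rewrite (big_pred1 (Bseq sz)) /F ?mulrA // => y /=; rewrite -val_eqE /= andbC eq_sym.
by case: eqP => //= ->; rewrite -catA e eqxx.
Qed.

Lemma tmul1l : left_id tone tmul.
Proof.
move=> a; apply/ffunP => w; rewrite ffunE (bigD1 [bseq]) //=.
rewrite (big_pred1 w) => [|v]; last by rewrite /= -val_eqE.
rewrite ffunE eqxx mul1r big1 ?addr0 // => u un0.
rewrite big1 // => v _; rewrite ffunE; case: eqP => [/size0nil u0|_].
  by case/eqP: un0; apply: val_inj.
by rewrite mul0r.
Qed.

Lemma tmul1r : right_id tone tmul.
Proof.
move=> a; apply/ffunP => w; rewrite ffunE (exchange_big_dep xpredT) //=.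
rewrite (bigD1 [bseq]) //= (big_pred1 w) => [|v]; last first.
  by rewrite /= cats0 -val_eqE.
rewrite ffunE eqxx mulr1 big1 ?addr0 // => u un0.
rewrite big1 // => v _; rewrite ffunE; case: eqP => [/size0nil u0|_].
  by case/eqP: un0; apply: val_inj.
by rewrite mulr0.
Qed.

Lemma tmulDl : left_distributive tmul +%R.
Proof.
move=> a b c; apply/ffunP => w; rewrite !ffunE -big_split.
by apply: eq_bigr => u _; rewrite -big_split; apply: eq_bigr => v _;
  rewrite ffunE mulrDl.
Qed.

Lemma tmulDr : right_distributive tmul +%R.
Proof.
move=> a b c; apply/ffunP => w; rewrite !ffunE -big_split.
by apply: eq_bigr => u _; rewrite -big_split; apply: eq_bigr => v _;
  rewrite ffunE mulrDr.
Qed.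

Lemma tone_neq0 : tone != 0.
Proof.
apply/eqP => /ffunP /(_ [bseq]); rewrite !ffunE => /eqP.
by rewrite oner_eq0.
Qed.

HB.instance Definition _ := GRing.Zmodule_isNzRing.Build T
  tmulA tmul1l tmul1r tmulDl tmulDr tone_neq0.

Lemma tscaleAl (k : R) (a b : T) : k *: (a * b) = (k *: a) * b.
Proof.
apply/ffunP => w; rewrite !ffunE scaler_sumr; apply: eq_bigr => u _.
rewrite scaler_sumr; apply: eq_bigr => v _.
by rewrite ffunE -scalerAl.
Qed.

HB.instance Definition _ := GRing.Lmodule_isLalgebra.Build R T tscaleAl.

Lemma tscaleAr (k : R) (a b : T) : k *: (a * b) = a * (k *: b).
Proof.
apply/ffunP => w; rewrite !ffunE scaler_sumr; apply: eq_bigr => u _.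
rewrite scaler_sumr; apply: eq_bigr => v _.
by rewrite ffunE -scalerAr.
Qed.

HB.instance Definition _ := GRing.Lalgebra_isAlgebra.Build R T tscaleAr.

(* Neumann series: the inverse of g when its degree-0 component is 1. *)
Definition tinv (g : T) : T := \sum_(k < m.+1) (1 - g) ^+ k.

Lemma tmulE (a b : T) : a * b = tmul a b. Proof. by []. Qed.

Lemma texp_nil (a : T) k w : a [bseq] = 0 -> (size w < k)%N -> (a ^+ k) w = 0.
Proof.
move=> a0; elim: k w => // k IH w; rewrite ltnS => wk.
rewrite exprS tmulE ffunE big1 // => u _; rewrite big1 // => v /eqP uvw.
have [u0|u0] := posnP (size u).
  by rewrite (_ : u = [bseq]) ?a0 ?mul0r //; apply/val_inj/size0nil.
rewrite IH ?mulr0 // (leq_trans _ wk) // -uvw size_cat.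
by rewrite -{1}(add0n (size v)) ltn_add2r.
Qed.

Lemma tinvP (g : T) : g [bseq] = 1 -> g * tinv g = 1 /\ tinv g * g = 1.
Proof.
move=> g1; pose x : T := 1 - g.
have gE : g = 1 - x by rewrite /x opprB addrC subrK.
have x0 : x ^+ m.+1 = 0.
  apply/ffunP => w; rewrite texp_nil ?ffunE ?ltnS ?size_bseq //.
  by rewrite g1 /= subrr.
have H : g * tinv g = 1.
  rewrite {1}gE -[1 - x]opprB mulNr.
  by rewrite -(subrX1 x m.+1) x0 sub0r opprK.
split => //; rewrite -{}H.
apply: commr_sym; apply: commr_sum => k _; apply: commrX.
by apply: commrB; [exact: commr1|exact: commr_refl].
Qed.

End TruncTensor.

Section RoughPaths.
Context {R : realType} {V : normedVectType R} {m : nat}.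

Local Notation dimV := (\dim {:V}).
Local Notation mu := (@lebesgue_measure R).

(* T^m(V) in the coordinates given by the basis vbasis {:V}: the word
   i_1 ... i_k stands for e_{i_1} (x) ... (x) e_{i_k}. *)
Local Notation T := (trunc_tensor R dimV m).

Definition vcoord (i : 'I_dimV) (v : V) : R := coord (vbasis {:V}) i v.

Definition tensor_of (v : V) : T :=
  coeff_tensor (fun w => if w : seq _ is [:: i] then vcoord i v else 0).

Definition lie_subalgebra (L : set T) :=
  [/\ L 0,
      (forall (k : R) a b, L a -> L b -> L (k *: a + b)) &
      (forall a b, L a -> L b -> L (a * b - b * a))].

Definition free_nilpotent_lie : set T :=
  smallest lie_subalgebra (range tensor_of).

Definition texp (a : T) : T := \sum_(k < m.+1) (k`!%:R)^-1 *: a ^+ k.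

Definition free_nilpotent_group : set T := texp @` free_nilpotent_lie.

Definition dilation (t : R) (g : T) : T :=
  coeff_tensor (fun w => t ^+ size w * g w).

(* Only the restriction of N to the group is constrained (and used). *)
Definition homogeneous_norm (N : T -> R) :=
  let G := free_nilpotent_group in
  [/\ (forall g, G g -> 0 <= N g),
      (forall g, G g -> N g = 0 <-> g = 1),
      (forall g t, G g -> N (dilation t g) = `|t| * N g),
      (forall g h, G g -> G h -> N (g * h) <= N g + N h) &
      (forall g, G g -> N (tinv g) = N g)].

(* Paths on [0, 1] are functions on R of which only the values on [0, 1]
   matter. The topology of the group is that of the finite-dimensional space
   T^m(V), so continuity is expressed coordinatewise. *)
Definition group_path (Y : R -> T) :=
  [/\ (forall t, 0 <= t <= 1 -> free_nilpotent_group (Y t)),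
      Y 0 = 1 &
      forall w, {within `[0, 1], continuous (fun t => Y t w)}].

Definition incr (Y : R -> T) (s t : R) : T := tinv (Y s) * Y t.

(* Smooth on the closed interval [0, 1]: restriction of a smooth map on R. *)
Definition smooth (y : R -> V) := forall n t, derivable (derive1n n y) t 1.

(* iter_integral y s [:: i_k; ...; i_1] t is the integral over
   s < u_1 < ... < u_k < t of dy^{i_1}_{u_1} ... dy^{i_k}_{u_k}:
   the outermost variable u_k comes first. *)
Fixpoint iter_integral (y : R -> V) (s : R) (w : seq 'I_dimV) (t : R) : R :=
  if w is i :: w' then
    \int[mu]_(u in `[s, t]) (iter_integral y s w' u * vcoord i (derive1 y u))
  else 1.

Definition signature (y : R -> V) (s t : R) : T :=
  coeff_tensor (fun w => iter_integral y s (rev w) t).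

Definition signature_path (y : R -> V) : R -> T := signature y 0.

(* The sum of F over consecutive points of the sequence a :: s. *)
Definition sum_consecutive {E : nmodType} (F : R -> R -> E) (a : R) (s : seq R)
    : E :=
  \sum_(0 <= i < size s) F (nth a (a :: s) i) (nth a (a :: s) i.+1).

Definition mesh (a : R) (s : seq R) : R :=
  \big[Num.max/0]_(0 <= i < size s)
    (nth a (a :: s) i.+1 - nth a (a :: s) i).

Section Variation.
Variables (N : T -> R) (p : R).

Definition gdist (g h : T) : R := N (tinv g * h).

Definition dpvar (x y : R -> T) : \bar R :=
  ereal_sup [set ((sum_consecutive
      (fun s t => gdist (incr x s t) (incr y s t) `^ p) 0 D) `^ p^-1)%:E
    | D in itv_partition 0 1].

Definition pvar (x : R -> T) : \bar R := dpvar x (fun=> 1).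

Definition Cpvar : set (R -> T) :=
  [set Y | group_path Y /\ (pvar Y < +oo)%E].

Definition C0pvar : set (R -> T) :=
  [set Y | group_path Y /\ forall e : R, 0 < e ->
     exists2 y : R -> V, smooth y & (dpvar Y (signature_path y) < e%:E)%E].

(* A pair u encodes the chain u_0 < ... < u_l with u.1 = u_0 and
   u.2 = [:: u_1; ...; u_l]; the endpoints s and t need not belong to it. *)
Definition delta_pvar (Y : R -> T) (s t : R) : \bar R :=
  ereal_sup [set (sum_consecutive
      (fun a b => N (incr Y a b) `^ p) u.1 u.2)%:E
    | u in [set u : R * seq R |
        [/\ s <= u.1, path <%R u.1 u.2 & last u.1 u.2 <= t]]].

(* Extended-real valued, so that the supremum is never a default value. *)
Definition mesh_sup (Y : R -> T) (delta : R) : \bar R :=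
  ereal_sup [set sum_consecutive (delta_pvar Y) 0 D
    | D in [set D | itv_partition 0 1 D /\ mesh 0 D <= delta]].

End Variation.

End RoughPaths.

(* Main.v *)
(* If Y is a limit of signatures S(y), then Y is, up to a small error in p-variation,
   Lipschitz for the homogeneous norm, and the sum of (t_{i+1} - t_i)^p vanishes with
   the mesh because p > 1.

   Conversely, replace Y on each interval of a subdivision D by the signature of a
   smooth path with the same increment and a comparable length. The distance of the
   increments of the two paths over [s, t] is bounded by their variations inside the
   intervals of D that contain s and t, whose p-th powers have a small sum by
   hypothesis, and by the norm of a conjugate h^-1 g h of a small element g by an
   increment h of Y. By homogeneity and compactness, for every eta there is C such
   that the norm of h^-1 g h is at most C |g| + eta |h|, and the p-th powers of |h|
   have a bounded sum.

   The paths come from Chow's theorem: modulo higher degrees, a commutator of curves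
   1 + l a + ... and 1 + b + ... is 1 + l [a, b] + ..., so that every element of the
   group is a product of exponentials of multiples of basis vectors, of total length
   controlled by its coordinates. This also shows that any homogeneous norm is
   continuous, hence comparable to the coordinates by compactness. *)

Require Import Defs.
From HB Require Import structures.
From mathcomp Require Import all_boot all_order all_algebra.
From mathcomp Require Import all_classical all_reals all_analysis.
From mathcomp Require Import lra ring zify.
Import Order.TTheory GRing.Theory Num.Theory.
Import numFieldNormedType.Exports.
Local Open Scope classical_set_scope.
Local Open Scope ring_scope.

Set Implicit Arguments.
Unset Strict Implicit.
Unset Printing Implicit Defensive.

(** * The truncated tensor algebra *)

(** The obstacle is that the norm of [h^-1 g h] is not bounded by a multiple of the norm of [g]: for
    fixed [h] and small [g] it can be as large as a root of it of order up to [m], and such roots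
    need not have summable p-th powers. A bound linear in [g] has to be paid for with a small
    multiple of the norm of [h], which is affordable because the cost is bounded by the p-variation
    of [Y] whatever the subdivision. This forces the order of the choices: [eta] from the precision
    and the p-variation, then [C], and only then the subdivision.

    Superadditive quantities are always replaced by the increments [H t - H s] of a nondecreasing
    function, so that sums over arbitrary subdivisions telescope.

    The group is given only as a set of exponentials. Its stability under products comes from linear
    differential equations instead of the Campbell-Hausdorff formula: a solution driven by the Lie
    algebra and starting in the group stays in it. Signatures solve the same kind of equation, so
    the same uniqueness and growth lemmas serve for them. *)

Section Graded.
Context {R : comNzRingType} {d m : nat}.
Local Notation T := (trunc_tensor R d m).
Implicit Types (a b c x y z : T) (w u v : {bseq m of 'I_d}).

Fact btakeP k w : (size (take k w) <= m)%N.
Proof. by rewrite size_take_min (leq_trans (geq_minr _ _)) ?size_bseq. Qed.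
Definition btake k w : {bseq m of 'I_d} := Bseq (btakeP k w).

Fact bdropP k w : (size (drop k w) <= m)%N.
Proof. by rewrite size_drop (leq_trans (leq_subr _ _)) ?size_bseq. Qed.
Definition bdrop k w : {bseq m of 'I_d} := Bseq (bdropP k w).

(** A factorization of a word is determined by the length of its first factor, so the sum over pairs
    of words is a sum over cut positions. *)
Lemma tmul_coef a b w : (a * b) w =
  \sum_(k < (size w).+1) a (btake k w) * b (bdrop k w).
Proof.
rewrite tmulE ffunE pair_big_dep /=.
rewrite (reindex_onto (fun k : 'I_(size w).+1 =>
  (btake k w, bdrop k w))
  (fun q : {bseq m of 'I_d} * {bseq m of 'I_d} => inord (size q.1))) /=.
  apply: eq_bigl => k; rewrite cat_take_drop eqxx /= size_takel ?inord_val ?eqxx //.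
  by rewrite -ltnS.
move=> [u v] /= /eqP uvw.
have su : (size u < (size w).+1)%N by rewrite -uvw size_cat ltnS leq_addr.
by congr pair; apply/val_inj; rewrite /= inordK // -uvw ?take_size_cat ?drop_size_cat.
Qed.

Lemma tone_coef w : (1 : T) w = (size w == 0%N)%:R.
Proof. by rewrite ffunE. Qed.

Lemma tadd_coef a b w : (a + b) w = a w + b w. Proof. by rewrite ffunE. Qed.
Lemma topp_coef a w : (- a) w = - a w. Proof. by rewrite ffunE. Qed.
Lemma tzero_coef w : (0 : T) w = 0. Proof. by rewrite ffunE. Qed.
Lemma tscale_coef (k : R) a w : (k *: a) w = k * a w. Proof. by rewrite ffunE. Qed.
Lemma tsum_coef (I : Type) (r : seq I) (P : pred I) (F : I -> T) w :
  (\sum_(i <- r | P i) F i) w = \sum_(i <- r | P i) F i w.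
Proof.
by apply: (big_morph (fun a : T => a w)) => [a b|]; rewrite ?tadd_coef ?tzero_coef.
Qed.

Definition tcoefE := (tadd_coef, topp_coef, tzero_coef, tscale_coef, tone_coef,
  tsum_coef).

Lemma coeff_tensorE (f : {bseq m of 'I_d} -> R) w : coeff_tensor f w = f w.
Proof. by rewrite ffunE. Qed.

(** The ideals of the filtration by degree. Their indices add under products and [tge m.+1] is zero,
    which ends every induction on the degree. *)
Definition tge (n : nat) : set T := [set a | forall w, (size w < n)%N -> a w = 0].

Lemma tge_lin n (k : R) a b : tge n a -> tge n b -> tge n (k *: a + b).
Proof. by move=> ha hb w wn; rewrite !tcoefE ha // hb // mulr0 addr0. Qed.

Lemma tge0 n : tge n 0. Proof. by move=> w _; rewrite tzero_coef. Qed.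

Lemma tgeD n a b : tge n a -> tge n b -> tge n (a + b).
Proof. by move=> ha hb; rewrite -[a]scale1r; exact: tge_lin. Qed.

Lemma tgeZ n k a : tge n a -> tge n (k *: a).
Proof. by move=> ha; rewrite -[_ *: _]addr0; apply: tge_lin => //; exact: tge0. Qed.

Lemma tgeN n a : tge n a -> tge n (- a).
Proof. by rewrite -scaleN1r; exact: tgeZ. Qed.

Lemma tgeB n a b : tge n a -> tge n b -> tge n (a - b).
Proof. by move=> ha /tgeN; exact: tgeD. Qed.

Lemma tge_sum n (I : Type) (r : seq I) (P : pred I) (F : I -> T) :
  (forall i, P i -> tge n (F i)) -> tge n (\sum_(i <- r | P i) F i).
Proof. by move=> h; apply: big_ind => //; [exact: tge0|exact: tgeD]. Qed.

Lemma tgeM i j a b : tge i a -> tge j b -> tge (i + j) (a * b).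
Proof.
move=> ha hb w wij; rewrite tmul_coef big1 // => k _.
have [ki|ki] := ltnP k i.
  by rewrite ha ?mul0r //= size_take_min (leq_ltn_trans (geq_minl _ _)).
by rewrite hb ?mulr0 //= size_drop; have := ltn_ord k; lia.
Qed.

Lemma tge_le i j a : (i <= j)%N -> tge j a -> tge i a.
Proof. by move=> ij ha w wi; apply: ha; exact: leq_trans ij. Qed.

Lemma tgeMl i a b : tge i a -> tge i (a * b).
Proof. by move=> ha; rewrite -[i]addn0; apply: tgeM. Qed.

Lemma tgeMr i a b : tge i b -> tge i (a * b).
Proof. by move=> ha; rewrite -[i]add0n; apply: tgeM. Qed.

Lemma tge_eq0 i a : (m < i)%N -> tge i a -> a = 0.
Proof.
by move=> mi ha; apply/ffunP => w; rewrite ha ?tzero_coef // (leq_ltn_trans (size_bseq w)).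
Qed.

Lemma tge1P a : tge 1 a <-> a [bseq] = 0.
Proof.
split=> [->//|a0 w]; rewrite ltnS leqn0 => /eqP/size0nil w0.
by rewrite (_ : w = [bseq]) //; exact: val_inj.
Qed.

Lemma tgeX a k : tge 1 a -> tge k (a ^+ k).
Proof. by move=> /tge1P a0 w; exact: texp_nil. Qed.

Lemma coef_nil_mul a b : (a * b) [bseq] = a [bseq] * b [bseq].
Proof.
rewrite tmul_coef /= big_ord1 /=; congr (_ * _); congr fun_of_fin; exact: val_inj.
Qed.

Lemma tgeB1 a : tge 1 (a - 1) <-> a [bseq] = 1.
Proof.
rewrite tge1P !tcoefE /=; split; first by move/subr0_eq.
by move=> ->; rewrite subrr.
Qed.

Definition tproj (n : nat) (a : T) : T :=
  coeff_tensor (fun w => if size w == n then a w else 0).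

Lemma tproj_coef n a w : tproj n a w = if size w == n then a w else 0.
Proof. exact: coeff_tensorE. Qed.

Lemma tproj_lin n (k : R) a b : tproj n (k *: a + b) = k *: tproj n a + tproj n b.
Proof.
by apply/ffunP => w; rewrite !(tcoefE, tproj_coef); case: ifP; rewrite // mulr0 addr0.
Qed.

Lemma tproj_sub n a : tge n a -> tge n.+1 (a - tproj n a).
Proof.
move=> ha w; rewrite ltnS leq_eqVlt !tcoefE tproj_coef => /orP[->|wn].
  by rewrite subrr.
by rewrite ha // ltn_eqF // subrr.
Qed.

Lemma tproj_eq n a b : tge n.+1 (a - b) -> tproj n a = tproj n b.
Proof.
move=> h; apply/ffunP => w; rewrite !tproj_coef; case: eqP => // wn.
by have := h w; rewrite wn !tcoefE => /(_ (ltnSn n)) /subr0_eq.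
Qed.

Lemma tprojM n a b : tproj n (a * b) = \sum_(k < n.+1) tproj k a * tproj (n - k) b.
Proof.
apply/ffunP => w; rewrite tproj_coef !tcoefE; case: eqP => [wn|wn]; last first.
  rewrite big1 // => i _; rewrite tmul_coef big1 // => k _.
  rewrite !tproj_coef /= size_takel -1?ltnS // size_drop.
  case: eqP => [e|]; last by rewrite mul0r.
  case: eqP; last by rewrite mulr0.
  by have := ltn_ord i; have := ltn_ord k; move: e wn; clear; lia.
rewrite tmul_coef wn; apply: eq_bigr => k _.
rewrite tmul_coef.
have kw : (k < (size w).+1)%N by rewrite wn.
rewrite (bigD1 (Ordinal kw)) //= [X in _ = _ + X]big1 ?addr0.
  by rewrite !tproj_coef /= size_takel -1?ltnS // size_drop wn !eqxx.
move=> i /eqP ik; rewrite !tproj_coef /= size_takel -1?ltnS //.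
case: eqP => [e|]; last by rewrite mul0r.
by case: ik; apply/val_inj.
Qed.

Lemma tinvV (g : T) : g [bseq] = 1 -> g * tinv g = 1.
Proof. by case/tinvP. Qed.
Lemma tVinv (g : T) : g [bseq] = 1 -> tinv g * g = 1.
Proof. by case/tinvP. Qed.
Lemma tinv_uniq (g h : T) : g [bseq] = 1 -> g * h = 1 -> tinv g = h.
Proof.
by move=> g1 gh; rewrite -[tinv g]mulr1 -gh mulrA tVinv // mul1r.
Qed.
Lemma tinv_nil (g : T) : g [bseq] = 1 -> tinv g [bseq] = 1.
Proof.
move=> g1; have := congr1 (fun a : T => a [bseq]) (tinvV g1).
by rewrite /= coef_nil_mul g1 mul1r tone_coef.
Qed.
Lemma tinvK (g : T) : g [bseq] = 1 -> tinv (tinv g) = g.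
Proof. by move=> g1; apply: tinv_uniq; [exact: tinv_nil|exact: tVinv]. Qed.
Lemma tinvM (g h : T) : g [bseq] = 1 -> h [bseq] = 1 ->
  tinv (g * h) = tinv h * tinv g.
Proof.
move=> g1 h1; apply: tinv_uniq; first by rewrite coef_nil_mul g1 h1 mulr1.
by rewrite -mulrA (mulrA h) tinvV // mul1r tinvV.
Qed.
Lemma tinv1 : tinv (1 : T) = 1.
Proof. by apply: tinv_uniq; rewrite ?mulr1 ?tone_coef. Qed.

End Graded.

(** * Exponential and logarithm *)

Section ExpLogPoly.
Context {R : numFieldType} (m : nat).

(** The series are handled as polynomials in one commuting variable: composition identities hold
    there modulo ['X^m.+1], and evaluation at a tensor without constant term, whose powers above [m]
    vanish, carries them to the tensor algebra. *)
Definition exp_poly : {poly R} := \poly_(k < m.+1) (k`!%:R)^-1.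
(* The coefficient of degree 0 is 0 because 0^-1 = 0. *)
Definition log_poly : {poly R} := \poly_(k < m.+1) (- (-1) ^+ k / k%:R).

Lemma factor_X (p : {poly R}) : p`_0 = 0 -> exists q, p = q * 'X.
Proof.
rewrite -horner_coef0 => p0.
have /factor_theorem[q ->] : root p 0 by apply/eqP.
by exists q; rewrite subr0.
Qed.

Lemma exp_poly_deriv : exp_poly^`() = exp_poly - (m`!%:R)^-1 *: 'X^m.
Proof.
apply/polyP => k; rewrite coef_deriv coefB coefZ coefXn !coef_poly ltnS.
case: (ltngtP k m) => km.
- rewrite ltnW // mulr0 subr0 -[LHS]mulr_natr factS (natrM _ k.+1) invfM.
  by rewrite mulrAC mulVf ?mul1r // pnatr_eq0.
- by rewrite mul0rn mulr0 subr0 ltnS leqNgt km.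
- by rewrite km ltnSn mulr1 subrr mul0rn.
Qed.

Lemma exprNX i : (- 'X) ^+ i = ((-1) ^+ i)%:P * 'X^i :> {poly R}.
Proof. by rewrite polyC_exp polyCN exprNn. Qed.

Lemma log_poly_deriv : (1 + 'X) * log_poly^`() = 1 - (- 'X) ^+ m.
Proof.
have -> : log_poly^`() = \sum_(i < m) (- 'X) ^+ i.
  apply/polyP => k; rewrite coef_deriv coef_poly coef_sum ltnS.
  under eq_bigr => i _ do rewrite exprNX coefCM coefXn.
  case: ltnP => km.
    rewrite (bigD1 (Ordinal km)) //= eqxx mulr1 big1 ?addr0.
      rewrite -[LHS]mulr_natr -mulrA mulVf ?mulr1 ?pnatr_eq0 //.
      by rewrite exprS mulN1r opprK.
    move=> i /eqP ik; case: eqP => [e|]; last by rewrite mulr0.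
    by case: ik; apply/val_inj.
  rewrite mul0rn big1 // => i _; rewrite eq_sym ltn_eqF ?mulr0 //.
  exact: leq_trans km.
have := subrX1 (- 'X : {poly R}) m; rewrite -opprB -[X in X * _]opprB mulNr.
by move/oppr_inj => ->; rewrite opprK.
Qed.

Lemma coef_low (p q : {poly R}) n k : (k < n)%N -> (p * q * 'X^n)`_k = 0.
Proof. by move=> kn; rewrite coefMXn kn. Qed.

Lemma exp_log_poly k : (k <= m)%N -> (exp_poly \Po log_poly)`_k = (1 + 'X)`_k.
Proof.
set F := _ \Po _.
have L0 : log_poly`_0 = 0 by rewrite coef_poly /= invr0 mulr0.
have F0 : F`_0 = 1.
  rewrite -horner_coef0 horner_comp horner_coef0 L0 horner_coef0 coef_poly /=.
  by rewrite fact0 invr1.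
have [q qE] := factor_X L0.
have rec j : (j < m)%N -> F`_j.+1 *+ j.+1 + F`_j *+ j = F`_j.
  move=> jm.
  have /(congr1 (fun p : {poly R} => p`_j)) : (1 + 'X) * F^`() = F + (- (- 1) ^+ m) *: (1 * F * 'X^m) -
      (m`!%:R)^-1 *: ((1 + 'X) * log_poly^`() * q ^+ m * 'X^m).
    rewrite /F deriv_comp exp_poly_deriv comp_polyB comp_polyZ comp_Xn_poly -/F.
    have LmE : log_poly ^+ m = q ^+ m * 'X^m by rewrite {1}qE exprMn.
    rewrite mulrCA LmE log_poly_deriv exprNX -!mul_polyC.
    by ring.
  rewrite mulrDl mul1r coefD coefXM !coef_deriv.
  rewrite coefB coefD !coefZ !coef_low // !mulr0 addr0 subr0.
  by case: j jm => [|j] jm /=; rewrite ?mulr0n // addr0.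
have two j : j.+1%:R != 0 :> R by rewrite pnatr_eq0.
have F1 : (0 < m)%N -> F`_1 = 1 by move/rec; rewrite mulr1n mulr0n addr0 F0.
have F2 j : (j.+2 <= m)%N -> F`_j.+2 = 0.
  elim: j => [|j IH] jm.
    have := rec 1%N jm; rewrite F1 1?ltnW // mulr1n => /eqP.
    rewrite -subr_eq0 addrK -mulr_natr mulf_eq0 (negbTE (two _)) orbF.
    by move/eqP.
  have := rec j.+2 jm; rewrite IH 1?ltnW // mul0rn addr0 => /eqP.
  by rewrite -mulr_natr mulf_eq0 (negbTE (two _)) orbF => /eqP.
case: k => [|[|k]] km; rewrite coefD coef1 coefX /= ?addr0 ?add0r //.
- exact: F1.
- exact: F2.
Qed.

(** Modulo ['X^m], [exp_poly] is its own derivative and [G] is its inverse, so the composite has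
    derivative 1. *)
Lemma log_exp_poly k : (k <= m)%N -> (log_poly \Po (exp_poly - 1))`_k = 'X`_k.
Proof.
set F := _ \Po _.
have E0 : (exp_poly - 1)`_0 = 0.
  by rewrite coefB coef1 coef_poly /= fact0 invr1 subrr.
have [q qE] := factor_X E0.
case: k => [_|k km].
  rewrite -horner_coef0 horner_comp horner_coef0 E0 horner_coef0 coef_poly /=.
  by rewrite invr0 mulr0 coefX.
pose G := log_poly^`() \Po (exp_poly - 1).
have GE : exp_poly * G = 1 - ((- 1) ^+ m)%:P * (q ^+ m * 'X^m).
  have := congr1 (fun p => p \Po (exp_poly - 1)) log_poly_deriv.
  rewrite /= comp_polyM comp_polyD comp_polyX comp_polyB exprNX comp_polyM.
  rewrite !comp_polyC comp_Xn_poly addrC subrK -/G => ->.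
  by rewrite {1}qE exprMn.
have : F^`() = 1 - ((- 1) ^+ m)%:P * q ^+ m * 'X^m - (m`!%:R)^-1%:P * G * 'X^m.
  rewrite /F deriv_comp -/G derivB derivC subr0 exp_poly_deriv mulrBr mulrC GE.
  by rewrite -!mul_polyC; ring.
move=> /(congr1 (fun p : {poly R} => p`_k)).
rewrite coef_deriv !coefB !coef_low // !subr0 coef1 coefX eqSS.
case: k km => [|k] _; rewrite ?mulr1n //= => /eqP.
by rewrite -[X in X == _]mulr_natr mulf_eq0 pnatr_eq0 orbF => /eqP.
Qed.

End ExpLogPoly.

Section CommutatorPower.
Context {A : nzRingType}.
Implicit Types Z W : A.

(** The opposite of the usual bracket: with this sign the derivative of the exponential, with the
    exponential factored out on the left, has no alternating signs. *)
Definition adj Z W := W * Z - Z * W.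

(** The left side is the derivative of [Z ^+ k] in the direction [W]. The powers of [Z] are moved to
    the left by [X * Z = Z * X + adj Z X], and Pascal's rule collects the coefficients. *)
Lemma deriv_power Z W k : \sum_(i < k) Z ^+ i * W * Z ^+ (k.-1 - i) =
  \sum_(j < k) (Z ^+ (k.-1 - j) * iter j (adj Z) W) *+ 'C(k, j.+1).
Proof.
elim: k => [|k IH]; first by rewrite !big_ord0.
rewrite big_ord_recr /= subnn expr0 mulr1.
have -> : \sum_(i < k) Z ^+ i * W * Z ^+ (k - i) =
    (\sum_(i < k) Z ^+ i * W * Z ^+ (k.-1 - i)) * Z.
  rewrite mulr_suml; apply: eq_bigr => i _; rewrite -[RHS]mulrA -exprSr.
  by congr (_ * Z ^+ _); have := ltn_ord i; lia.
rewrite {}IH mulr_suml.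
have -> : \sum_(j < k) (Z ^+ (k.-1 - j) * iter j (adj Z) W) *+ 'C(k, j.+1) * Z =
    \sum_(j < k) (Z ^+ (k - j.+1) * iter j.+1 (adj Z) W) *+ 'C(k, j.+1) +
    \sum_(j < k) (Z ^+ (k - j) * iter j (adj Z) W) *+ 'C(k, j.+1).
  rewrite -big_split; apply: eq_bigr => j _ /=.
  rewrite mulrnAl -mulrnDl; congr (_ *+ _).
  have -> : (k - j = (k.-1 - j).+1)%N by have := ltn_ord j; lia.
  have -> : (k - j.+1 = k.-1 - j)%N by have := ltn_ord j; lia.
  by rewrite exprSr /adj mulrBr -!mulrA subrK.
under [RHS]eq_bigr => j _ do rewrite binS mulrnDr.
rewrite [RHS]big_split /= [X in _ = X + _]big_ord_recr [X in _ = _ + X]big_ord_recl /=.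
rewrite bin_small // mulr0n addr0 bin0 mulr1n subn0.
by rewrite -addrA addrC -addrA.
Qed.

End CommutatorPower.

Section ExpLog.
Context {R : numFieldType} {d m : nat}.
Local Notation T := (trunc_tensor R d m).
Implicit Types (a b g Z W : T).

(** [texp] over an arbitrary alphabet and field, so that the algebra below does not involve [V]. *)
Definition texpn a : T := \sum_(k < m.+1) (k`!%:R)^-1 *: a ^+ k.
Definition tlog g : T := \sum_(k < m.+1) (- (-1) ^+ k / k%:R) *: (g - 1) ^+ k.

Lemma horner_alg_poly n (f : nat -> R) a :
  horner_alg a (\poly_(k < n) f k) = \sum_(k < n) f k *: a ^+ k.
Proof.
rewrite poly_def rmorph_sum /=; apply: eq_bigr => k _.
by rewrite linearZ /= rmorphXn /= horner_algX mulr_algl.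
Qed.

Lemma horner_alg_comp (p q : {poly R}) a :
  horner_alg a (p \Po q) = horner_alg (horner_alg a q) p.
Proof.
elim/poly_ind: p => [|p c IH]; first by rewrite comp_poly0 !rmorph0.
by rewrite comp_poly_MXaddC !rmorphD !rmorphM /= IH horner_algX !horner_algC.
Qed.

Lemma horner_alg_low (p q : {poly R}) a : tge 1 a ->
  (forall k, (k <= m)%N -> p`_k = q`_k) -> horner_alg a p = horner_alg a q.
Proof.
move=> a1 pq; apply/eqP; rewrite -subr_eq0 -rmorphB /=; apply/eqP.
rewrite -[p - q]coefK (horner_alg_poly _ (fun k => (p - q)`_k)) big1 // => k _.
have [km|km] := leqP k m; first by rewrite coefB pq // subrr scale0r.
by rewrite (tge_eq0 km (tgeX a1)) scaler0.
Qed.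

Lemma texpE a : texpn a = horner_alg a (exp_poly m).
Proof. by rewrite (horner_alg_poly _ (fun k => _)). Qed.

Lemma tlogE g : tlog g = horner_alg (g - 1) (log_poly m).
Proof. by rewrite (horner_alg_poly _ (fun k => _)). Qed.

Lemma tlogK g : g [bseq] = 1 -> texpn (tlog g) = g.
Proof.
move=> /tgeB1 g1; rewrite texpE tlogE -horner_alg_comp.
rewrite (horner_alg_low g1 (exp_log_poly (m := m))).
by rewrite rmorphD rmorph1 /= horner_algX addrC subrK.
Qed.

Lemma texpK a : tge 1 a -> tlog (texpn a) = a.
Proof.
move=> a1; rewrite texpE tlogE.
have -> : horner_alg a (exp_poly m) - 1 = horner_alg a (exp_poly m - 1).
  by rewrite rmorphB rmorph1.
by rewrite -horner_alg_comp (horner_alg_low a1 (log_exp_poly (m := m))) horner_algX.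
Qed.

Lemma texp_tail n a : (0 < n)%N -> tge n a -> tge n.+1 (texpn a - 1 - a).
Proof.
move=> n0 an; have a1 := tge_le n0 an.
case: (posnP m) => m0.
  have mn : (m < n)%N by rewrite m0.
  rewrite (tge_eq0 mn an) /texpn big_ord_recl m0 big_ord0 /= expr0 fact0 invr1.
  by rewrite scale1r addr0 subrr subr0; exact: tge0.
have -> : texpn a - 1 - a = \sum_(i < m.-1) (i.+2`!%:R)^-1 *: a ^+ i.+2.
  rewrite /texpn.
  rewrite -(big_mkord xpredT (fun k => (k`!%:R)^-1 *: a ^+ k)) big_ltn //.
  rewrite big_ltn // !fact0 !factS !invr1 !scale1r expr0 expr1.
  rewrite [1 + _]addrC addrK addrC addKr.
  by rewrite !big_add1 /= big_mkord.
apply: tge_sum => i _; apply: tgeZ; rewrite 2!exprS mulrA.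
apply: tgeMl; apply: (@tge_le _ _ _ _ (n + n)); last exact: tgeM.
by rewrite -addn1 leq_add2l.
Qed.

Lemma texpn_nil a : tge 1 a -> texpn a [bseq] = 1.
Proof.
move=> a1; apply/tgeB1; rewrite -[_ - 1](subrK a).
by apply: tgeD => //; apply: (@tge_le _ _ _ _ 2) => //; exact: texp_tail.
Qed.

Lemma tlog_ge g : g [bseq] = 1 -> tge 1 (tlog g).
Proof.
move=> /tgeB1 g1; apply: tge_sum => -[[|k] km] _ /=.
  by rewrite invr0 mulr0 scale0r; exact: tge0.
by apply: tgeZ; rewrite exprS; exact: tgeMl.
Qed.

Lemma tlog_geN n g : (0 < n)%N -> tge n (g - 1) -> tge n (tlog g).
Proof.
move=> n0 g1; apply: tge_sum => -[[|k] km] _ /=.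
  by rewrite invr0 mulr0 scale0r; exact: tge0.
by apply: tgeZ; rewrite exprS; exact: tgeMl.
Qed.

(** Put [k = i + j + 1] in [deriv_power]: the binomial coefficient divided by [k!] splits into
    [1 / (i! (j+1)!)]. The terms with [i + j >= m] vanish by degree, so the triangular sum extends
    to a rectangle, which is a product. *)
Lemma texp_deriv Z W : tge 1 Z -> tge 1 W ->
  \sum_(k < m.+1) (k`!%:R)^-1 *: \sum_(i < k) Z ^+ i * W * Z ^+ (k.-1 - i) =
  texpn Z * \sum_(j < m.+1) (j.+1`!%:R)^-1 *: iter j (adj Z) W.
Proof.
move=> Z1 W1.
have adW j : tge j.+1 (iter j (adj Z) W).
  elim: j => [|j IH] //=; rewrite /adj; apply: tgeB.
    by rewrite -addn1; apply: tgeM.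
  by rewrite -add1n; apply: tgeM.
pose f i j : T := ((i`!%:R)^-1 * (j.+1`!%:R)^-1) *: (Z ^+ i * iter j (adj Z) W).
transitivity (\sum_(0 <= k < m.+1) \sum_(0 <= j < m.+1 | (j < k)%N) f (k.-1 - j)%N j).
  rewrite big_mkord; apply: eq_bigr => k _.
  rewrite deriv_power scaler_sumr (big_ord_widen_cond m.+1 xpredT
    (fun j => (k`!%:R)^-1 *: (Z ^+ (k.-1 - j) * iter j (adj Z) W *+ 'C(k, j.+1))));
    last by rewrite ltnW.
  rewrite big_mkord; apply: eq_bigr => j /= jk.
  rewrite /f -[_ *+ 'C(_, _)]scaler_nat scalerA; congr (_ *: _).
  rewrite -(bin_fact jk) (_ : k - j.+1 = k.-1 - j)%N; last by case: (k : nat) jk.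
  rewrite !natrM !invfM mulrAC mulVf ?mul1r 1?mulrC //.
  by rewrite pnatr_eq0 -lt0n bin_gt0.
rewrite (exchange_big_dep_nat xpredT) //=.
rewrite mulr_sumr -(big_mkord xpredT (fun j => texpn Z * ((j.+1`!%:R)^-1 *: iter j (adj Z) W))).
rewrite big_nat_cond [RHS]big_nat_cond; apply: eq_bigr => j; rewrite andbT => /andP[_ jm].
transitivity (\sum_(0 <= i < m - j) f i j).
  transitivity (\sum_(j.+1 <= i < m.+1) f (i.-1 - j)%N j).
    by rewrite (big_nat_widenl j.+1 0).
  rewrite -{1}(add0n j.+1) big_addn subSS; apply: eq_bigr => i _.
  by congr f; rewrite addnS /= addnK.
transitivity (\sum_(0 <= i < m.+1) f i j).
  have jm1 : (m - j <= m.+1)%N by rewrite (leq_trans (leq_subr _ _)) ?leqnSn.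
  rewrite (big_cat_nat (leq0n _) jm1) /=.
  rewrite [X in _ + X]big1_seq ?addr0 // => i /andP[_]; rewrite mem_index_iota.
  move=> /andP[ij _].
  have ij' : (m < i + j.+1)%N by move: ij; rewrite leq_subLR addnS ltnS addnC.
  by rewrite /f (tge_eq0 ij' (tgeM (tgeX Z1) (adW j))) scaler0.
rewrite /texpn mulr_suml big_mkord; apply: eq_bigr => i _.
by rewrite /f -scalerAl -scalerAr scalerA.
Qed.
End ExpLog.

(** * Linear subspaces in coordinates *)

Section LinearSet.
Context {R : realType} {I : finType}.
Local Notation F := {ffun I -> R^o}.

Definition lin_set {V : lmodType R} (L : set V) :=
  L 0 /\ forall (k : R) a b, L a -> L b -> L (k *: a + b).

Lemma ffun_delta_sum (a : F) :
  a = \sum_w a w *: ([ffun u => (u == w)%:R] : F).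
Proof.
apply/ffunP => u; rewrite sum_ffunE (bigD1 u) //= big1 ?addr0.
  by rewrite !ffunE eqxx; exact/esym/mulr1.
by move=> w wu; rewrite !ffunE eq_sym (negbTE wu); exact: mulr0.
Qed.

(** A vector space of maximal dimension inside [L] exhausts [L]. The coefficients are written as
    explicit linear forms in the entries of [a], so that their bounds and continuity are visible. *)
Lemma ffun_basis (L : set F) : lin_set L ->
  exists n (Y : 'I_n -> F) (C : 'I_n -> I -> R), (forall i, L (Y i)) /\
    forall a, L a -> a = \sum_i (\sum_w C i w * a w) *: Y i.
Proof.
move=> [L0 Llin].
pose P n := `[< exists U : {vspace F}, \dim U = n /\ forall a, a \in U -> L a >].
have exP : exists n, P n.
  exists 0%N; apply/asboolP; exists 0%VS; split; first exact: dimv0.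
  by move=> a; rewrite memv0 => /eqP ->.
have ubP n : P n -> (n <= \dim {:F})%N.
  by move=> /asboolP[U [<- _]]; apply: dimvS; exact: subvf.
case: (ex_maxnP exP ubP) => n /asboolP[U [Un UL]] nmax.
have LU a : L a -> a \in U.
  move=> La; have : P (\dim (U + <[a]>)%VS).
    apply/asboolP; exists (U + <[a]>)%VS; split => // x /memv_addP[y yU [z /vlineP[k ->] ->]].
    by rewrite addrC; apply: Llin => //; exact: UL.
  move/nmax; rewrite -Un => dimle.
  have /eqP -> : U == (U + <[a]>)%VS by rewrite eqEdim addvSl.
  by rewrite memvE addvSr.
exists (\dim U), (fun i => (vbasis U)`_i),
  (fun i w => coord (vbasis U) i ([ffun u => (u == w)%:R] : F)); split.
  by move=> i; apply: UL; apply: vbasis_mem; rewrite mem_nth // size_tuple.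
move=> a /LU aU; rewrite {1}(coord_vbasis aU); apply: eq_bigr => i _.
congr (_ *: _); rewrite {1}(ffun_delta_sum a) linear_sum; apply: eq_bigr => w _.
by rewrite linearZ /= mulrC.
Qed.

End LinearSet.

Section TensorLinear.
Context {R : realType} {d m : nat}.
Local Notation T := (trunc_tensor R d m).

Lemma tensor_basis (L : set T) : lin_set L ->
  exists n (Y : 'I_n -> T) (C : 'I_n -> {bseq m of 'I_d} -> R), (forall i, L (Y i)) /\
    forall a, L a -> a = \sum_i (\sum_w C i w * a w) *: Y i.
Proof. exact: ffun_basis. Qed.

Lemma lin_setD (L : set T) a b : lin_set L -> L a -> L b -> L (a + b).
Proof. by move=> [_ h] La Lb; rewrite -[a]scale1r; exact: h. Qed.
Lemma lin_setZ (L : set T) (k : R) a : lin_set L -> L a -> L (k *: a).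
Proof. by move=> [L0 h] La; rewrite -[_ *: _]addr0; exact: h. Qed.
Lemma lin_setN (L : set T) a : lin_set L -> L a -> L (- a).
Proof. by move=> hL La; rewrite -scaleN1r; exact: lin_setZ. Qed.
Lemma lin_setB (L : set T) a b : lin_set L -> L a -> L b -> L (a - b).
Proof. by move=> hL La Lb; apply: lin_setD => //; exact: lin_setN. Qed.
Lemma lin_set_sum (L : set T) (J : Type) (r : seq J) (P : pred J) (F : J -> T) :
  lin_set L -> (forall i, P i -> L (F i)) -> L (\sum_(i <- r | P i) F i).
Proof. by move=> hL h; apply: big_ind => //; [exact: hL.1|move=> *; exact: lin_setD]. Qed.

(** The forms are the entries of [a] minus its expansion in a basis of [L]. Described by linear
    equations, membership passes through derivatives and limits. *)
Lemma tensor_separation (L : set T) : lin_set L ->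
  exists E : {bseq m of 'I_d} -> {bseq m of 'I_d} -> R,
    forall a, L a <-> forall u, \sum_w E u w * a w = 0.
Proof.
move=> hL; have [n [Y [C [LY YC]]]] := tensor_basis hL.
pose E u w : R := (u == w)%:R - \sum_i C i w * Y i u.
exists E => a.
have EE u : \sum_w E u w * a w = a u - (\sum_i (\sum_w C i w * a w) *: Y i) u.
  rewrite tsum_coef; under eq_bigr do rewrite mulrBl.
  rewrite sumrB (bigD1 u) //= eqxx mul1r big1 ?addr0; last first.
    by move=> w wu; rewrite eq_sym (negbTE wu) mul0r.
  congr (_ - _); under eq_bigr => w _ do rewrite mulr_suml.
  rewrite exchange_big; apply: eq_bigr => i _; rewrite tscale_coef mulr_suml.
  by apply: eq_bigr => w _; rewrite mulrAC.
split=> [La u|h]; first by rewrite EE -YC // subrr.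
have -> : a = \sum_i (\sum_w C i w * a w) *: Y i.
  by apply/ffunP => u; have := h u; rewrite EE => /subr0_eq.
by apply: lin_set_sum => // i _; apply: lin_setZ.
Qed.

End TensorLinear.

(** * Linear differential equations and the free nilpotent group *)

Section Calculus.
Context {R : realType}.
Implicit Types (f g : R -> R).

Lemma is_derive_bigsum (I : Type) (r : seq I) (h : I -> R -> R) (x : R) (dh : I -> R) :
  (forall i, is_derive x 1 (h i) (dh i)) ->
  is_derive x 1 (fun u => \sum_(i <- r) h i u) (\sum_(i <- r) dh i).
Proof.
move=> H; elim: r => [|i r IH].
  rewrite big_nil (_ : (fun u => _) = cst 0); first exact: is_derive_cst.
  by apply/funext => u; rewrite big_nil.
rewrite big_cons (_ : (fun u => _) = fun u => h i u + \sum_(i <- r) h i u).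
  exact: is_deriveD.
by apply/funext => u; rewrite big_cons.
Qed.

Lemma is_derive_mul f g (x df dg : R) : is_derive x 1 f df -> is_derive x 1 g dg ->
  is_derive x 1 (fun u => f u * g u) (df * g x + f x * dg).
Proof.
move=> hf hg; apply: is_derive_eq (is_deriveM hf hg) _.
by rewrite addrC [df * _]mulrC.
Qed.

Lemma cont_mul (U : topologicalType) (f g : U -> R) :
  continuous f -> continuous g -> continuous (fun u => f u * g u).
Proof. by move=> hf hg u; apply: continuousM; [exact: hf|exact: hg]. Qed.

Lemma cont_add (U : topologicalType) (W : normedModType R) (f g : U -> W) :
  continuous f -> continuous g -> continuous (fun u => f u + g u).
Proof. by move=> hf hg u; apply: cvgD; [exact: hf|exact: hg]. Qed.

Lemma cont_cst (U : topologicalType) (W : normedModType R) (k : W) : continuous (fun _ : U => k).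
Proof. by move=> u; exact: cvg_cst. Qed.

Lemma cont_sum (U : topologicalType) (W : normedModType R) (I : Type) (r : seq I)
    (h : I -> U -> W) :
  (forall i, continuous (h i)) -> continuous (fun u => \sum_(i <- r) h i u).
Proof.
move=> H; elim: r => [|i r IH].
  rewrite (_ : (fun u => _) = cst 0); first exact: cont_cst.
  by apply/funext => u; rewrite big_nil.
rewrite (_ : (fun u => _) = fun u => h i u + \sum_(i <- r) h i u).
  exact: cont_add.
by apply/funext => u; rewrite big_cons.
Qed.

Lemma cont_norm (U : topologicalType) (W : normedModType R) (f : U -> W) :
  continuous f -> continuous (fun u => `|f u|).
Proof. by move=> cf u; apply: cvg_norm; exact: cf. Qed.

Lemma cont_opp (U : topologicalType) (W : normedModType R) (f : U -> W) :
  continuous f -> continuous (fun u => - f u).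
Proof. by move=> cf u; apply: cvgN; exact: cf. Qed.

Lemma cont_scalel (U : topologicalType) (W : normedModType R) (f : U -> R) (v : W) :
  continuous f -> continuous (fun u => f u *: v).
Proof. by move=> cf u; apply: cvgZr_tmp; exact: cf. Qed.

Lemma within_cont_sub (a b c d : R) f : a <= c -> d <= b ->
  {within `[a, b], continuous f} -> {within `[c, d], continuous f}.
Proof.
move=> ac db; apply: continuous_subspaceW.
by apply: subset_itv; rewrite bnd_simp.
Qed.

Lemma zero_deriv_const f (a b : R) : a <= b ->
  (forall x, a < x < b -> is_derive x 1 f 0) ->
  {within `[a, b], continuous f} -> f b = f a.
Proof.
move=> ab df cf; have [c cab] := @MVT_segment R f (fun=> 0) a b ab df cf.
by rewrite mul0r => /subr0_eq.
Qed.

Lemma deriv_bound f (df : R -> R) (a b M : R) : a <= b ->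
  (forall x, a < x < b -> is_derive x 1 f (df x)) ->
  (forall x, a < x < b -> `|df x| <= M) ->
  {within `[a, b], continuous f} -> `|f b - f a| <= M * (b - a).
Proof.
rewrite le_eqVlt => /orP[/eqP ->|ab] hf dfM cf; first by rewrite !subrr normr0 mulr0.
have [c cab ->] := @MVT R f df a b ab hf cf.
rewrite normrM [`|b - a|]gtr0_norm ?subr_gt0 // ler_wpM2r ?subr_ge0 ?(ltW ab) //.
exact: dfM.
Qed.

End Calculus.

Section TensorCalculus.
Context {R : realType} {d m : nat}.
Local Notation T := (trunc_tensor R d m).
Implicit Types (X Y Z v : R -> T) (A : set R).

Definition tderiv X (t : R) (D : T) := forall w, is_derive t 1 (fun u => X u w) (D w).
Definition tcontU (U : topologicalType) (X : U -> T) := forall w, continuous (fun u => X u w).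
Local Notation tcont A X := (@tcontU (subspace A) X).

Lemma tderivM X Y t DX DY : tderiv X t DX -> tderiv Y t DY ->
  tderiv (fun u => X u * Y u) t (DX * Y t + X t * DY).
Proof.
move=> hX hY w; rewrite tadd_coef !tmul_coef -big_split /=.
rewrite (_ : (fun u => _) = fun u => \sum_(k < (size w).+1)
  X u (btake k w) * Y u (bdrop k w)); last by apply/funext => u; rewrite tmul_coef.
by apply: is_derive_bigsum => k; apply: is_derive_mul.
Qed.

Lemma tcontM (U : topologicalType) (X Y : U -> T) :
  tcontU X -> tcontU Y -> tcontU (fun u => X u * Y u).
Proof.
move=> hX hY w.
rewrite (_ : (fun u => _) = fun u => \sum_(k < (size w).+1)
  X u (btake k w) * Y u (bdrop k w)); last by apply/funext => u; rewrite tmul_coef.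
by apply: cont_sum => k; apply: cont_mul.
Qed.

Lemma tderivD X Y t DX DY : tderiv X t DX -> tderiv Y t DY ->
  tderiv (fun u => X u + Y u) t (DX + DY).
Proof.
move=> hX hY w; rewrite tadd_coef.
rewrite (_ : (fun u => _) = fun u => X u w + Y u w); last first.
  by apply/funext => u; rewrite tadd_coef.
exact: is_deriveD.
Qed.

Lemma tcontD (U : topologicalType) (X Y : U -> T) :
  tcontU X -> tcontU Y -> tcontU (fun u => X u + Y u).
Proof.
move=> hX hY w.
rewrite (_ : (fun u => _) = fun u => X u w + Y u w); last first.
  by apply/funext => u; rewrite tadd_coef.
exact: cont_add.
Qed.

Lemma tderiv_cst (a : T) t : tderiv (fun=> a) t 0.
Proof. by move=> w; rewrite tzero_coef; exact: is_derive_cst. Qed.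

Lemma tcont_cst (U : topologicalType) (a : T) : tcontU (fun _ : U => a).
Proof. by move=> w; exact: cont_cst. Qed.

Lemma tderivZ (f : R -> R) (df : R) X (t : R) DX : is_derive t 1 f df -> tderiv X t DX ->
  tderiv (fun u => f u *: X u) t (df *: X t + f t *: DX).
Proof.
move=> hf hX w; rewrite tadd_coef !tscale_coef.
rewrite (_ : (fun u => _) = fun u => f u * X u w); last first.
  by apply/funext => u; rewrite tscale_coef.
exact: is_derive_mul.
Qed.

Lemma tcontZ (U : topologicalType) (f : U -> R) (X : U -> T) :
  continuous f -> tcontU X -> tcontU (fun u => f u *: X u).
Proof.
move=> hf hX w.
rewrite (_ : (fun u => _) = fun u => f u * X u w); last first.
  by apply/funext => u; rewrite tscale_coef.
exact: cont_mul.
Qed.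

Lemma tderiv_scale (k : R) X (t : R) DX : tderiv X t DX -> tderiv (fun u => k *: X u) t (k *: DX).
Proof.
move=> hX; have := tderivZ (is_derive_cst k t (1 : R)) hX.
by rewrite scale0r add0r.
Qed.

Lemma tderiv_sum n (h : 'I_n -> R -> T) t (dh : 'I_n -> T) :
  (forall i, tderiv (h i) t (dh i)) -> tderiv (fun u => \sum_i h i u) t (\sum_i dh i).
Proof.
move=> H w; rewrite tsum_coef.
rewrite (_ : (fun u => _) = fun u => \sum_i h i u w); last first.
  by apply/funext => u; rewrite tsum_coef.
by apply: is_derive_bigsum => i; apply: H.
Qed.

Lemma tcont_sum (U : topologicalType) n (h : 'I_n -> U -> T) :
  (forall i, tcontU (h i)) -> tcontU (fun u => \sum_i h i u).
Proof.
move=> H w.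
rewrite (_ : (fun u => _) = fun u => \sum_i h i u w); last first.
  by apply/funext => u; rewrite tsum_coef.
by apply: cont_sum => i; apply: H.
Qed.

Lemma tderivX X t DX n : tderiv X t DX ->
  tderiv (fun u => X u ^+ n) t (\sum_(i < n) X t ^+ i * DX * X t ^+ (n.-1 - i)).
Proof.
move=> hX; elim: n => [|n IH].
  by rewrite big_ord0; exact: tderiv_cst.
rewrite (_ : (fun u => _) = fun u => X u ^+ n * X u); last first.
  by apply/funext => u; rewrite exprSr.
have := tderivM IH hX; rewrite big_ord_recr /= subnn expr0 mulr1 mulr_suml.
congr (tderiv _ _ (_ + _)); apply: eq_bigr => i _; rewrite -[LHS]mulrA -exprSr.
by congr (_ * X t ^+ _); have := ltn_ord i; lia.
Qed.

Lemma tcontX (U : topologicalType) (X : U -> T) n : tcontU X -> tcontU (fun u => X u ^+ n).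
Proof.
move=> hX; elim: n => [|n IH]; first exact: tcont_cst.
rewrite (_ : (fun u => _) = fun u => X u ^+ n * X u); last first.
  by apply/funext => u; rewrite exprSr.
exact: tcontM.
Qed.

Lemma tderiv_uniq X t D1 D2 : tderiv X t D1 -> tderiv X t D2 -> D1 = D2.
Proof.
move=> h1 h2; apply/ffunP => w.
by rewrite -(@derive_val _ _ _ _ _ _ _ (h1 w)) -(@derive_val _ _ _ _ _ _ _ (h2 w)).
Qed.

Lemma tderiv_texp Z t W : tderiv Z t W -> tderiv (fun u => texpn (Z u)) t
  (\sum_(k < m.+1) (k`!%:R)^-1 *: \sum_(i < k) Z t ^+ i * W * Z t ^+ (k.-1 - i)).
Proof. by move=> hZ; apply: tderiv_sum => k; apply/tderiv_scale/tderivX. Qed.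

Lemma tderiv_near X Y t D : (\forall u \near t, X u = Y u) -> tderiv X t D -> tderiv Y t D.
Proof.
move=> XY hX w; apply: (near_eq_is_derive _ (hX w)).
by apply: filterS XY => u ->.
Qed.

(** The equation is imposed only inside the interval, since a two-sided derivative may fail at its
    ends: [signature_path] is constant to the left of 0. *)
Definition sol (a b : R) v X := [/\ tcont `[a, b] X,
  (forall t, a < t < b -> tderiv X t (X t * v t)) &
  forall t, a <= t <= b -> X t [bseq] = 1].

End TensorCalculus.
Notation tcont A X := (tcontU (U := subspace A) X).

Section Driven.
Context {R : realType} {d m : nat}.
Local Notation T := (trunc_tensor R d m).
Implicit Types (X Y Z v : R -> T).

Lemma sol_sub (a b c e : R) v X : a <= c -> e <= b -> sol a b v X -> sol c e v X.
Proof.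
move=> ac eb [cX dX X1]; split.
- by move=> w; apply: within_cont_sub (cX w).
- move=> t /andP[ct te]; apply: dX.
  by rewrite (le_lt_trans ac ct) (lt_le_trans te eb).
- move=> t /andP[ct te]; apply: X1.
  by rewrite (le_trans ac ct) (le_trans te eb).
Qed.

Lemma sol_mull (a b : R) v X (g : T) : g [bseq] = 1 -> sol a b v X -> sol a b v (fun t => g * X t).
Proof.
move=> g1 [cX dX X1]; split.
- by apply: tcontM => //; exact: tcont_cst.
- move=> t tab; have := tderivM (tderiv_cst g t) (dX t tab).
  by rewrite mul0r add0r mulrA.
- by move=> t tab; rewrite coef_nil_mul g1 X1 // mulr1.
Qed.

Lemma sol_eq (a b : R) v v' X : (forall t, a < t < b -> v t = v' t) -> sol a b v X -> sol a b v' X.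
Proof. by move=> vv' [cX dX X1]; split => // t tab; rewrite -vv' //; exact: dX. Qed.

(** No Gronwall estimate is involved: since [v] has no constant term, the degree [n] part of the
    derivative of [X - Y] depends only on lower degrees, so the difference vanishes one degree at a
    time. *)
Lemma sol_uniq (a b : R) v X Y : a <= b -> (forall t, a < t < b -> tge 1 (v t)) ->
  sol a b v X -> sol a b v Y -> X a = Y a -> X b = Y b.
Proof.
move=> ab v1 [cX dX _] [cY dY _] XYa.
pose Z t : T := X t + (-1) *: Y t.
suff H n t : a <= t <= b -> tge n (Z t).
  have := tge_eq0 (ltnSn m) (H m.+1 b _); rewrite ab lexx => /(_ isT) /eqP.
  by rewrite /Z scaleN1r subr_eq0 => /eqP.
elim: n t => [//|n IH] t /andP[at_ tb] w.
rewrite ltnS leq_eqVlt => /orP[/eqP wn|]; last by apply: IH; rewrite at_ tb.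
have cZ : tcont `[a, b] Z.
  by apply: tcontD => //; apply: tcontZ => //; exact: cont_cst.
have dZ s : a < s < b -> tderiv Z s (Z s * v s).
  move=> sab; rewrite /Z mulrDl -scalerAl.
  exact: (tderivD (dX s sab) (tderiv_scale (-1) (dY s sab))).
have -> : Z t w = Z a w.
  apply: (@zero_deriv_const _ (fun s => Z s w) a t) => //.
    move=> s /andP[as_ st].
    have sab : a < s < b by rewrite as_ (lt_le_trans st).
    have <- : (Z s * v s) w = 0; last exact: dZ.
    apply: (@tgeM _ _ _ n 1); rewrite ?wn ?addn1 //; last exact: v1.
    by apply: IH; rewrite ltW //= ltW // (lt_le_trans st).
  by apply: within_cont_sub (cZ w).
by rewrite /Z XYa scaleN1r subrr tzero_coef.
Qed.

End Driven.

(** * Solutions driven by the free Lie algebra *)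

Section FreeLie.
Context {R : realType} {V : normedVectType R} {m : nat}.
Local Notation dimV := (\dim {:V}).
Local Notation T := (trunc_tensor R dimV m).
Local Notation g0 := (@free_nilpotent_lie R V m).
Local Notation G := (@free_nilpotent_group R V m).
Implicit Types (a b : T) (X v : R -> T).

Lemma texp_texpn a : texp a = texpn a. Proof. by []. Qed.

Lemma tensor_of_coef x w : (tensor_of x : T) w =
  if w : seq _ is [:: i] then vcoord i x else 0.
Proof. exact: coeff_tensorE. Qed.

Lemma tensor_of_ge1 x : tge 1 (tensor_of x : T).
Proof. by apply/tge1P; rewrite tensor_of_coef. Qed.

Lemma vcoord_lin i (k : R) (x y : V) : vcoord i (k *: x + y) = k * vcoord i x + vcoord i y.
Proof. by rewrite /vcoord linearP. Qed.

Lemma tensor_of_lin (k : R) (x y : V) :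
  tensor_of (k *: x + y) = k *: tensor_of x + tensor_of y :> T.
Proof.
apply/ffunP => w; rewrite !tcoefE !tensor_of_coef.
by case: (w : seq _) => [|i [|j s]]; rewrite ?vcoord_lin ?mulr0 ?addr0.
Qed.

Lemma tensor_of0 : tensor_of 0 = 0 :> T.
Proof.
apply/ffunP => w; rewrite tensor_of_coef tzero_coef.
by case: (w : seq _) => [|i [|j s]] //; rewrite /vcoord linear0.
Qed.

Lemma tensor_ofZ k (x : V) : tensor_of (k *: x) = k *: tensor_of x :> T.
Proof. by rewrite -[k *: x]addr0 tensor_of_lin tensor_of0 addr0. Qed.

Lemma mul_tensor_of (a : T) (x : V) (u w : {bseq m of 'I_dimV}) i :
  w = rcons u i :> seq _ -> (a * tensor_of x) w = a u * vcoord i x.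
Proof.
move=> wE; rewrite tmul_coef.
have sw : size w = (size u).+1 by rewrite wE size_rcons.
have uw : (size u < (size w).+1)%N by rewrite sw ltnS leqnSn.
rewrite (bigD1 (Ordinal uw)) //= big1 ?addr0.
  have -> : btake (size u) w = u.
    by apply: val_inj; rewrite /= wE -cats1 take_size_cat.
  by rewrite tensor_of_coef /= wE -cats1 drop_size_cat.
move=> k /eqP ku; rewrite tensor_of_coef /=.
have : size (drop k w) != 1%N.
  apply/eqP; rewrite size_drop => e; apply: ku; apply: val_inj => /=.
  by have := ltn_ord k; move: e sw; clear; lia.
by case: drop => [|? []] //= _; rewrite mulr0.
Qed.

Lemma free_lie_lin : lin_set g0.
Proof.
split; first by move=> L [[]].
by move=> k a b ha hb L hL; have [[_ Ll _] _] := hL; apply: Ll; [exact: ha|exact: hb].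
Qed.

Lemma free_lie_adj a b : g0 a -> g0 b -> g0 (adj a b).
Proof. by move=> ha hb L hL; have [[_ _ Lb] _] := hL; apply: Lb; [exact: hb|exact: ha]. Qed.

Lemma free_lie_tensor x : g0 (tensor_of x).
Proof. by move=> L [_ sL]; apply: sL; exists x. Qed.

Lemma free_lie_ge1 a : g0 a -> tge 1 a.
Proof.
move=> /(_ (tge 1)); apply; split; last first.
  by move=> _ [x _ <-]; exact: tensor_of_ge1.
split; [exact: tge0|by move=> *; exact: tge_lin|].
by move=> x y hx hy; apply: tgeB; exact: tgeMl.
Qed.

Lemma free_groupP a : G a <-> a [bseq] = 1 /\ g0 (tlog a).
Proof.
split=> [[b gb <-]|[a1 la]]; last by exists (tlog a); rewrite ?texp_texpn ?tlogK.
by rewrite texp_texpn texpn_nil ?texpK //; exact: free_lie_ge1.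
Qed.

Lemma free_group_nil a : G a -> a [bseq] = 1. Proof. by case/free_groupP. Qed.

(** The Lie algebra up to an error of degree at least [n], for inductions on the degree; for
    [n = m.+1] there is no error left. *)
Definition lie_mod n : set T := [set a | exists2 b, g0 b & tge n (a - b)].

Lemma lie_mod_lin n : lin_set (lie_mod n).
Proof.
split; first by exists 0; [exact: free_lie_lin.1|rewrite subrr; exact: tge0].
move=> k a b [a' ga' ha] [b' gb' hb]; exists (k *: a' + b').
  exact: free_lie_lin.2.
by rewrite opprD addrACA -scalerBr; exact: tge_lin.
Qed.

Lemma lie_mod_g n a : g0 a -> lie_mod n a.
Proof. by move=> ga; exists a => //; rewrite subrr; exact: tge0. Qed.

Lemma lie_mod_le i j a : (i <= j)%N -> lie_mod j a -> lie_mod i a.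
Proof. by move=> ij [b gb hb]; exists b => //; exact: tge_le hb. Qed.

(** Every error term is multiplied by a factor of degree at least 1, so a bracket is known one
    degree further than its less precise argument. *)
Lemma lie_mod_adj n j Z W : (j <= n)%N -> tge 1 Z -> tge 1 W ->
  lie_mod n Z -> lie_mod j W -> lie_mod j.+1 (adj Z W).
Proof.
move=> jn Z1 W1 [z gz hz] [w gw hw]; exists (adj z w); first exact: free_lie_adj.
have -> : adj Z W - adj z w = (W - w) * Z + w * (Z - z) - ((Z - z) * W + z * (W - w)).
  rewrite /adj !mulrBl !mulrBr !addrA !subrK !opprD !opprK !addrA.
  by rewrite [W * Z - Z * W - _]addrAC.
have zj := tge_le jn hz; have w1 := free_lie_ge1 gw; have z1 := free_lie_ge1 gz.
rewrite -(addn1 j); apply: tgeB; apply: tgeD; try exact: tgeM;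
  by rewrite addnC; apply: tgeM.
Qed.

(** The equation expresses [W] as [c] minus brackets in [W]. Brackets are known one degree further
    than [W], so each substitution improves [W] by one degree, until the precision of [Z] is the
    limit. *)
Lemma lie_mod_deriv n Z W c : g0 c -> tge 1 Z -> tge 1 W -> lie_mod n Z ->
  c = \sum_(j < m.+1) (j.+1`!%:R)^-1 *: iter j (adj Z) W -> lie_mod n.+1 W.
Proof.
move=> gc Z1 W1 hZ cE.
suff H j : (j <= n.+1)%N -> lie_mod j W by exact: H.
elim: j => [_|j IH jn]; first by exists 0; [exact: free_lie_lin.1|].
have {}IH := IH (ltnW jn).
have adge k : tge 1 (iter k (adj Z) W).
  by elim: k => //= k ih; apply: tgeB; exact: tgeMl.
have adk k : lie_mod j.+1 (iter k.+1 (adj Z) W).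
  elim: k => [|k ih]; first exact: (lie_mod_adj (n := n)).
  by rewrite iterS; apply: (lie_mod_adj (n := n)) => //; exact: lie_mod_le ih.
have -> : W = c - \sum_(j < m) (j.+2`!%:R)^-1 *: iter j.+1 (adj Z) W.
  by rewrite cE big_ord_recl /= factS fact0 invr1 scale1r addrK.
have hL := lie_mod_lin j.+1.
apply: lin_setB => //; first exact: lie_mod_g.
by apply: lin_set_sum => // i _; apply: lin_setZ.
Qed.

(* The logarithm [Z] of a solution satisfies [v = \sum_j ad_Z^j Z' / (j+1)!],
   where [ad_Z W = W Z - Z W]; the terms with [j > 0] gain a degree, so this
   keeps [Z'], hence [Z], in the Lie algebra, one degree at a time. *)
Lemma sol_group (a b : R) v X : a <= b -> (forall t, g0 (v t)) -> sol a b v X ->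
  G (X a) -> G (X b).
Proof.
move=> ab gv [cX dX X1] GXa; apply/free_groupP; split; first by apply: X1; rewrite ab lexx.
pose Z t : T := tlog (X t).
pose dZ t : T := \sum_(k < m.+1) (- (-1) ^+ k / k%:R) *:
   \sum_(i < k) (X t - 1) ^+ i * (X t * v t) * (X t - 1) ^+ (k.-1 - i).
have cX1 : tcont `[a, b] (fun t => X t - 1).
  by apply: tcontD => //; exact: tcont_cst.
have cZ : tcont `[a, b] Z.
  by apply: tcont_sum => k; apply: tcontZ; [exact: cont_cst|exact: tcontX].
have hZ t : a < t < b -> tderiv Z t (dZ t).
  move=> tab; apply: tderiv_sum => k; apply/tderiv_scale/tderivX.
  by have := tderivD (dX t tab) (tderiv_cst (- 1) t); rewrite addr0.
have Z1 t : a <= t <= b -> tge 1 (Z t) by move=> tab; apply/tlog_ge/X1.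
have dZ1 t : a <= t <= b -> tge 1 (dZ t).
  move=> tab; apply: tge_sum => k _; apply/tgeZ/tge_sum => i _.
  by apply/tgeMl/tgeMr/tgeMr/free_lie_ge1.
have vE t : a < t < b -> v t = \sum_(j < m.+1) (j.+1`!%:R)^-1 *: iter j (adj (Z t)) (dZ t).
  move=> tab; have tab' : a <= t <= b by case/andP: tab => ? ?; rewrite !ltW.
  have := tderiv_texp (hZ t tab); rewrite (texp_deriv (Z1 t tab') (dZ1 t tab')) => h.
  have {}h : tderiv X t (texpn (Z t) *
      \sum_(j < m.+1) (j.+1`!%:R)^-1 *: iter j (adj (Z t)) (dZ t)).
    apply: tderiv_near h; near=> u; apply/tlogK/X1.
    suff : u \in `]a, b[ by move=> /subset_itv_oo_cc; rewrite in_itv.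
    by near: u; apply: near_in_itvoo; rewrite in_itv.
  have := tderiv_uniq (dX t tab) h; rewrite /Z tlogK ?X1 // => /(congr1 ( *%R (tinv (X t)))).
  by rewrite !mulrA tVinv ?X1 // !mul1r.
suff H : forall n t, a <= t <= b -> lie_mod n (Z t).
  have [|z gz] := H m.+1 b; first by rewrite ab lexx.
  by move=> /(tge_eq0 (ltnSn m)) /subr0_eq; rewrite /Z => ->.
elim=> [|n IH] t /andP[at_ tb].
  by exists 0; [exact: free_lie_lin.1|].
(* The forms cutting out [lie_mod n.+1] vanish on the derivative of [Z], hence are constant along
   [Z], and they vanish at [a]. *)
have [E EP] := tensor_separation (lie_mod_lin n.+1).
apply/EP => u.
have /EP/(_ u) Za0 : lie_mod n.+1 (Z a) by apply: lie_mod_g; case/free_groupP: GXa.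
rewrite -[RHS]Za0.
apply: (@zero_deriv_const _ (fun r => \sum_w E u w * Z r w) a t) => //.
  move=> s /andP[as_ st]; have sb := lt_le_trans st tb.
  have sab : a <= s <= b by rewrite !ltW.
  have dZ0 : \sum_w E u w * dZ s w = 0.
    apply: (EP _).1; apply: (@lie_mod_deriv n (Z s) _ (v s)) => //.
    - exact: Z1.
    - exact: dZ1.
    - exact: IH.
    - by apply: vE; rewrite as_ sb.
  rewrite -[X in is_derive _ _ _ X]dZ0; apply: is_derive_bigsum => w.
  apply: is_derive_eq (is_derive_mul (is_derive_cst (E u w) s 1) (hZ s _ w)) _; first by rewrite as_ sb.
  by rewrite mul0r add0r.
apply: cont_sum => w; apply: cont_mul; first exact: cont_cst.
by apply: within_cont_sub (cZ w).
Unshelve. all: by end_near. Qed.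

End FreeLie.
Arguments free_lie_lin {R V m}.

(** * Homogeneous boxes *)

Section Boxes.
Context {R : realType} {d m : nat}.
Local Notation T := (trunc_tensor R d m).
Implicit Types (a b g : T).

(** A ball for a model homogeneous norm: the exponent equal to the degree makes a dilation by
    [t >= 0] multiply the radius by [t]. By contrast [tbounded] is a ball of the ordinary sup
    norm. *)
Definition inbox (r : R) a := forall w, `|a w| <= r ^+ size w.
Definition tbounded (r : R) a := forall w, `|a w| <= r.

(** The products [r ^+ k * s ^+ (n - k)] are terms of the binomial expansion of [(r + s) ^+ n],
    without their coefficients, which are at least 1. *)
Lemma inboxM r s a b : 0 <= r -> 0 <= s -> inbox r a -> inbox s b -> inbox (r + s) (a * b).
Proof.
move=> r0 s0 ha hb w; rewrite tmul_coef (le_trans (ler_norm_sum _ _ _)) //.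
rewrite [r + s]addrC exprDn; apply: ler_sum => k _; rewrite normrM.
have kw : (k <= size w)%N by rewrite -ltnS.
apply: (@le_trans _ _ (s ^+ (size w - k) * r ^+ k)).
  rewrite mulrC; apply: ler_pM => //.
    by rewrite (le_trans (hb _)) //= size_drop.
  by rewrite (le_trans (ha _)) //= size_takel.
rewrite -[leLHS]mulr1n ler_wpMn2l ?mulr_ge0 ?exprn_ge0 //.
by rewrite bin_gt0.
Qed.

Lemma inbox1 : inbox 0 (1 : T).
Proof.
by move=> w; rewrite tone_coef expr0n; case: eqP => _; rewrite ?normr1 ?normr0.
Qed.

Lemma inbox_le r s a : 0 <= r -> r <= s -> inbox r a -> inbox s a.
Proof. by move=> r0 rs ha w; rewrite (le_trans (ha w)) // lerXn2r // nnegrE (le_trans r0). Qed.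

Lemma inbox_bounded r a : 0 <= r -> inbox r a -> tbounded ((1 + r) ^+ m) a.
Proof.
move=> r0 ha w; rewrite (le_trans (ha w)) //.
apply: (@le_trans _ _ ((1 + r) ^+ size w)).
  by rewrite lerXn2r ?nnegrE ?addr_ge0 // lerDr.
by rewrite ler_weXn2l ?lerDl // size_bseq.
Qed.

Lemma tboundedM r s a b : 0 <= r -> 0 <= s -> tbounded r a -> tbounded s b ->
  tbounded (m.+1%:R * (r * s)) (a * b).
Proof.
move=> r0 s0 ha hb w; rewrite tmul_coef (le_trans (ler_norm_sum _ _ _)) //.
apply: (@le_trans _ _ (\sum_(k < (size w).+1) r * s)).
  by apply: ler_sum => k _; rewrite normrM ler_pM.
rewrite sumr_const card_ord -[leLHS]mulr_natl ler_wpM2r ?mulr_ge0 //.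
by rewrite ler_nat ltnS size_bseq.
Qed.

End Boxes.

(** * Group law, dilations and broken lines *)

Section Group.
Context {R : realType} {V : normedVectType R} {m : nat}.
Local Notation dimV := (\dim {:V}).
Local Notation T := (trunc_tensor R dimV m).
Local Notation g0 := (@free_nilpotent_lie R V m).
Local Notation G := (@free_nilpotent_group R V m).
Implicit Types (a b g h : T) (X v : R -> T).

Lemma texpn0 : texpn (0 : T) = 1.
Proof.
rewrite /texpn big_ord_recl big1 ?addr0 => [|i _]; last by rewrite expr0n scaler0.
by rewrite fact0 invr1 scale1r.
Qed.

(** The element [f t *: b] commutes with its derivative, so only the first term of [texp_deriv]
    survives. *)
Lemma sol_exp (c e : R) (f df : R -> R) b : tge 1 b ->
  (forall t, c < t < e -> is_derive t 1 f (df t)) ->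
  {within `[c, e], continuous f} ->
  sol c e (fun t => df t *: b) (fun t => texpn (f t *: b)).
Proof.
move=> b1 hf cf; split.
- apply: tcont_sum => k; apply: tcontZ; first exact: cont_cst.
  by apply: tcontX; apply: tcontZ => //; exact: tcont_cst.
- move=> t tce; have hZ := tderivZ (hf t tce) (tderiv_cst b t).
  have := tderiv_texp hZ; rewrite scaler0 addr0.
  have fb k : tge 1 (k *: b) by exact: tgeZ.
  rewrite texp_deriv //.
  have ad0 : adj (f t *: b) (df t *: b) = 0.
    by rewrite /adj -!scalerAl -!scalerAr !scalerA mulrC subrr.
  rewrite big_ord_recl /= factS fact0 invr1 scale1r big1 ?addr0 // => i _.
  suff -> : adj (f t *: b) (iter i (adj (f t *: b)) (df t *: b)) = 0 by rewrite scaler0.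
  elim: (i : nat) => [|k IH] //=; rewrite IH /adj mul0r mulr0 subrr //.
- by move=> t _; apply: texpn_nil; exact: tgeZ.
Qed.

Lemma free_group_exp b : g0 b -> G (texpn b). Proof. by move=> gb; exists b. Qed.

Lemma free_group1 : G 1.
Proof. by rewrite -texpn0; apply: free_group_exp; exact: free_lie_lin.1. Qed.

Lemma is_derive_linear (c k t : R) : is_derive t 1 (fun u => c + k * u) k.
Proof.
apply: is_derive_eq (is_deriveD (is_derive_cst c t 1)
  (is_derive_mul (is_derive_cst k t 1) (is_derive_id t 1))) _.
by rewrite mul0r !add0r mulr1.
Qed.

Lemma cont_linear (A : set R) (c k : R) : {within A, continuous (fun u => c + k * u)}.
Proof.
apply: cont_add; first exact: cont_cst.
apply: cont_mul; first exact: cont_cst.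
by apply: continuous_subspaceT => u; exact: cvg_id.
Qed.

Lemma sol_exp_linear (c k : R) b : tge 1 b ->
  sol 0 1 (fun=> k *: b) (fun t => texpn ((c + k * t) *: b)).
Proof.
move=> b1; apply: (@sol_exp _ _ (fun t => c + k * t) (fun=> k)) => //.
  by move=> t _; exact: is_derive_linear.
exact: cont_linear.
Qed.

(** The path from [g] to [g * texpn b] given by [g * texpn (t *: b)] is driven by [b], so it stays
    in the group. *)
Lemma free_groupM g h : G g -> G h -> G (g * h).
Proof.
move=> Gg [b gb <-]; rewrite texp_texpn.
have b1 := free_lie_ge1 gb.
have hs := sol_mull (free_group_nil Gg) (sol_exp_linear 0 1 b1).
have : G (g * texpn ((0 + 1 * 1) *: b)).
  apply: (sol_group ler01 _ hs); first by move=> _; rewrite scale1r.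
  by rewrite mulr0 add0r scale0r texpn0 mulr1.
by rewrite mulr1 add0r scale1r.
Qed.

(** As functions of [t], [texpn b * texpn (- t *: b)] and [texpn ((1 - t) *: b)] solve the same
    equation with the same initial value; compare them at [t = 1]. *)
Lemma texpN b : tge 1 b -> tinv (texpn b) = texpn (- b).
Proof.
move=> b1; apply: tinv_uniq; first exact: texpn_nil.
have h1 := sol_mull (texpn_nil b1) (sol_exp_linear 0 (-1) b1).
have h2 := sol_exp_linear 1 (-1) b1.
have v1 : forall t : R, 0 < t < 1 -> tge 1 (-1 *: b) by move=> *; exact: tgeZ.
have e : texpn b * texpn ((0 + -1 * 1) *: b) = texpn ((1 + -1 * 1) *: b).
  apply: (sol_uniq ler01 v1 h1 h2).
  by rewrite !mulr0 add0r addr0 scale0r texpn0 mulr1 scale1r.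
by move: e; rewrite mulr1 add0r scaleN1r subrr scale0r texpn0.
Qed.

Lemma free_groupV g : G g -> G (tinv g).
Proof.
move=> [b gb <-]; rewrite texp_texpn texpN; last exact: free_lie_ge1.
by apply: free_group_exp; exact: (lin_setN free_lie_lin gb).
Qed.

Lemma dilation_coef (t : R) a w : dilation t a w = t ^+ size w * a w.
Proof. exact: coeff_tensorE. Qed.

Lemma dilation_lin (t k : R) a b : dilation t (k *: a + b) = k *: dilation t a + dilation t b.
Proof. by apply/ffunP => w; rewrite !(dilation_coef, tcoefE) mulrDr mulrCA. Qed.

Lemma dilation0 t : dilation t (0 : T) = 0.
Proof. by apply/ffunP => w; rewrite !(dilation_coef, tcoefE) mulr0. Qed.

Lemma dilationZ t k a : dilation t (k *: a) = k *: dilation t a.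
Proof. by rewrite -[k *: a]addr0 dilation_lin dilation0 addr0. Qed.

Lemma dilationD t a b : dilation t (a + b) = dilation t a + dilation t b.
Proof. by rewrite -[a]scale1r dilation_lin !scale1r. Qed.

Lemma dilationM t a b : dilation t (a * b) = dilation t a * dilation t b.
Proof.
apply/ffunP => w; rewrite dilation_coef !tmul_coef mulr_sumr; apply: eq_bigr => k _.
rewrite !dilation_coef /= size_takel -1?ltnS // size_drop.
rewrite -{1}(subnKC (_ : k <= size w)%N) -1?ltnS // exprD.
by rewrite mulrACA.
Qed.

Lemma dilation_one t : dilation t (1 : T) = 1.
Proof.
apply/ffunP => w; rewrite dilation_coef tone_coef.
by case: eqP => [->|]; rewrite ?mulr0 // expr0 mul1r.
Qed.

Lemma dilation_comp s t a : dilation s (dilation t a) = dilation (s * t) a.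
Proof. by apply/ffunP => w; rewrite !dilation_coef mulrA exprMn. Qed.

Lemma dilation_id a : dilation 1 a = a.
Proof. by apply/ffunP => w; rewrite dilation_coef expr1n mul1r. Qed.

Lemma dilationX t a n : dilation t (a ^+ n) = dilation t a ^+ n.
Proof. by elim: n => [|n IH]; rewrite ?dilation_one // !exprS dilationM IH. Qed.

Lemma dilation_sum t (I : Type) (r : seq I) (F : I -> T) :
  dilation t (\sum_(i <- r) F i) = \sum_(i <- r) dilation t (F i).
Proof. by apply: big_morph; [exact: dilationD|exact: dilation0]. Qed.

Lemma dilation_texp t a : dilation t (texpn a) = texpn (dilation t a).
Proof.
by rewrite dilation_sum; apply: eq_bigr => k _; rewrite dilationZ dilationX.
Qed.

Lemma dilation_tensor t x : dilation t (tensor_of x : T) = t *: tensor_of x.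
Proof.
apply/ffunP => w; rewrite tscale_coef dilation_coef !tensor_of_coef.
by case: (w : seq _) => [|i [|j s]] //=; rewrite !mulr0.
Qed.

Lemma dilation_nil t a : dilation t a [bseq] = a [bseq].
Proof. by rewrite dilation_coef expr0 mul1r. Qed.

Lemma free_lie_dilation t a : g0 a -> g0 (dilation t a).
Proof.
have gl : lin_set g0 := free_lie_lin.
move=> /(_ [set a | g0 (dilation t a)]); apply; split; last first.
  move=> _ [x _ <-]; rewrite /= dilation_tensor.
  exact: (lin_setZ t gl (free_lie_tensor x)).
split=> /=; first by rewrite dilation0; exact: gl.1.
  by move=> k x y hx hy; rewrite dilation_lin; exact: gl.2.
move=> x y hx hy; rewrite -scaleN1r dilationD dilationZ scaleN1r !dilationM.
exact: (free_lie_adj hy hx).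
Qed.

Lemma free_group_dilation t g : G g -> G (dilation t g).
Proof.
move=> [a ga <-]; rewrite texp_texpn dilation_texp.
exact: (free_group_exp (free_lie_dilation t ga)).
Qed.

Lemma dilation_inv t g : g [bseq] = 1 -> dilation t (tinv g) = tinv (dilation t g).
Proof.
move=> g1; symmetry; apply: tinv_uniq; first by rewrite dilation_nil.
by rewrite -dilationM tinvV // dilation_one.
Qed.

Lemma inbox_dilation (t r : R) a : 0 <= t -> inbox r a -> inbox (t * r) (dilation t a).
Proof.
move=> t0 ha w; rewrite dilation_coef normrM ger0_norm ?exprn_ge0 // exprMn.
by rewrite ler_wpM2l ?exprn_ge0.
Qed.

(** Differentiating the coordinate of a word removes its last letter, so each degree costs one
    integration of a speed bounded by [M] over a time at most [e - c]. *)
Lemma sol_bound (c e M : R) (x : R -> V) X : c <= e -> 0 <= M ->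
  (forall t, c < t < e -> forall i, `|vcoord i (x t)| <= M) ->
  sol c e (fun t => tensor_of (x t)) X -> X c = 1 -> inbox (M * (e - c)) (X e).
Proof.
move=> ce M0 hM [cX dX _] Xc w.
have L0 : 0 <= M * (e - c) by rewrite mulr_ge0 // subr_ge0.
suff H : forall n t (w : {bseq m of 'I_dimV}), size w = n -> c <= t <= e -> `|X t w| <= (M * (e - c)) ^+ n.
  by apply: H => //; rewrite lexx ce.
move=> {w}; elim=> [|n IH] t w wn /andP[ct te].
  have -> : X t w = X c w; last first.
    by rewrite Xc tone_coef wn normr1.
  apply: (@zero_deriv_const _ (fun s => X s w)) => //; last exact: within_cont_sub (cX w).
  move=> s /andP[cs st]; have := dX s _ w; rewrite cs (lt_le_trans st te) => /(_ isT).
  by rewrite (_ : (X s * _) w = 0) //; apply: (tgeMr _ (tensor_of_ge1 (x s))); rewrite wn.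
have -> : X t w = X t w - X c w by rewrite Xc tone_coef wn subr0.
apply: (@le_trans _ _ ((M * (e - c)) ^+ n * M * (t - c))); last first.
  by rewrite exprSr -mulrA ler_wpM2l ?exprn_ge0 // ler_wpM2l // lerD2r.
apply: (@deriv_bound _ (fun s => X s w) (fun s => (X s * tensor_of (x s)) w)) => //.
- by move=> s /andP[cs st]; apply: dX; rewrite cs (lt_le_trans st te).
- move=> s /andP[cs st]; have se := lt_le_trans st te.
  case/lastP E : (w : seq _) => [|u i]; first by move: wn; rewrite E.
  have um : (size u <= m)%N.
    by rewrite (leq_trans _ (size_bseq w)) // E size_rcons.
  rewrite (@mul_tensor_of _ _ _ _ _ (Bseq um) _ i E) normrM ler_pM //.
    apply: IH; last by rewrite !ltW.
    by move: wn; rewrite E size_rcons => -[].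
  by apply: hM; rewrite cs se.
- exact: within_cont_sub (cX w).
Qed.

Definition ebasis (i : 'I_dimV) : V := (vbasis {:V})`_i.

Lemma vcoord_ebasis i j : vcoord i (ebasis j) = (i == j)%:R.
Proof. by rewrite /vcoord /ebasis coord_free ?(basis_free (vbasisP _)) // eq_sym. Qed.

Lemma tensor_of_sum x : tensor_of x = \sum_i vcoord i x *: tensor_of (ebasis i) :> T.
Proof.
apply/ffunP => w; rewrite tsum_coef tensor_of_coef.
case E : (w : seq _) => [|j [|k s]].
- by rewrite big1 // => i _; rewrite tscale_coef tensor_of_coef E mulr0.
- rewrite (bigD1 j) //= big1 ?addr0 => [|i ij]; rewrite tscale_coef tensor_of_coef E vcoord_ebasis.
    by rewrite eqxx mulr1.
  by rewrite eq_sym (negbTE ij) mulr0.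
- by rewrite big1 // => i _; rewrite tscale_coef tensor_of_coef E mulr0.
Qed.

Definition eexp (q : R * 'I_dimV) : T := texpn (q.1 *: tensor_of (ebasis q.2)).

(** The endpoints of lifted broken lines with sides parallel to the basis vectors and total length
    at most [L]. *)
Definition reach (L : R) g :=
  exists2 s : seq (R * 'I_dimV), g = \prod_(q <- s) eexp q & \sum_(q <- s) `|q.1| <= L.

Lemma reach_le L L' g : L <= L' -> reach L g -> reach L' g.
Proof. by move=> LL' [s -> sL]; exists s => //; exact: le_trans LL'. Qed.

Lemma reach1 L : 0 <= L -> reach L 1.
Proof. by move=> L0; exists [::]; rewrite !big_nil. Qed.

Lemma reachM L L' g h : reach L g -> reach L' h -> reach (L + L') (g * h).
Proof.
by move=> [s -> sL] [s' -> sL']; exists (s ++ s'); rewrite !big_cat //= lerD.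
Qed.

Lemma reach_exp t i : reach `|t| (texpn (t *: tensor_of (ebasis i))).
Proof. by exists [:: (t, i)]; rewrite big_seq1. Qed.

Lemma eexp_group q : G (eexp q).
Proof. exact: (free_group_exp (lin_setZ q.1 free_lie_lin (free_lie_tensor _))). Qed.

Lemma prod_group s : G (\prod_(q <- s) eexp q).
Proof. by apply: big_ind => [||q _]; [exact: free_group1|exact: free_groupM|exact: eexp_group]. Qed.

Lemma reach_group L g : reach L g -> G g.
Proof. by move=> [s -> _]; exact: prod_group. Qed.

Lemma reachV L g : reach L g -> reach L (tinv g).
Proof.
move=> [s -> sL]; apply: reach_le sL _.
elim: s => [|q s IH]; first by rewrite !big_nil tinv1; exact: reach1.
rewrite !big_cons tinvM; [|exact/free_group_nil/eexp_group|exact/free_group_nil/prod_group].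
rewrite addrC; apply: reachM => //; rewrite /eexp texpN; last first.
  by apply: tgeZ; exact: tensor_of_ge1.
by rewrite -scaleNr -normrN; exact: reach_exp.
Qed.

Lemma reach_dilation t L g : reach L g -> reach (`|t| * L) (dilation t g).
Proof.
move=> [s -> sL]; apply: (reach_le (L := `|t| * \sum_(q <- s) `|q.1|)).
  by rewrite ler_wpM2l.
elim: s {sL} => [|q s IH]; first by rewrite !big_nil dilation_one mulr0; exact: reach1.
rewrite !big_cons dilationM mulrDr; apply: reachM => //.
rewrite /eexp dilation_texp dilationZ dilation_tensor scalerA.
by rewrite [q.1 * t]mulrC -normrM; exact: reach_exp.
Qed.

Lemma eexp_inbox q : inbox `|q.1| (eexp q).
Proof.
have h := sol_exp_linear 0 q.1 (tensor_of_ge1 (ebasis q.2)).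
have : inbox (`|q.1| * (1 - 0)) (texpn ((0 + q.1 * 1) *: tensor_of (ebasis q.2)) : T).
  apply: (@sol_bound 0 1 `|q.1| (fun=> q.1 *: ebasis q.2)
    (fun t => texpn ((0 + q.1 * t) *: tensor_of (ebasis q.2)))) => //.
  - move=> t _ i; rewrite /vcoord linearZ /= -/(vcoord _ _) vcoord_ebasis normrM.
    by case: eqP => _; rewrite ?normr1 ?normr0 ?mulr1 ?mulr0.
  - by apply: sol_eq h => t _; rewrite tensor_ofZ.
  - by rewrite mulr0 addr0 scale0r texpn0.
by rewrite subr0 add0r !mulr1.
Qed.

Lemma reach_inbox L g : reach L g -> inbox L g.
Proof.
move=> [s -> sL]; apply: inbox_le sL _; first by apply: sumr_ge0.
elim: s => [|q s IH]; first by rewrite !big_nil; exact: inbox1.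
rewrite !big_cons; apply: inboxM => //; last exact: eexp_inbox.
by apply: sumr_ge0.
Qed.

End Group.
Arguments free_group1 {R V m}.

(** * Generation by exponentials of basis vectors *)

(* Linear identities between noncommutative monomials, coordinate by coordinate. *)
Local Ltac tzmod := apply/ffunP => ?;
  rewrite !(tadd_coef, topp_coef, tscale_coef); ring.

Section Chow.
Context {R : realType} {V : normedVectType R} {m : nat}.
Local Notation dimV := (\dim {:V}).
Local Notation T := (trunc_tensor R dimV m).
Local Notation g0 := (@free_nilpotent_lie R V m).
Local Notation G := (@free_nilpotent_group R V m).
Implicit Types (a b g h : T).

Definition approx n a g := tge n.+1 (g - 1 - a).

Lemma approx_ge n a g : tge n a -> approx n a g -> tge n (g - 1).
Proof.
by move=> ha hg; rewrite -[g - 1](subrK a); apply: tgeD => //; apply: tge_le hg.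
Qed.

Lemma approxM n a b g h : (0 < n)%N -> tge n a -> tge n b ->
  approx n a g -> approx n b h -> approx n (a + b) (g * h).
Proof.
move=> n0 ha hb hg hh; rewrite /approx.
have -> : g * h - 1 - (a + b) = (g - 1 - a) + (h - 1 - b) + (g - 1) * (h - 1).
  by rewrite !(mulrDl, mulrDr, mulrN, mulNr) !mulr1 mul1r; tzmod.
apply: tgeD; first exact: tgeD.
apply: (@tge_le _ _ _ _ (n + n)); first by rewrite -addn1 leq_add2l.
by apply: tgeM; [exact: approx_ge hg|exact: approx_ge hh].
Qed.

Lemma approx1 n : approx n 0 1.
Proof. by rewrite /approx subrr subr0; exact: tge0. Qed.

(** A single length [L] serves all multiples [l] with [|l| <= B]. This uniformity is what survives
    linear combinations and brackets, and it yields bounds depending only on the size of the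
    coordinates. *)
Definition curve n a := tge n a /\ forall B : R, exists L, forall l, `|l| <= B ->
  exists2 g, reach L g & approx n (l *: a) g.

Lemma curve_lin n : (0 < n)%N -> lin_set (curve n).
Proof.
move=> n0; split.
  split; first exact: tge0.
  move=> B; exists 0 => l _; exists 1; first exact: reach1.
  by rewrite scaler0; exact: approx1.
move=> k a b [ha ca] [hb cb]; split; first exact: tge_lin.
move=> B; have [La hLa] := ca (`|k| * B); have [Lb hLb] := cb B.
exists (La + Lb) => l lB.
have [|g rg ag] := hLa (k * l); first by rewrite normrM ler_wpM2l.
have [h rh ah] := hLb l lB.
exists (g * h); first exact: reachM.
rewrite scalerDr scalerA [l * k]mulrC; apply: approxM => //; exact: tgeZ.
Qed.

(* The group commutator of [1 + l a + ...] and [1 + b + ...] is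
   [1 + l [a, b] + ...], up to the sign convention of [adj]. *)
Lemma curve_adj p q a b : (0 < p)%N -> (0 < q)%N -> curve p a -> curve q b ->
  curve (p + q) (adj a b).
Proof.
move=> p0 q0 [ha ca] [hb cb]; split.
  by apply: tgeB; [rewrite addnC|]; exact: tgeM.
move=> B; have [La hLa] := ca B; have [Lb hLb] := cb 1.
exists (Lb + La + (Lb + La)) => l lB.
have [g rg ag] := hLa l lB.
have [|h rh] := hLb 1; first by rewrite normr1.
rewrite scale1r => ah.
have g1 := free_group_nil (reach_group rg); have h1 := free_group_nil (reach_group rh).
exists (h * g * (tinv h * tinv g)).
  by apply: reachM; apply: reachM => //; exact: reachV.
pose k := tinv h * tinv g.
have k1 : tge 1 (k - 1).
  by apply/tgeB1; rewrite coef_nil_mul !tinv_nil // mulr1.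
(* The commutator minus 1 is therefore [(h * g - g * h) * k], where [h * g - g * h] depends only on
   [h - 1] and [g - 1], and [k] is 1 up to terms of higher degree. *)
have e : g * h * k = 1 by rewrite /k mulrA -(mulrA g) tinvV // mulr1 tinvV.
have gp := approx_ge (tgeZ l ha) ag; have hq := approx_ge hb ah.
rewrite /approx -/k.
have -> : h * g * k - 1 - l *: adj a b =
   (h * g - g * h - l *: adj a b) + (h * g - g * h) * (k - 1).
  by rewrite -{1}e !(mulrDl, mulrDr, mulrN, mulNr) !mulr1; tzmod.
have -> : h * g - g * h = (h - 1) * (g - 1) - (g - 1) * (h - 1).
  by rewrite !(mulrDl, mulrDr, mulrN, mulNr) !mulr1 !mul1r; tzmod.
apply: tgeD.
  have -> : (h - 1) * (g - 1) - (g - 1) * (h - 1) - l *: adj a b =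
     ((h - 1 - b) * (g - 1) + b * (g - 1 - l *: a)) -
     ((g - 1 - l *: a) * (h - 1) + (l *: a) * (h - 1 - b)).
    rewrite /adj; move: (h - 1) (g - 1) => y x.
    rewrite !(mulrDl, mulrDr, mulrN, mulNr) -!scalerAl -!scalerAr; tzmod.
  have la := tgeZ l ha.
  apply: tgeB; apply: tgeD.
  - by apply: (tge_le _ (tgeM ah gp)); lia.
  - by apply: (tge_le _ (tgeM hb ag)); lia.
  - by apply: (tge_le _ (tgeM ag hq)); lia.
  - by apply: (tge_le _ (tgeM la ah)); lia.
rewrite -addn1; apply: tgeM => //.
by apply: tgeB; [rewrite addnC|]; exact: tgeM.
Qed.

(** The tensors without constant term whose homogeneous components all satisfy [curve] form a Lie
    subalgebra containing [V]: the degree [n] component of a bracket is a sum of brackets of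
    components of degrees [k] and [n - k]. *)
Lemma lie_curve a : g0 a -> forall n, (0 < n)%N -> curve n (tproj n a).
Proof.
move=> ga.
suff : tge 1 a /\ forall n, (0 < n)%N -> curve n (tproj n a) by case.
move: ga => /(_ [set a | tge 1 a /\ forall n, (0 < n)%N -> curve n (tproj n a)]); apply; split; last first.
  move=> _ [x _ <-] /=; split; first exact: tensor_of_ge1.
  move=> n n0; have cl := curve_lin n0; rewrite tensor_of_sum.
  have -> : tproj n (\sum_i vcoord i x *: tensor_of (ebasis i) : T) =
     \sum_i vcoord i x *: tproj n (tensor_of (ebasis i) : T).
    apply/ffunP => w; rewrite tproj_coef !tsum_coef; case: eqP => wn; last first.
      by rewrite big1 // => i _; rewrite tscale_coef tproj_coef; case: eqP => // _; rewrite mulr0.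
    by apply: eq_bigr => i _; rewrite !tscale_coef tproj_coef wn eqxx.
  apply: lin_set_sum => // i _; apply: lin_setZ => //.
  case: (eqVneq n 1%N) => [->|n1]; last first.
    suff -> : tproj n (tensor_of (ebasis i) : T) = 0 by exact: cl.1.
    apply/ffunP => w; rewrite tproj_coef tzero_coef tensor_of_coef.
    by case: eqP => // wn; move: n1; rewrite -wn; case: (w : seq _) => [|? []].
  have -> : tproj 1 (tensor_of (ebasis i) : T) = tensor_of (ebasis i).
    apply/ffunP => w; rewrite tproj_coef tensor_of_coef.
    by case: (w : seq _) => [|? []].
  split; first exact: tensor_of_ge1.
  move=> B; exists B => l lB; exists (texpn (l *: tensor_of (ebasis i))).
    by apply: reach_le lB _; exact: reach_exp.
  by apply: texp_tail => //; apply/tgeZ/tensor_of_ge1.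
split.
- split; first exact: tge0.
  move=> n n0; have cl := curve_lin n0.
  suff -> : tproj n (0 : T) = 0 by exact: cl.1.
  by apply/ffunP => w; rewrite tproj_coef tzero_coef; case: ifP.
- move=> k x y [x1 cx] [y1 cy]; split; first exact: tge_lin.
  move=> n n0; rewrite tproj_lin; apply: (curve_lin n0).2; [exact: cx|exact: cy].
move=> x y [x1 cx] [y1 cy]; split; first by apply: tgeB; exact: tgeMl.
move=> n n0; have cl := curve_lin n0.
rewrite -scaleN1r addrC tproj_lin scaleN1r addrC !tprojM.
have -> : \sum_(k < n.+1) tproj k y * tproj (n - k) x =
    \sum_(k < n.+1) tproj (n - k) y * tproj k x.
  rewrite (reindex_inj rev_ord_inj) /=; apply: eq_bigr => k _.
  by rewrite subSS subKn // -ltnS.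
rewrite -sumrB; apply: (lin_set_sum (L := curve n)) => // k _.
have z0 (z : T) : tge 1 z -> tproj 0 z = 0.
  move=> z1; apply/ffunP => w; rewrite tproj_coef tzero_coef; case: eqP => // w0.
  by apply: z1; rewrite w0.
have [k0|k0] := posnP k; first by rewrite k0 z0 // mul0r mulr0 subrr; exact: cl.1.
have [kn|kn] := eqVneq (k : nat) n.
  by rewrite kn subnn (z0 y) // mulr0 mul0r subrr; exact: cl.1.
have kn' : (k < n)%N by rewrite ltn_neqAle kn -ltnS ltn_ord.
have {1}-> : (n = (n - k) + k)%N by rewrite subnK // ltnW.
by apply: curve_adj; rewrite ?subn_gt0 //; [apply: cy; rewrite subn_gt0|apply: cx].
Qed.

Lemma approx_prod n (I : Type) (r : seq I) (L : I -> R) (a : I -> T) : (0 < n)%N ->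
  (forall i, tge n (a i)) ->
  (forall i, exists2 g, reach (L i) g & approx n (a i) g) ->
  exists2 g, reach (\sum_(i <- r) L i) g & approx n (\sum_(i <- r) a i) g.
Proof.
move=> n0 ha H; elim: r => [|i r [g rg ag]].
  by exists 1; rewrite !big_nil; [exact: reach1|exact: approx1].
have [h rh ah] := H i.
exists (h * g); rewrite !big_cons; first exact: reachM.
by apply: approxM => //; exact: tge_sum.
Qed.

(** Descending induction on [n], with [k] counting the degrees left. The leading component of [g] is
    expanded in a basis of [curve n] and realized by a product [h]; then [g * tinv h] starts one
    degree higher and its coordinates are still bounded. *)
Lemma chow_graded k n (B : R) : (n + k = m.+1)%N -> (0 < n)%N ->
  exists L, forall g, G g -> tge n (g - 1) -> tbounded B g -> reach L g.
Proof.
elim: k n B => [|k IH] n B nk n0.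
  exists 0 => g Gg; rewrite -[n]addn0 nk => /(tge_eq0 (ltnSn m)) /subr0_eq -> _.
  exact: reach1.
have cl := curve_lin n0.
have [r [Y [C [cY YC]]]] := tensor_basis cl.
pose D := \sum_i \sum_w `|C i w| * `|B|.
have D0 : 0 <= D by apply: sumr_ge0 => i _; apply: sumr_ge0 => w _; exact: mulr_ge0.
have [L hL] : exists L : 'I_r -> R, forall i l, `|l| <= D ->
    exists2 g, reach (L i) g & approx n (l *: Y i) g.
  have /choice : forall i, exists L, forall l, `|l| <= D ->
      exists2 g, reach L g & approx n (l *: Y i) g by move=> i; case: (cY i) => _; apply.
  by move=> [L hL]; exists L.
pose S := \sum_i `|L i|.
have S0 : 0 <= S by exact: sumr_ge0.
(* Bounds the coordinates of [g * tinv h]: those of [g] are at most [|B|], and [tinv h], reached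
   with length [S], has coordinates at most [(1 + S) ^+ m]. *)
pose B' := m.+1%:R * (`|B| * (1 + S) ^+ m).
have [L' hL'] := IH n.+1 B' (etrans (addSnnS _ _) nk) isT.
exists (L' + S) => g Gg gn gB.
have g1 := free_group_nil Gg.
pose a : T := tproj n (g - 1).
(* The leading components of [g - 1] and of [tlog g] coincide, and [tlog g] lies in the Lie
   algebra. *)
have ca : curve n a.
  have [_ lg] := (free_groupP g).1 Gg; have := lie_curve lg n0.
  congr curve; apply: tproj_eq.
  have ln : tge n (tlog g) by exact: tlog_geN.
  have := texp_tail n0 ln; rewrite tlogK // => h.
  have -> : tlog g - (g - 1) = - (g - 1 - tlog g) by tzmod.
  exact: tgeN.
have aB w : `|a w| <= `|B|.
  rewrite tproj_coef; case: eqP => [wn|_]; last by rewrite normr0.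
  rewrite tadd_coef topp_coef tone_coef wn gtn_eqF // subr0.
  by rewrite (le_trans (gB w)) // ler_norm.
pose l i := \sum_w C i w * a w.
have lD i : `|l i| <= D.
  rewrite /D (bigD1 i) //= -[leLHS]addr0 lerD //.
    rewrite (le_trans (ler_norm_sum _ _ _)) //; apply: ler_sum => w _.
    by rewrite normrM ler_wpM2l.
  by apply: sumr_ge0 => j _; apply: sumr_ge0 => w _; exact: mulr_ge0.
have [h rh] : exists2 h, reach (\sum_i L i) h & approx n (\sum_i l i *: Y i) h.
  apply: approx_prod => // i; last exact: hL.
  by apply: tgeZ; case: (cY i).
rewrite -YC // => ah.
have {}rh : reach S h by apply: reach_le rh; apply: ler_sum => i _; exact: ler_norm.
have h1 := free_group_nil (reach_group rh).
have -> : g = g * tinv h * h by rewrite -mulrA tVinv // mulr1.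
apply: reachM => //; apply: hL'.
- by apply: free_groupM => //; apply: free_groupV; exact: reach_group rh.
- have -> : g * tinv h - 1 = (g - 1 - a - (h - 1 - a)) * tinv h.
    have <- : g - h = g - 1 - a - (h - 1 - a) by tzmod.
    by rewrite mulrBl tinvV.
  by apply: tgeMl; apply: tgeB => //; exact: tproj_sub.
- apply: tboundedM => //; first by rewrite exprn_ge0 // addr_ge0.
    by move=> w; rewrite (le_trans (gB w)) // ler_norm.
  by apply: inbox_bounded => //; apply/reach_inbox/reachV.
Qed.

Lemma chow_bounded (B : R) : exists L, forall g, G g -> tbounded B g -> reach L g.
Proof.
have [L hL] := @chow_graded m 1 B (add1n m) isT.
by exists L => g Gg gB; apply: hL => //; apply/tgeB1/free_group_nil.
Qed.

(** The dilation by [r^-1] reduces to coordinates bounded by 1, and dilating back multiplies the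
    length by [r]. For [r = 0] the box contains only the neutral element of the group. *)
Lemma chow_box : exists2 L : R, 0 <= L & forall r g, 0 <= r -> G g -> inbox r g -> reach (r * L) g.
Proof.
have [L hL] := chow_bounded 1.
exists `|L| => // r g r0 Gg hg.
have [r00|rn0] := eqVneq r 0.
  rewrite r00 mul0r; have -> : g = 1; last exact: reach1.
  apply/ffunP => w; rewrite tone_coef; case: eqP => [w0|/eqP w0].
    have -> : w = [bseq] by apply/val_inj/size0nil.
    exact: free_group_nil.
  by apply/normr0_eq0/le_anti; rewrite normr_ge0 (le_trans (hg w)) // r00 expr0n (negbTE w0).
have rp : 0 < r by rewrite lt_def rn0.
have -> : g = dilation r (dilation r^-1 g) by rewrite dilation_comp divff // dilation_id.
rewrite -{1}(ger0_norm r0); apply: reach_dilation; apply: reach_le (ler_norm L) _.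
apply: hL; first exact: free_group_dilation.
move=> w; have := inbox_dilation (t := r^-1) _ hg; rewrite invr_ge0 => /(_ r0 w).
by rewrite mulVf // expr1n.
Qed.

End Chow.

(** * Homogeneous norms *)

Section GroupClosed.
Context {R : realType} {V : normedVectType R} {m : nat}.
Local Notation dimV := (\dim {:V}).
Local Notation W := {bseq m of 'I_dimV}.
Local Notation T := (trunc_tensor R dimV m).
Local Notation G := (@free_nilpotent_group R V m).

(** Row vectors carry the normed topology in which closed bounded sets are known to be compact. *)
Definition tensor_of_row (v : 'rV[R]_#|W|) : T := coeff_tensor (fun w => v 0 (enum_rank w)).
Definition row_of_tensor (a : T) : 'rV[R]_#|W| := \row_i a (enum_val i).

Lemma row_of_tensorK a : tensor_of_row (row_of_tensor a) = a.
Proof. by apply/ffunP => w; rewrite coeff_tensorE mxE enum_rankK. Qed.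

Lemma tensor_of_row_coef v w : tensor_of_row v w = v 0 (enum_rank w).
Proof. exact: coeff_tensorE. Qed.

Lemma tensor_of_row_cont : tcontU tensor_of_row.
Proof.
move=> w; rewrite (_ : (fun u => _) = fun v : 'rV[R]_#|W| => v 0 (enum_rank w)).
  exact: coord_continuous.
by apply/funext => v; rewrite tensor_of_row_coef.
Qed.

Lemma tlog_cont (U : topologicalType) (X : U -> T) : tcontU X -> tcontU (fun u => tlog (X u)).
Proof.
move=> cX; apply: tcont_sum => k; apply: tcontZ; first exact: cont_cst.
by apply: tcontX; apply: tcontD => //; exact: tcont_cst.
Qed.

Lemma closed_zero (U : topologicalType) (f : U -> R) : continuous f -> closed [set u | f u = 0].
Proof.
move=> cf; rewrite (_ : [set u | _] = f @^-1` [set 0]) //.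
apply: closed_comp; first by move=> u _; exact: cf.
exact: closed_eq.
Qed.

(** Through the logarithm, which is a polynomial, the group is cut out by finitely many equations
    between continuous functions. *)
Lemma free_group_closed : closed [set v | G (tensor_of_row v)].
Proof.
have [E EP] := tensor_separation (@free_lie_lin R V m).
rewrite (_ : [set v | _] = [set v | tensor_of_row v [bseq] + -1 = 0] `&`
  \bigcap_(u : W) [set v | \sum_w E u w * tlog (tensor_of_row v) w = 0]); last first.
  apply/seteqP; split=> v /=.
    move=> /free_groupP[v1 /EP lv]; split; first by rewrite v1 subrr.
    by move=> u _; exact: lv.
  move=> [/subr0_eq v1 lv]; apply/free_groupP; split => //.
  by apply/EP => u; exact: lv.
apply: closedI.
  apply: closed_zero; apply: cont_add; [exact: tensor_of_row_cont|exact: cont_cst].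
apply: closed_bigI => u _; apply: closed_zero; apply: cont_sum => w.
apply: cont_mul; first exact: cont_cst.
exact: (tlog_cont tensor_of_row_cont).
Qed.

End GroupClosed.

Section Norm.
Context {R : realType} {V : normedVectType R} {m : nat}.
Local Notation dimV := (\dim {:V}).
Local Notation W := {bseq m of 'I_dimV}.
Local Notation T := (trunc_tensor R dimV m).
Local Notation G := (@free_nilpotent_group R V m).
Variable N : T -> R.
Hypothesis hN : homogeneous_norm N.
Implicit Types (g h : T).

Lemma hnorm_ge0 g : G g -> 0 <= N g. Proof. by case: hN => H *; exact: H. Qed.
Lemma hnorm_eq0 g : G g -> N g = 0 -> g = 1.
Proof. by case: hN => _ H _ _ _ Gg /(H g Gg). Qed.
Lemma hnorm1 : N 1 = 0.
Proof. by case: hN => _ H _ _ _; apply/(H 1); [exact: free_group1|]. Qed.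
Lemma hnorm_dil g t : G g -> N (dilation t g) = `|t| * N g.
Proof. by case: hN => _ _ H _ _; exact: H. Qed.
Lemma hnormM g h : G g -> G h -> N (g * h) <= N g + N h.
Proof. by case: hN => _ _ _ H _; exact: H. Qed.
Lemma hnormV g : G g -> N (tinv g) = N g.
Proof. by case: hN => _ _ _ _; exact. Qed.

(** The exponential of [t] times a basis vector is a dilation by [t] of a fixed group element, so
    homogeneity and subadditivity alone give the bound. *)
Lemma hnorm_reach : exists2 M : R, 0 <= M & forall L g, reach L g -> N g <= M * L.
Proof.
pose M := \sum_i N (eexp (1, i)).
have M0 : 0 <= M by apply: sumr_ge0 => i _; apply/hnorm_ge0/eexp_group.
exists M => // L g [s -> sL]; apply: (@le_trans _ _ (M * \sum_(q <- s) `|q.1|)); last first.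
  by rewrite ler_wpM2l.
elim: s {sL} => [|q s IH]; first by rewrite !big_nil hnorm1 mulr0.
rewrite !big_cons (le_trans (hnormM _ _)) //; [exact: eexp_group|exact: prod_group|].
rewrite mulrDr lerD //.
have -> : eexp q = dilation q.1 (eexp (1, q.2)) :> T.
  by rewrite /eexp dilation_texp dilationZ dilation_tensor scale1r.
rewrite hnorm_dil; last exact: eexp_group.
rewrite mulrC ler_wpM2r // /M (bigD1 q.2) //= lerDl.
by apply: sumr_ge0 => i _; apply/hnorm_ge0/eexp_group.
Qed.

Lemma hnorm_box : exists2 C : R, 0 < C & forall r g, 0 <= r -> G g -> inbox r g -> N g <= C * r.
Proof.
have [M M0 hM] := hnorm_reach; have [L L0 hL] := @chow_box R V m.
exists (M * L + 1); first by rewrite ltr_wpDl // mulr_ge0.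
move=> r g r0 Gg gr; rewrite (le_trans (hM _ _ (hL _ _ r0 Gg gr))) //.
by rewrite mulrDl mul1r [r * L]mulrC mulrA lerDl.
Qed.

Lemma hnorm_sub g h : G g -> G h -> `|N g - N h| <= N (tinv g * h).
Proof.
move=> Gg Gh; have g1 := free_group_nil Gg; have h1 := free_group_nil Gh.
have G' : G (tinv g * h) by apply: free_groupM => //; exact: free_groupV.
have e1 : N h <= N g + N (tinv g * h).
  by rewrite -{1}(mul1r h) -(tinvV g1) -mulrA hnormM.
have e2 : N g <= N h + N (tinv g * h).
  rewrite -[N (tinv g * h)]hnormV // tinvM ?tinv_nil // tinvK //.
  rewrite -{1}(mul1r g) -(tinvV h1) -mulrA hnormM //.
  by apply: free_groupM => //; exact: free_groupV.
by rewrite ler_norml; apply/andP; split; lra.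
Qed.

(** Subadditivity and symmetry bound the variation of [N] between two elements by [N] of their
    quotient, and [hnorm_box] makes it small when the quotient has small coordinates. *)
Lemma hnorm_cont : {within [set v | G (tensor_of_row v)], continuous (N \o tensor_of_row)}.
Proof.
have [C C0 hC] := hnorm_box.
apply/subspace_continuousP => v Gv; apply/cvgrPdist_le => e e0.
have eC : 0 < e / C by rewrite divr_gt0.
have cX : tcontU (fun u : 'rV[R]_#|W| => tinv (tensor_of_row v) * tensor_of_row u).
  by apply: tcontM; [exact: tcont_cst|exact: tensor_of_row_cont].
have H : \forall u \near v, forall w : W, (size w != 0)%N ->
    `|(tinv (tensor_of_row v) * tensor_of_row u) w| <= (e / C) ^+ size w.
  apply: (@filter_forall _ W (fun w u => (size w != 0)%N ->
    `|(tinv (tensor_of_row v) * tensor_of_row u) w| <= (e / C) ^+ size w)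
    (nbhs v) (nbhs_filter v)) => w.
  case: eqP => [w0|w0]; first by near=> u.
  have := cX w v; rewrite /continuous_at (tVinv (free_group_nil Gv)) tone_coef.
  move/eqP/negbTE : (w0) => -> /cvgrPdist_le/(_ ((e / C) ^+ size w)).
  rewrite exprn_gt0 // => /(_ isT); apply: filterS => u.
  by rewrite sub0r normrN.
near=> u => /=.
have Gu : G (tensor_of_row u) by near: u; exact: withinT.
have -> : e = C * (e / C) by rewrite mulrC divfK // gt_eqF.
apply: (le_trans (hnorm_sub Gv Gu)); apply: hC; first exact: ltW.
  by apply: free_groupM => //; exact: free_groupV.
move=> w; have [w0|w0] := eqVneq (size w) 0%N.
  have -> : w = [bseq] by apply/val_inj/size0nil.
  by rewrite coef_nil_mul tinv_nil ?free_group_nil // mulr1 normr1.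
move: w w0; near: u; exact: cvg_within H.
Unshelve. all: by end_near. Qed.

End Norm.

(** * Comparison of the norm with coordinates, and conjugation *)

Section NormComparison.
Context {R : realType} {V : normedVectType R} {m : nat}.
Local Notation dimV := (\dim {:V}).
Local Notation W := {bseq m of 'I_dimV}.
Local Notation T := (trunc_tensor R dimV m).
Local Notation G := (@free_nilpotent_group R V m).
Variable N : T -> R.
Hypothesis hN : homogeneous_norm N.
Implicit Types (g h : T).

Lemma closed_superlevel (U : topologicalType) (f : U -> R) (c : R) : continuous f -> closed [set u | c <= f u].
Proof.
move=> cf; rewrite (_ : [set u | _] = f @^-1` [set x | c <= x]) //.
apply: closed_comp; first by move=> u _; exact: cf.
exact: closed_ge.
Qed.

(** A compact substitute for a unit sphere. The gap between [2^-1 ^+ m] and 1 is wide enough that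
    repeated dilations by one half, entering [tbounded 1] from outside, cannot jump over it. *)
Definition shell : set 'rV[R]_#|W| := [set v | [/\ G (tensor_of_row v),
  tbounded 1 (tensor_of_row v) &
  exists2 w : W, size w != 0%N & 2^-1 ^+ m <= `|tensor_of_row v w|]].

Lemma shell_compact : compact shell.
Proof.
apply: bounded_closed_compact.
  exists 1; split => // x x1 v [_ v1 _] /=; rewrite (le_trans _ (ltW x1)) //.
  rewrite [leLHS]/Num.norm /= mx_normrE; apply/bigmax_leP; split => // -[i j] _ /=.
  by have := v1 (enum_val j); rewrite tensor_of_row_coef enum_valK (ord1 i).
rewrite (_ : shell = [set v | G (tensor_of_row v)] `&`
  (\bigcap_(w : W) [set v | - 1 <= - `|tensor_of_row v w|] `&`
   \bigcup_(w in [set w : W | size w != 0%N]) [set v | 2^-1 ^+ m <= `|tensor_of_row v w|])); last first.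
  apply/seteqP; split => v.
    move=> [Gv v1 [w w0 hw]]; split => //; split; last by exists w.
    by move=> w' _ /=; rewrite lerN2.
  move=> [Gv [v1 [w w0 hw]]]; split => //; last by exists w.
  by move=> w'; have := v1 w' I; rewrite /= lerN2.
have cn (w : W) : continuous (fun v : 'rV[R]_#|W| => `|tensor_of_row v w|).
  by apply: cont_norm; exact: (@tensor_of_row_cont R V m w).
apply: closedI; first exact: (@free_group_closed R V m).
apply: closedI.
  apply: closed_bigI => w _; apply: closed_superlevel.
  by apply: cont_opp; exact: cn.
apply: closed_bigcup; first exact: finite_finset.
by move=> w _; apply: closed_superlevel; exact: cn.
Qed.

Lemma hnorm_shell : exists2 e : R, 0 < e & forall v, shell v -> e <= N (tensor_of_row v).
Proof.
have [s0|/set0P s0] := eqVneq shell set0; first by exists 1 => // v; rewrite s0.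
have cN : {within shell, continuous (N \o @tensor_of_row R V m)}.
  by apply: continuous_subspaceW (hnorm_cont hN) => v [].
have [v sv vmin] := EVT_min_rV s0 shell_compact cN.
exists (N (tensor_of_row v)); last by move=> u su; apply: vmin; rewrite inE.
move: sv; rewrite inE => -[Gv _ [w w0 hw]].
rewrite lt_def hnorm_ge0 // andbT; apply/eqP => /(hnorm_eq0 hN Gv) v1.
by move: hw; rewrite v1 tone_coef (negbTE w0) normr0 leNgt exprn_gt0 //.
Qed.

Lemma tbounded1_inbox g : tbounded 1 g -> inbox 1 g.
Proof. by move=> g1 w; rewrite expr1n. Qed.

(** If [g] is unbounded, halve it until it first becomes bounded. It is then in the shell, where [N]
    is at least [e], while the dilations have only decreased [N]. *)
Lemma small_bounded : exists2 e : R, 0 < e & forall g, G g -> N g < e -> tbounded 1 g.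
Proof.
have [e e0 he] := hnorm_shell; exists e => // g Gg Ne.
apply: contrapT => g1.
pose P k := `[< tbounded 1 (dilation (2^-1 ^+ k) g) >].
have half0 k : 0 < 2^-1 ^+ k :> R by rewrite exprn_gt0 // invr_gt0.
have half1 k : 2^-1 ^+ k <= 1 :> R by rewrite exprn_ile1 // ?invr_ge0 // invf_le1 // ler1n.
have exP : exists k, P k.
  pose B := \sum_w `|g w|.
  (* Any exponent [k] with [2 ^ k >= B] works, and [k < 2 ^ k]. *)
  exists (Num.trunc B).+1; apply/asboolP => w; rewrite dilation_coef normrM.
  have [w0|w0] := eqVneq (size w) 0%N.
    have -> : w = [bseq] by apply/val_inj/size0nil.
    by rewrite (free_group_nil Gg) expr0 !normr1 mulr1.
  rewrite normrX (gtr0_norm (half0 _)) -exprM -(prednK (_ : 0 < size w)%N) ?lt0n //.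
  rewrite mulnS exprD -mulrA.
  apply: (@le_trans _ _ (2^-1 ^+ (Num.trunc B).+1 * `|g w|)).
    by rewrite ler_wpM2l ?(ltW (half0 _)) // ler_piMl.
  have gB : `|g w| <= B.
    by rewrite /B (bigD1 w) //= lerDl; apply: sumr_ge0.
  rewrite exprVn mulrC ler_pdivrMr ?exprn_gt0 // mul1r (le_trans gB) //.
  apply: (@le_trans _ _ (Num.trunc B).+1%:R).
    by apply: ltW; apply: truncnS_gt.
  by rewrite -natrX ler_nat ltnW // ltn_expl.
case: (ex_minnP exP) => k /asboolP Pk kmin.
case: k Pk kmin => [|k] Pk kmin.
  by apply: g1; move: Pk; rewrite expr0 dilation_id.
have : ~ tbounded 1 (dilation (2^-1 ^+ k) g).
  by move=> h; have := kmin k (introT (asboolP _) h); rewrite ltnn.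
move=> /existsNP[w hw].
have : e <= N (tensor_of_row (row_of_tensor (dilation (2^-1 ^+ k.+1) g))).
  apply: he; rewrite /shell /= row_of_tensorK; split => //; first exact: free_group_dilation.
  have w0 : size w != 0%N.
    apply/eqP => /size0nil w0; apply: hw.
    have -> : w = [bseq] by exact/val_inj.
    by rewrite dilation_nil (free_group_nil Gg) normr1.
  exists w => //; rewrite exprS -dilation_comp dilation_coef normrM normrX.
  rewrite gtr0_norm ?invr_gt0 //.
  apply: (@le_trans _ _ (2^-1 ^+ size w * 1)).
    by rewrite mulr1 ler_wiXn2l ?invr_ge0 // ?invf_le1 ?ler1n // size_bseq.
  rewrite ler_wpM2l ?(ltW (half0 _)) //.
  by move/negP: hw; rewrite -ltNge => /ltW.
rewrite row_of_tensorK hnorm_dil // gtr0_norm // => h.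
have : e <= N g by rewrite (le_trans h) // ler_piMl // hnorm_ge0.
by rewrite leNgt Ne.
Qed.

Lemma hnorm_lower : exists2 c : R, 0 < c & forall g, G g -> inbox (c * N g) g.
Proof.
(* The constant [2 / e] comes from rescaling [g] to norm [e / 2], strictly below the threshold
   [e]. *)
have [e e0 he] := small_bounded; exists (2 / e); first by rewrite divr_gt0.
move=> g Gg; have [g0|gn0] := eqVneq (N g) 0.
  by rewrite (hnorm_eq0 hN Gg g0) (hnorm1 hN) mulr0; exact: inbox1.
have Ng : 0 < N g by rewrite lt_def gn0 hnorm_ge0.
set r := _ * _; have r0 : 0 < r by rewrite mulr_gt0 // divr_gt0.
have -> : g = dilation r (dilation r^-1 g).
  by rewrite dilation_comp divff ?gt_eqF // dilation_id.
rewrite -[r in inbox r]mulr1; apply: inbox_dilation; first exact: ltW.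
apply/tbounded1_inbox/he; first exact: free_group_dilation.
rewrite hnorm_dil // gtr0_norm ?invr_gt0 // /r.
have -> : (2 / e * N g)^-1 * N g = e / 2 by field; rewrite gt_eqF.
by rewrite ltr_pdivrMr // ltr_pMr // ltr1n.
Qed.

Lemma reach_hnorm : exists2 C : R, 0 <= C & forall g, G g -> reach (C * N g) g.
Proof.
have [c c0 hc] := hnorm_lower; have [L L0 hL] := @chow_box R V m.
exists (c * L); first by rewrite mulr_ge0 // ltW.
move=> g Gg; have cN : 0 <= c * N g by rewrite mulr_ge0 ?(ltW c0) // hnorm_ge0.
by rewrite mulrAC; apply: hL => //; exact: hc.
Qed.

(* Conjugation by a bounded element is continuous at 1; by homogeneity the
   conjugate is small compared to [N h] when [N g / N h] is small. *)
Lemma hnorm_conj (eta : R) : 0 < eta ->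
  exists2 C : R, 0 <= C & forall g h, G g -> G h -> N (tinv h * g * h) <= C * N g + eta * N h.
Proof.
move=> eta0; have [c c0 hc] := hnorm_lower; have [C C0 hC] := hnorm_box hN.
(* On the box of radius [r] the norm is at most [eta]; [r <= 1] allows the bound [r ^+ m] in all
   degrees. *)
pose r := Num.min 1 (eta / C).
have r0 : 0 < r by rewrite lt_min ltr01 divr_gt0.
have r1 : r <= 1 by rewrite ge_min lexx.
pose B := (1 + c) ^+ m.
have B0 : 0 < B by rewrite exprn_gt0 // addr_gt0.
pose K := m.+1%:R * (m.+1%:R * (B * 1) * B).
have K0 : 0 < K by rewrite !mulr_gt0.
(* The admissible ratio [N g / N h]. The bound [c^-1] makes the coordinates of [g - 1] at most
   [c * k]; the other puts those of [tinv h * (g - 1) * h], at most [K * c * k], below [r ^+ m]. *)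
pose k := Num.min c^-1 (r ^+ m / (K * c)).
have k0 : 0 < k by rewrite lt_min invr_gt0 c0 divr_gt0 ?exprn_gt0 // mulr_gt0.
have small g h : G g -> G h -> N h = 1 -> N g <= k -> N (tinv h * g * h) <= eta.
  move=> Gg Gh h1 gk.
  have GV := free_groupV Gh.
  have hb : tbounded B h by apply: inbox_bounded (ltW c0) _; have := hc _ Gh; rewrite h1 mulr1.
  have hVb : tbounded B (tinv h).
    by apply: inbox_bounded (ltW c0) _; have := hc _ GV; rewrite (hnormV hN) // h1 mulr1.
  have ck1 : c * k <= 1.
    by rewrite -ler_pdivlMl // mulr1 ge_min lexx.
  have gb : tbounded (c * k) (g - 1).
    move=> w; have [w0|w0] := eqVneq (size w) 0%N.
      have -> : w = [bseq] by apply/val_inj/size0nil.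
      by rewrite !tcoefE (free_group_nil Gg) /= subrr normr0 mulr_ge0 // ltW.
    rewrite !tcoefE (negbTE w0) subr0 (le_trans (hc _ Gg w)) //.
    apply: (@le_trans _ _ ((c * k) ^+ size w)).
      by rewrite lerXn2r ?nnegrE ?mulr_ge0 ?hnorm_ge0 ?(ltW c0) ?(ltW k0) // ler_wpM2l // ltW.
    rewrite -{2}[c * k]expr1 ler_wiXn2l ?lt0n // mulr_ge0 // ltW //.
  have xb := tboundedM _ (ltW B0) (tboundedM (ltW B0) _ hVb gb) hb.
  have {}xb : tbounded (r ^+ m) (tinv h * (g - 1) * h).
    move=> w; apply: le_trans (xb _ _ w) _; rewrite ?mulr_ge0 ?(ltW c0) ?(ltW k0) ?(ltW B0) //.
    have -> : m.+1%:R * (m.+1%:R * (B * (c * k)) * B) = k * (K * c) by rewrite /K; ring.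
    by rewrite -ler_pdivlMr ?mulr_gt0 // ge_min lexx orbT.
  have Gx : G (tinv h * g * h) by apply: free_groupM => //; exact: free_groupM.
  apply: (@le_trans _ _ (C * r)).
    apply: hC => //; first exact: ltW.
    move=> w; have [w0|w0] := eqVneq (size w) 0%N.
      have -> : w = [bseq] by apply/val_inj/size0nil.
      by rewrite (free_group_nil Gx) normr1.
    have := xb w; rewrite mulrBr mulr1 mulrBl (tVinv (free_group_nil Gh)) !tcoefE (negbTE w0) subr0.
    by move/le_trans; apply; rewrite ler_wiXn2l ?(ltW r0) // size_bseq.
  by rewrite -ler_pdivlMl // mulrC ge_min lexx orbT.
exists (1 + 2 / k); first by rewrite addr_ge0 // divr_ge0 // ltW.
move=> g h Gg Gh; have Ng := hnorm_ge0 hN Gg; have Nh := hnorm_ge0 hN Gh.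
have GV := free_groupV Gh.
have crude : N (tinv h * g * h) <= N g + 2 * N h.
  apply: (le_trans (hnormM hN _ Gh)); first exact: free_groupM.
  have := hnormM hN GV Gg; rewrite (hnormV hN) //; lra.
(* When [N g] exceeds [k * N h], the triangle inequality suffices, with [2 * N h] absorbed by
   [2 / k * N g]. Otherwise dilate so that [h] has norm 1. *)
have [gk|gk] := leP (N g) (k * N h); last first.
  apply: (le_trans crude).
  have -> : (1 + 2 / k) * N g = N g + 2 / k * N g by ring.
  have : 2 * N h <= 2 / k * N g.
    by rewrite -mulrA ler_wpM2l // ler_pdivlMl // ltW.
  have := mulr_ge0 (ltW eta0) Nh; lra.
have [h0|h0] := eqVneq (N h) 0.
  apply: (le_trans crude); rewrite h0 !mulr0 !addr0.
  have -> : (1 + 2 / k) * N g = N g + 2 / k * N g by ring.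
  rewrite lerDl.
  by rewrite mulr_ge0 // divr_ge0 // ltW.
have hp : 0 < N h by rewrite lt_def h0.
pose s := (N h)^-1.
have s0 : 0 < s by rewrite invr_gt0.
have := small (dilation s g) (dilation s h) (free_group_dilation _ Gg) (free_group_dilation _ Gh).
rewrite -dilation_inv ?free_group_nil // -!dilationM !hnorm_dil //; last first.
  by apply: free_groupM => //; exact: free_groupM.
rewrite gtr0_norm // mulVf // => /(_ erefl).
rewrite ler_pdivrMl // mulrC => /(_ gk).
rewrite ler_pdivrMl // mulrC => /le_trans; apply.
by rewrite lerDr mulr_ge0 // addr_ge0 // divr_ge0 // ltW.
Qed.

End NormComparison.

(** * Subdivisions and control functions *)

Section Consecutive.
Context {R : realType}.
Implicit Types (f g H : R -> R -> R) (a b s t : R) (D : seq R).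

Lemma sum_consecutive_nil (E : nmodType) (F : R -> R -> E) a : sum_consecutive F a [::] = 0.
Proof. by rewrite /sum_consecutive big_nil. Qed.

Lemma sum_consecutive_cons (E : nmodType) (F : R -> R -> E) a x D :
  sum_consecutive F a (x :: D) = F a x + sum_consecutive F x D.
Proof.
rewrite /sum_consecutive /= big_nat_recl //=; congr (_ + _).
by apply: eq_big_nat => i /andP[_ iD] /=; rewrite -!(set_nth_default x a) // ltnW.
Qed.

Lemma sum_consecutive_cat (E : nmodType) (F : R -> R -> E) a D D' :
  sum_consecutive F a (D ++ D') = sum_consecutive F a D + sum_consecutive F (last a D) D'.
Proof.
elim: D a => [|x D IH] a /=; first by rewrite sum_consecutive_nil add0r.
by rewrite !sum_consecutive_cons IH addrA.
Qed.

Lemma path_le_last a D : path <%R a D -> a <= last a D.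
Proof.
by elim: D a => //= x D IH a /andP[ax xD]; rewrite (le_trans (ltW ax)) // IH.
Qed.

Lemma sum_consecutive_le f g a D : path <%R a D ->
  (forall s t, a <= s -> s < t -> t <= last a D -> f s t <= g s t) ->
  sum_consecutive f a D <= sum_consecutive g a D.
Proof.
elim: D a => [|x D IH] a; first by rewrite !sum_consecutive_nil.
move=> /= /andP[ax xD] fg; rewrite !sum_consecutive_cons lerD //.
  by apply: fg => //; exact: path_le_last.
by apply: IH => // s t xs; apply: fg; rewrite (le_trans (ltW ax)).
Qed.

Lemma sum_consecutiveD f g a D : sum_consecutive (fun s t => f s t + g s t) a D =
  sum_consecutive f a D + sum_consecutive g a D.
Proof. by rewrite /sum_consecutive big_split. Qed.

Lemma sum_consecutiveZ (k : R) f a D : sum_consecutive (fun s t => k * f s t) a D =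
  k * sum_consecutive f a D.
Proof. by rewrite /sum_consecutive mulr_sumr. Qed.

Lemma sum_consecutive_telescope (h : R -> R) a D :
  sum_consecutive (fun s t => h t - h s) a D = h (last a D) - h a.
Proof.
elim: D a => [|x D IH] a; first by rewrite sum_consecutive_nil subrr.
by rewrite sum_consecutive_cons IH /= addrC addrA subrK.
Qed.

Lemma chain_partition f a D : (forall s t, 0 <= s -> s < t -> t <= 1 -> 0 <= f s t) ->
  0 <= a -> path <%R a D -> last a D <= 1 ->
  exists2 D', itv_partition 0 1 D' & sum_consecutive f a D <= sum_consecutive f 0 D'.
Proof.
move=> f0 a0 aD aD1.
have [D1 [D1p D1l D1s]] : exists D1, [/\ path <%R 0 D1, last 0 D1 = last a D &
    sum_consecutive f a D <= sum_consecutive f 0 D1].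
  have [a00|an0] := eqVneq a 0; first by exists D; rewrite -a00.
  have ap : 0 < a by rewrite lt_def an0.
  exists (a :: D); split => //=; first by rewrite ap.
  rewrite sum_consecutive_cons lerDr; apply: f0 => //.
  exact: le_trans (path_le_last aD) aD1.
move: aD1; rewrite -D1l le_eqVlt => /orP[/eqP l1|l1].
  by exists D1 => //; split => //; apply/eqP.
exists (rcons D1 1); first by split; rewrite ?rcons_path ?D1p //= last_rcons.
rewrite -cats1 sum_consecutive_cat sum_consecutive_cons sum_consecutive_nil addr0.
rewrite (le_trans D1s) // lerDl; apply: f0 => //.
by exact: path_le_last.
Qed.

(* [h t] is the supremum of the sums of [f] over the chains of [a, t]. *)
Lemma control f a b (B : R) : a <= b ->
  (forall s t, a <= s -> s < t -> t <= b -> 0 <= f s t) ->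
  (forall u D, a <= u -> path <%R u D -> last u D <= b -> sum_consecutive f u D <= B) ->
  exists h : R -> R, [/\ (forall s t, a <= s -> s <= t -> t <= b -> h s <= h t),
    h b - h a <= B & forall s t, a <= s -> s < t -> t <= b -> f s t <= h t - h s].
Proof.
move=> ab f0 fB.
pose C t : set R := [set sum_consecutive f u.1 u.2 | u in
  [set u : R * seq R | [/\ a <= u.1, path <%R u.1 u.2 & last u.1 u.2 <= t]]].
pose h t := sup (C t).
have C0 t : a <= t -> C t 0.
  by move=> at_; exists (a, [::]) => //=; rewrite sum_consecutive_nil.
have ubC t : t <= b -> ubound (C t) B.
  by move=> tb _ [u [au uD ut] <-]; apply: fB => //; exact: le_trans tb.
have supC t : a <= t -> t <= b -> has_sup (C t).
  by move=> at_ tb; split; [exists 0; exact: C0|exists B; exact: ubC].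
have hge t x : a <= t -> t <= b -> C t x -> x <= h t.
  by move=> at_ tb Cx; apply: (ub_le_sup (supC _ at_ tb).2).
have hle t B' : a <= t -> ubound (C t) B' -> h t <= B'.
  by move=> at_ uC; apply: ge_sup => //; exists 0; exact: C0.
exists h; split.
- move=> s t as_ st tb; have at_ := le_trans as_ st.
  apply: hle => // x [u [au uD us] <-]; apply: hge => //.
  by exists u => //; split => //; exact: le_trans st.
- have hb : h b <= B by apply: hle => //; exact: ubC.
  have ha : 0 <= h a by apply: hge => //; exact: C0.
  by lra.
move=> s t as_ st tb; have at_ := le_trans as_ (ltW st).
have sb := le_trans (ltW st) tb.
rewrite lerBrDl -lerBrDr; apply: hle => // _ [[u D] /= [au uD us] <-].
rewrite lerBrDr.
move: us; rewrite le_eqVlt => /orP[/eqP us|us].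
  apply: hge => //; exists (u, rcons D t).
    by split; rewrite //= ?rcons_path ?last_rcons // uD us.
  by rewrite -cats1 sum_consecutive_cat sum_consecutive_cons sum_consecutive_nil addr0 us.
apply: (@le_trans _ _ (sum_consecutive f u (rcons (rcons D s) t))); last first.
  apply: hge => //; exists (u, rcons (rcons D s) t) => //.
  by split; rewrite //= ?rcons_path ?last_rcons // uD us.
rewrite -cats1 -cats1 !sum_consecutive_cat !sum_consecutive_cons !sum_consecutive_nil !addr0.
rewrite last_cat /= lerD2r lerDl; apply: f0 => //.
by rewrite (le_trans au) // path_le_last.
Qed.

Lemma itv_partition_nth D i : itv_partition 0 1 D -> (i < size D)%N ->
  nth 0 (0 :: D) i < nth 0 (0 :: D) i.+1.
Proof. by move=> [/(pathP 0) h _] iD; exact: h. Qed.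

Lemma itv_partition_nth01 D i : itv_partition 0 1 D -> (i <= size D)%N ->
  0 <= nth 0 (0 :: D) i <= 1.
Proof.
move=> hD iD; rewrite -ltnS in iD.
have := itv_partition_nth_ge iD hD; have := itv_partition_nth_le iD hD.
by rewrite (set_nth_default 0) //= => -> ->.
Qed.

Lemma itv_partition_mono D i j : itv_partition 0 1 D -> (i <= j)%N -> (j <= size D)%N ->
  nth 0 (0 :: D) i <= nth 0 (0 :: D) j.
Proof.
move=> hD; elim: j => [|j IH]; first by rewrite leqn0 => /eqP ->.
rewrite leq_eqVlt => /orP[/eqP -> //|ij] jD.
by rewrite (le_trans (IH ij (ltnW jD))) // ltW // itv_partition_nth.
Qed.

Lemma itv_partition_locate D t : itv_partition 0 1 D -> 0 <= t <= 1 ->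
  exists2 i, (i < size D)%N & nth 0 (0 :: D) i <= t <= nth 0 (0 :: D) i.+1.
Proof.
move=> hD /andP[t0 t1].
have sD : (0 < size D)%N.
  by case: D hD => // -[_ /eqP /= /esym/eqP]; rewrite oner_eq0.
have exP : exists i, (i < size D)%N && (t <= nth 0 (0 :: D) i.+1).
  exists (size D).-1; rewrite prednK // leqnn /=.
  have := itv_partition_nth_size 0 hD; case: D sD {hD} => // x D _ /= ->.
  by [].
case: (ex_minnP exP) => i /andP[iD ti] imin.
exists i => //; rewrite ti andbT; case: i iD ti imin => [//|i] iD ti imin.
rewrite leNgt; apply/negP => /ltW ti'.
have := imin i; rewrite (ltnW iD) ti' => /(_ isT).
by rewrite ltnn.
Qed.

Lemma mesh_le D (delta : R) : mesh 0 D <= delta -> forall i, (i < size D)%N ->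
  nth 0 (0 :: D) i.+1 - nth 0 (0 :: D) i <= delta.
Proof.
move=> hD i iD; apply: le_trans hD; rewrite /mesh big_mkord.
exact: (le_bigmax _ (fun i : 'I_(size D) => nth 0 (0 :: D) i.+1 - nth 0 (0 :: D) i) (Ordinal iD)).
Qed.

Lemma fine_partition (delta : R) : 0 < delta ->
  exists2 D, itv_partition 0 1 D & mesh 0 D <= delta.
Proof.
move=> d0; pose n := (Num.trunc delta^-1).+1.
have n0 : 0 < n%:R :> R by rewrite ltr0n.
have nd : n%:R^-1 <= delta.
  rewrite -[delta]invrK lef_pV2 ?posrE ?invr_gt0 //.
  by apply/ltW/truncnS_gt.
pose D : seq R := [seq i.+1%:R / n%:R | i <- iota 0 n].
have sD : size D = n by rewrite size_map size_iota.
have nthD i : (i <= n)%N -> nth 0 (0 :: D) i = i%:R / n%:R.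
  case: i => [|i] iN /=; first by rewrite mul0r.
  by rewrite (nth_map 0%N) ?size_iota // nth_iota.
exists D.
  split; last first.
    by rewrite -nth_last sD -[_ (n.-1)]/(nth 0 (0 :: D) n.-1.+1) nthD // divff // gt_eqF.
  apply/(pathP 0) => i; rewrite sD => iN.
  rewrite -[X in _ < X]/(nth 0 (0 :: D) i.+1) (nthD i (ltnW iN)) (nthD i.+1 iN).
  by rewrite ltr_pM2r ?invr_gt0 // ltr_nat.
rewrite /mesh big_mkord; apply/bigmax_leP; split; first exact: ltW.
move=> [i iD] _ /=; have iN : (i < n)%N by rewrite -sD.
rewrite -[D`_i]/(nth 0 (0 :: D) i.+1) (nthD i (ltnW iN)) (nthD i.+1 iN) -mulrBl -natrB // subSnn mul1r.
exact: nd.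
Qed.

(** Each [F i], monotone only on its own interval, is composed with the clamping onto that interval.
    The sum is then monotone everywhere, and on the interval [i] it grows at least as much as
    [F i]. *)
Lemma glue D (F : nat -> R -> R) : itv_partition 0 1 D ->
  (forall i s t, (i < size D)%N -> nth 0 (0 :: D) i <= s -> s <= t ->
    t <= nth 0 (0 :: D) i.+1 -> F i s <= F i t) ->
  exists H : R -> R, [/\ forall s t, s <= t -> H s <= H t,
    (forall i s t, (i < size D)%N -> nth 0 (0 :: D) i <= s -> s <= t ->
      t <= nth 0 (0 :: D) i.+1 -> F i t - F i s <= H t - H s) &
    H 1 - H 0 = \sum_(i < size D) (F i (nth 0 (0 :: D) i.+1) - F i (nth 0 (0 :: D) i))].
Proof.
move=> hD Fmono.
pose c i t := Num.max (nth 0 (0 :: D) i) (Num.min t (nth 0 (0 :: D) i.+1)).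
have c1 i t : nth 0 (0 :: D) i <= c i t by rewrite le_max lexx.
have c2 i t : (i < size D)%N -> c i t <= nth 0 (0 :: D) i.+1.
  by move=> iD; rewrite ge_max ge_min lexx orbT andbT ltW // itv_partition_nth.
have c3 i s t : s <= t -> c i s <= c i t.
  by move=> st; rewrite /c ge_max !le_max lexx /= le_min !ge_min st lexx !orbT.
have cE i t : nth 0 (0 :: D) i <= t -> t <= nth 0 (0 :: D) i.+1 -> c i t = t.
  by move=> h1 h2; rewrite /c min_l // max_r.
exists (fun t => \sum_(i < size D) F i (c i t)); split.
- move=> s t st; apply: ler_sum => i _; apply: Fmono => //; [exact: c3|exact: c2].
- move=> i s t iD is_ st ti; rewrite -sumrB (bigD1 (Ordinal iD)) //=.
  rewrite !cE // ?(le_trans is_ st) ?(le_trans st ti) // lerDl.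
  apply: sumr_ge0 => j _; rewrite subr_ge0; apply: Fmono => //; [exact: c3|exact: c2].
- rewrite -sumrB; apply: eq_bigr => i _.
  have iD := ltn_ord i.
  have /andP[a0 a1] := itv_partition_nth01 hD (ltnW iD).
  have /andP[b0 b1] := itv_partition_nth01 hD iD.
  have lt := itv_partition_nth hD iD.
  congr (F i _ - F i _).
    by rewrite /c min_r // max_r // ltW.
  by rewrite /c min_l // max_l.
Qed.

(** Bound [x + y] by twice the larger term; the best constant does not matter. *)
Lemma powR_add (p x y : R) : 0 <= p -> 0 <= x -> 0 <= y ->
  (x + y) `^ p <= 2 `^ p * (x `^ p + y `^ p).
Proof.
move=> p0; wlog xy : x y / x <= y => [H|] x0 y0.
  case: (leP x y) => [|/ltW] h; first exact: H.
  by rewrite addrC [_ `^ _ + _]addrC; exact: H.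
apply: (@le_trans _ _ ((2 * y) `^ p)).
  apply: ge0_ler_powR; rewrite ?nnegrE ?addr_ge0 ?mulr_ge0 //.
  by rewrite mulr2n mulrDl mul1r lerD2r.
by rewrite powRM // ler_wpM2l ?powR_ge0 // lerDr powR_ge0.
Qed.

End Consecutive.

(** * Smooth paths with prescribed increments *)

Section Smooth.
Context {R : realType}.

Lemma is_derive_quotient (W : normedModType R) (f : R -> W) (x : R) (df : W) :
  h^-1 *: (f (h + x) - f x) @[h --> 0^'] --> df <-> is_derive x 1 f df.
Proof.
have E : (fun h : R => h^-1 *: ((f \o shift x) (h *: 1) - f x)) =
         (fun h => h^-1 *: (f (h + x) - f x)).
  by apply/funext => h; rewrite /= /shift /= [h *: 1]mulr1.
split=> [H|[H <-]]; last by rewrite -E; exact: H.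
apply: DeriveDef; first by rewrite /derivable E; exact: cvgP H.
by rewrite /derive E; exact: cvg_lim H.
Qed.

Lemma is_derive_scalel (W : normedModType R) (f : R -> R) (x df : R) (v : W) :
  is_derive x 1 f df -> is_derive x 1 (fun u => f u *: v) (df *: v).
Proof.
move=> /is_derive_quotient H; apply/is_derive_quotient.
rewrite (_ : (fun h => _) = fun h => (h^-1 *: (f (h + x) - f x)) *: v).
  by apply: cvgZr_tmp.
by apply/funext => h; rewrite -scalerBl scalerA.
Qed.

Lemma is_derive_pow (f : R -> R) n (x df : R) : is_derive x 1 f df ->
  is_derive x 1 (fun u => f u ^+ n) (n%:R * f x ^+ n.-1 * df).
Proof.
move=> hf; elim: n => [|n IH]; first by rewrite !mul0r; exact: is_derive_cst.
rewrite (_ : (fun u => _) = fun u => f u * f u ^+ n); last first.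
  by apply/funext => u; rewrite exprS.
apply: is_derive_eq (is_derive_mul hf IH) _.
by case: n {IH} => [|n] /=; rewrite ?exprS; ring.
Qed.

Lemma is_derive_affine (f : R -> R) (a b x df : R) :
  is_derive (a * x + b) 1 f df -> is_derive x 1 (fun u => f (a * u + b)) (a * df).
Proof.
move=> hf; rewrite mulrC.
have : is_derive x 1 (fun u => a * u + b) a.
  apply: is_derive_eq (is_deriveD (is_derive_mul (is_derive_cst a x 1)
    (is_derive_id x 1)) (is_derive_cst b x 1)) _.
  by rewrite mul0r add0r mulr1 addr0.
exact: is_derive1_comp.
Qed.

(** The function [x^-n exp(-1/x)] extended by 0. The linear combinations of these functions are
    stable under derivation, so higher derivatives never have to be computed. *)
Definition flatexp (n : nat) (x : R) : R :=
  if 0 < x then x^-1 ^+ n * expR (- x^-1) else 0.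

(** One term of the exponential series at [x^-1] dominates. A quadratic bound is enough for the
    derivative at 0 to vanish. *)
Lemma flatexp_le n (x : R) : `|flatexp n x| <= n.+2`!%:R * x ^+ 2.
Proof.
rewrite /flatexp; case: ifP => x0; last first.
  by rewrite normr0 mulr_ge0 // sqr_ge0.
have z0 : 0 < x^-1 by rewrite invr_gt0.
rewrite ger0_norm; last by rewrite mulr_ge0 ?exprn_ge0 ?expR_ge0 // ltW.
have := expR_ge1Dxn n.+1 (ltW z0); set z := x^-1 in z0 * => h.
have {}h : z ^+ n.+2 / n.+2`!%:R <= expR z by apply: le_trans h; rewrite lerDr.
have -> : x ^+ 2 = (z ^+ 2)^-1 by rewrite /z exprVn invrK.
rewrite expRN ler_pdivrMr ?expR_gt0 // mulrAC ler_pdivlMr ?exprn_gt0 // -exprD addn2.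
by rewrite mulrC -ler_pdivrMr // ltr0n fact_gt0.
Qed.

Lemma flatexp_deriv n (x : R) :
  is_derive x 1 (flatexp n) (flatexp n.+2 x - n%:R * flatexp n.+1 x).
Proof.
case: (ltgtP 0 x) => x0.
- have : is_derive x 1 (fun u => u^-1 ^+ n * expR (- u^-1))
      (flatexp n.+2 x - n%:R * flatexp n.+1 x).
    have hV : is_derive x 1 (fun u : R => u^-1) (- x ^- 2).
      have xn0 : x != 0 by rewrite gt_eqF.
      have := @is_deriveV _ id x 1 1 xn0 (is_derive_id x 1).
      by rewrite [X in is_derive _ _ _ X]mulr1.
    have hX : is_derive x 1 (fun u : R => u^-1 ^+ n) (n%:R * x^-1 ^+ n.-1 * - x ^- 2).
      exact: is_derive_pow hV.
    have hE : is_derive x 1 (fun u : R => expR (- u^-1)) (expR (- x^-1) * x ^- 2).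
      rewrite -[x ^- 2]opprK; apply: (@is_derive1_comp _ expR (fun u => - u^-1)).
    apply: is_derive_eq (is_derive_mul hX hE) _; rewrite /flatexp x0.
    case: n {hX} => [|n] /=; rewrite -!exprVn ?exprS; ring.
  apply: near_eq_is_derive; near=> u; rewrite /flatexp ifT //.
  by near: u; exact: lt_nbhsr.
- have -> : flatexp n.+2 x - n%:R * flatexp n.+1 x = 0.
    by rewrite /flatexp ltNge (ltW x0) /= mulr0 subr0.
  apply: near_eq_is_derive (is_derive_cst 0 x 1); near=> u; rewrite /flatexp ifF //.
  by apply/negbTE; rewrite -leNgt ltW //; near: u; exact: lt_nbhsl.
rewrite -x0 /flatexp ltxx mulr0 subr0 -/(flatexp n); apply/is_derive_quotient.
have f0 : flatexp n 0 = 0 by rewrite /flatexp ltxx.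
apply/cvgrPdist_le => e e0; near=> h.
have h0 : h != 0 by near: h; exact: nbhs_dnbhs_neq.
rewrite f0 addr0 subr0 sub0r normrN normrM normfV.
rewrite ler_pdivrMl ?normr_gt0 // (le_trans (flatexp_le n h)) //.
rewrite -[h ^+ 2]ger0_norm ?sqr_ge0 // normrX expr2 mulrCA ler_wpM2l //.
rewrite -ler_pdivlMl ?ltr0n ?fact_gt0 //.
near: h; apply: dnbhs0_le.
by rewrite mulr_gt0 ?invr_gt0 ?ltr0n ?fact_gt0.
Unshelve. all: by end_near. Qed.

Lemma flatexp_ge0 n x : 0 <= flatexp n x.
Proof.
rewrite /flatexp; case: ifP => // x0.
by rewrite mulr_ge0 ?exprn_ge0 ?expR_ge0 ?invr_ge0 ?ltW.
Qed.

End Smooth.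

Section Primitive.
Context {R : realType}.
Local Notation mu := (@lebesgue_measure R).
Implicit Types r f : R -> R.

Lemma is_derive_cont (W : normedModType R) (f : R -> W) (x : R) (df : W) :
  is_derive x 1 f df -> {for x, continuous f}.
Proof. by move=> [h _]; apply: differentiable_continuous; apply/derivable1_diffP. Qed.

Lemma integrable_within (a b : R) r : {within `[a, b], continuous r} ->
  mu.-integrable `[a, b] (EFin \o r).
Proof.
by move=> cr; apply: continuous_compact_integrable => //; exact: segment_compact.
Qed.

Lemma FTC_at (a t u : R) r : a < t -> t < u -> {within `[a, u], continuous r} ->
  {for t, continuous r} ->
  is_derive t 1 (fun x => \int[mu]_(s in `[a, x]) r s) (r t).
Proof.
move=> at_ tu cr ct.
have [h1 h2] := continuous_FTC1_closed tu (integrable_within cr) at_ ct.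
by apply: DeriveDef => //; rewrite -derive1E.
Qed.

(** Starting the integral at [a - 1] puts [a] inside the domain of the fundamental theorem; to the
    left of [a] the integral is locally zero, whether or not its interval is empty. *)
Lemma primitive (a : R) r : continuous r -> (forall t, t <= a -> r t = 0) ->
  exists P : R -> R, forall t : R, is_derive t 1 P (r t).
Proof.
move=> cr r0; exists (fun x => \int[mu]_(s in `[a - 1, x]) r s) => t.
have [ta|ta] := ltP t a; last first.
  apply: (@FTC_at _ _ (t + 1)) => //.
  - by rewrite ltrBlDr (le_lt_trans ta) // ltrDl.
  - by rewrite ltrDl.
  - exact: continuous_subspaceT.
  - exact: cr.
rewrite r0 ?ltW //; apply: near_eq_is_derive (is_derive_cst 0 t 1).
near=> u; have ua : u < a by near: u; exact: lt_nbhsl.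
rewrite /= (@eq_Rintegral _ _ _ _ _ (cst 0)).
  by rewrite Rintegral_cst // mul0r.
move=> s; rewrite inE /= in_itv /= => /andP[_ su].
by rewrite r0 // (le_trans su) // ltW.
Unshelve. all: by end_near. Qed.

Lemma nondecr_derive f (df : R -> R) : (forall t : R, is_derive t 1 f (df t)) -> (forall t, 0 <= df t) ->
  forall s t, s <= t -> f s <= f t.
Proof.
move=> hf df0 s t; rewrite le_eqVlt => /orP[/eqP -> //|st].
have [c _ e] := @MVT R f df s t st (fun x _ => hf x)
  (continuous_subspaceT (fun x => is_derive_cont (hf x))).
by rewrite -subr_ge0 e mulr_ge0 // subr_ge0 ltW.
Qed.

End Primitive.

Section Flat.
Context {R : realType} {V : normedModType R}.

(** A class of smooth functions closed under derivation. Products of two factors are included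
    because a bump must be flat at both ends of its interval. *)
Inductive flat : (R -> V) -> Prop :=
| flat_gen n k (a b c e : R) (v : V) :
    flat (fun x => (flatexp n (a * x + b) * flatexp k (c * x + e)) *: v)
| flat_add f g : flat f -> flat g -> flat (fun x => f x + g x).

Lemma flat_derive f : flat f -> exists2 g, flat g & forall x : R, is_derive x 1 f (g x).
Proof.
elim=> [n k a b c e v|f1 f2 _ [g1 fl1 h1] _ [g2 fl2 h2]]; last first.
  exists (fun x => g1 x + g2 x); first exact: flat_add.
  by move=> x; exact: is_deriveD.
pose F1 n k (s : R) x := (flatexp n (a * x + b) * flatexp k (c * x + e)) *: (s *: v).
exists (fun x => (F1 n.+2 k a x + F1 n.+1 k (- (a * n%:R)) x) +
   (F1 n k.+2 c x + F1 n k.+1 (- (c * k%:R)) x)).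
  by do 2 apply: flat_add; apply: flat_add || exact: flat_gen; exact: flat_gen.
move=> x; apply: is_derive_eq (is_derive_scalel v (is_derive_mul
  (is_derive_affine (flatexp_deriv n _)) (is_derive_affine (flatexp_deriv k _)))) _.
rewrite /F1 !scalerA -!scalerDl; congr (_ *: _); ring.
Qed.

Lemma flat_derive1 f : flat f -> flat (derive1 f).
Proof.
move=> /flat_derive[g gf h]; rewrite (_ : derive1 f = g) //.
by apply/funext => x; rewrite derive1E; exact: (@derive_val _ _ _ _ _ _ _ (h x)).
Qed.

Lemma flat_derivable f x : flat f -> derivable f x 1.
Proof. by move=> /flat_derive[g gf h]; exact: (@ex_derive _ _ _ _ _ _ _ (h x)). Qed.

Lemma flat_cont f : flat f -> continuous f.
Proof. by move=> /flat_derive[g gf h] x; exact: is_derive_cont (h x). Qed.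

Lemma flat0 : flat (fun=> 0).
Proof.
rewrite (_ : (fun=> 0) = fun x => (flatexp 0 (0 * x + 0) * flatexp 0 (0 * x + 0)) *: 0).
  exact: flat_gen.
by apply/funext => x; rewrite scaler0.
Qed.

Lemma flat_sum (I : Type) (r : seq I) (f : I -> R -> V) : (forall i, flat (f i)) ->
  flat (fun x => \sum_(i <- r) f i x).
Proof.
move=> hf; elim: r => [|i r IH].
  rewrite (_ : (fun x => _) = fun=> 0); first exact: flat0.
  by apply/funext => x; rewrite big_nil.
rewrite (_ : (fun x => _) = fun x => f i x + \sum_(i <- r) f i x); first exact: flat_add.
by apply/funext => x; rewrite big_cons.
Qed.

Lemma flat_primitive_smooth (y v : R -> V) : flat v -> (forall t : R, is_derive t 1 y (v t)) ->
  forall n t, derivable (derive1n n y) t 1.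
Proof.
move=> fv hy; have yE : derive1 y = v.
  by apply/funext => x; rewrite derive1E; exact: (@derive_val _ _ _ _ _ _ _ (hy x)).
case=> [|n] t; first exact: (@ex_derive _ _ _ _ _ _ _ (hy t)).
apply: flat_derivable; elim: n {t} => [|n IH]; first by rewrite derive1nS derive1n0 yE.
by rewrite derive1nS; exact: flat_derive1.
Qed.

End Flat.

Section Bump.
Context {R : realType}.

(** The speed [rho] is a normalized product of flat functions of [t - a] and [b - t]. It vanishes
    with all its derivatives at the ends, so pieces reparametrized by [theta] concatenate
    smoothly. *)
Lemma bump (a b : R) : a < b -> exists theta rho : R -> R,
  [/\ forall (V : normedModType R) (v : V), flat (fun x => rho x *: v),
      forall t : R, is_derive t 1 theta (rho t),
      forall t, ~~ (a < t < b) -> rho t = 0,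
      forall s t, s <= t -> theta s <= theta t &
      theta b - theta a = 1].
Proof.
move=> ab.
pose r x := flatexp 0 (1 * x + - a) * flatexp 0 ((- 1) * x + b) : R.
have rfl (V : normedModType R) (v : V) : flat (fun x => r x *: v) by exact: flat_gen.
have cr : continuous r.
  have := @flat_cont _ _ _ (rfl R^o 1); rewrite (_ : (fun x => _) = r) //.
  by apply/funext => x; exact: mulr1.
have r0 t : ~~ (a < t < b) -> r t = 0.
  rewrite negb_and -!leNgt => /orP[h|h]; rewrite /r /flatexp.
    by rewrite ifF ?mul0r // mul1r subr_gt0 ltNge h.
  by rewrite [X in _ * X]ifF ?mulr0 // mulN1r [- t + b]addrC subr_gt0 ltNge h.
have rge t : 0 <= r t by rewrite mulr_ge0 // flatexp_ge0.
have [|P hP] := @primitive R a r cr.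
  by move=> t ta; apply: r0; rewrite negb_and -leNgt ta.
have [c cab e] := @MVT R P r a b ab (fun x _ => hP x)
  (continuous_subspaceT (fun x => is_derive_cont (hP x))).
have K0 : 0 < P b - P a.
  rewrite e mulr_gt0 ?subr_gt0 //; move: cab; rewrite in_itv /= => /andP[ac cb].
  rewrite /r /flatexp mul1r subr_gt0 ac mulN1r [- c + b]addrC subr_gt0 cb.
  by rewrite !expr0 !mul1r mulr_gt0 // expR_gt0.
set K := P b - P a in K0.
exists (fun t => K^-1 * P t), (fun t => K^-1 * r t); split.
- move=> V v; rewrite (_ : (fun x => _) = fun x => r x *: (K^-1 *: v)) //.
  by apply/funext => x; rewrite scalerA mulrC.
- move=> t; apply: is_derive_eq (is_derive_mul (is_derive_cst K^-1 t 1) (hP t)) _.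
  by rewrite mul0r add0r.
- by move=> t /r0 ->; rewrite mulr0.
- move=> s t st; rewrite ler_wpM2l ?invr_ge0 ?(ltW K0) //.
  exact: (nondecr_derive hP rge).
- by rewrite -mulrBr mulVf // gt_eqF.
Qed.

End Bump.

(** * Continuity of the coordinates of V *)

Section Coordinates.
Context {R : realType} {V : normedVectType R}.
Local Notation dimV := (\dim {:V}).

Lemma vec_sum (x : V) : x = \sum_i vcoord i x *: ebasis i.
Proof. exact: coord_vbasis (memvf x). Qed.

(** The given norm of [V] attains a positive minimum on the unit sphere of coordinate vectors;
    homogeneity does the rest. *)
Lemma vcoord_bounded : exists2 C : R, 0 <= C & forall (x : V) i, `|vcoord i x| <= C * `|x|.
Proof.
pose L (u : 'rV[R]_dimV) : V := \sum_i u 0 i *: ebasis i.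
have vcL u i : vcoord i (L u) = u 0 i.
  rewrite /vcoord linear_sum (bigD1 i) //= big1 ?addr0 => [|j ji]; rewrite linearZ /= -/(vcoord _ _) vcoord_ebasis.
    by rewrite eqxx; exact: mulr1.
  by rewrite eq_sym (negbTE ji); exact: mulr0.
have cL : continuous L.
  by apply: cont_sum => i; apply: cont_scalel; exact: coord_continuous.
pose S : set 'rV[R]_dimV := [set u | `|u| = 1].
have [S0|/set0P S0] := eqVneq S set0.
  exists 0 => // x i; rewrite mul0r.
  pose u : 'rV[R]_dimV := \row_j vcoord j x.
  have [u0|u0] := eqVneq u 0.
    by have := congr1 (fun u : 'rV[R]_dimV => u 0 i) u0; rewrite !mxE => ->; rewrite normr0.
  have : S (`|u|^-1 *: u) by rewrite /S /= normrZ normfV normr_id mulVf // normr_eq0.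
  by rewrite S0.
have cS : compact S.
  apply: bounded_closed_compact.
    by exists 1; split => // M M1 u /= ->; exact: ltW.
  rewrite (_ : S = (fun u : 'rV[R]_dimV => `|u|) @^-1` [set 1]) //.
  apply: closed_comp; first by move=> u _; exact: norm_continuous.
  exact: closed_eq.
have cN : {within S, continuous (fun u => `|L u|)}.
  by apply: continuous_subspaceT; exact: cont_norm cL.
have [u] := EVT_min_rV S0 cS cN; rewrite inE /S /= => u1 umin.
have L0 : 0 < `|L u|.
  rewrite normr_gt0; apply/eqP => Lu0.
  have u0 : u = 0.
    apply/rowP => i; rewrite -vcL Lu0 mxE /vcoord linear0 //.
  by move/eqP: u1; rewrite u0 normr0 eq_sym oner_eq0.
exists `|L u|^-1 => [|x i]; first by rewrite invr_ge0.
pose w : 'rV[R]_dimV := \row_j vcoord j x.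
have LW : L w = x.
  by rewrite [RHS](vec_sum x); apply: eq_bigr => j _; rewrite mxE.
have [w0|w0] := eqVneq w 0.
  have -> : vcoord i x = 0.
    by have := congr1 (fun u : 'rV[R]_dimV => u 0 i) w0; rewrite !mxE.
  by rewrite normr0 mulr_ge0 // invr_ge0.
have nw : 0 < `|w| by rewrite normr_gt0.
have := umin (`|w|^-1 *: w); rewrite inE /S /= normrZ normfV normr_id mulVf ?gt_eqF // => /(_ erefl).
have -> : L (`|w|^-1 *: w) = `|w|^-1 *: x.
  by rewrite -[in RHS]LW scaler_sumr; apply: eq_bigr => j _; rewrite mxE scalerA.
rewrite normrZ normfV normr_id => h.
rewrite ler_pdivlMl // (le_trans (_ : _ <= `|L u| * `|w|)) //; last first.
  by move: h; rewrite ler_pdivlMl // mulrC.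
rewrite ler_wpM2l // [leRHS]/Num.norm /= mx_normrE.
apply: le_trans (le_bigmax _ (fun ij : 'I_1 * 'I_dimV => `|w ij.1 ij.2|) (0, i)).
by rewrite mxE.
Qed.

Lemma vcoord_continuous i : continuous (vcoord i : V -> R).
Proof.
have [C C0 hC] := vcoord_bounded.
move=> x; apply/cvgrPdist_le => e e0; near=> z.
have -> : vcoord i x - vcoord i z = vcoord i (x - z).
  by rewrite /vcoord linearB.
rewrite (le_trans (hC _ _)) // (le_trans (_ : _ <= (C + 1) * `|x - z|)) //.
  by rewrite ler_wpM2r // lerDl.
rewrite -ler_pdivlMl ?ltr_wpDl //.
near: z; have e1 : 0 < (C + 1)^-1 * e by rewrite mulr_gt0 // invr_gt0 ltr_wpDl.
exact: (@cvgr_dist_le _ _ _ (nbhs x) _ id x cvg_id _ e1).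
Unshelve. all: by end_near. Qed.

End Coordinates.

(** * The signature as the solution of a differential equation *)

Section SignatureODE.
Context {R : realType} {V : normedVectType R} {m : nat}.
Local Notation dimV := (\dim {:V}).
Local Notation T := (trunc_tensor R dimV m).
Local Notation mu := (@lebesgue_measure R).

Lemma iter_integral_at0 (y : R -> V) w : iter_integral y 0 w 0 = (w == [::])%:R.
Proof. by case: w => //= i w; rewrite set_itv1 Rintegral_set1. Qed.

Lemma iter_integral_ode (y : R -> V) w : (forall i, continuous (fun t => vcoord i (derive1 y t))) ->
  (forall b : R, 0 < b -> {within `[0, b], continuous (iter_integral y 0 w)}) /\
  (forall t : R, 0 < t -> {for t, continuous (iter_integral y 0 w)}).
Proof.
move=> cy; elim: w => [|i w [IH1 IH2]].
  split=> [b _|t _]; last exact: cvg_cst.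
  exact: cont_cst.
have cf b : 0 < b -> {within `[0, b], continuous (fun u => iter_integral y 0 w u * vcoord i (derive1 y u))}.
  by move=> b0; apply: cont_mul; [exact: IH1|exact: continuous_subspaceT].
split=> [b b0|t t0].
  exact: (parameterized_integral_continuous (ltW b0) (integrable_within (cf b b0))).
apply: (@is_derive_cont _ _ _ t _ (@FTC_at _ 0 t (t + 1) _ t0 _ (cf _ _) _)).
- by rewrite ltrDl.
- by rewrite addr_gt0.
- by apply: continuousM; [exact: IH2|exact: cy].
Qed.

Lemma iter_integral_deriv (y : R -> V) i w (t : R) : (forall i, continuous (fun t => vcoord i (derive1 y t))) ->
  0 < t -> is_derive t 1 (iter_integral y 0 (i :: w))
    (iter_integral y 0 w t * vcoord i (derive1 y t)).
Proof.
move=> cy t0; have [IH1 IH2] := iter_integral_ode w cy.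
apply: (@FTC_at _ 0 t (t + 1) (fun u => iter_integral y 0 w u * vcoord i (derive1 y u))) => //.
- by rewrite ltrDl.
- by apply: cont_mul; [apply: IH1; rewrite addr_gt0|exact: continuous_subspaceT].
- by apply: continuousM; [exact: IH2|exact: cy].
Qed.

Lemma signature_coef (y : R -> V) s t w : (signature y s t : T) w = iter_integral y s (rev w) t.
Proof. exact: coeff_tensorE. Qed.

Lemma signature_sol (y : R -> V) : (forall i, continuous (fun t => vcoord i (derive1 y t))) ->
  sol 0 1 (fun t => tensor_of (derive1 y t)) (signature_path y : R -> T).
Proof.
move=> cy; split.
- move=> w; rewrite (_ : (fun u => _) = iter_integral y 0 (rev w)).
    by apply: (iter_integral_ode _ cy).1.
  by apply/funext => u; rewrite signature_coef.
- move=> t /andP[t0 _] w.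
  rewrite (_ : (fun u => _) = iter_integral y 0 (rev w)); last first.
    by apply/funext => u; rewrite signature_coef.
  case/lastP E : (w : seq _) => [|u i].
    rewrite (tgeMr _ (tensor_of_ge1 _)) ?E //; exact: is_derive_cst.
  have um : (size u <= m)%N by rewrite (leq_trans _ (size_bseq w)) // E size_rcons.
  rewrite (@mul_tensor_of _ _ _ _ _ (Bseq um) _ i E) signature_coef rev_rcons.
  exact: iter_integral_deriv.
- by move=> t _; rewrite signature_coef.
Qed.

Lemma signature_path0 (y : R -> V) : signature_path y 0 = 1 :> T.
Proof.
apply/ffunP => w; rewrite signature_coef iter_integral_at0 tone_coef.
by congr (_%:R); rewrite -size_eq0 size_rev.
Qed.

End SignatureODE.

(** * Smooth paths following products of exponentials *)

Section Drive.
Context {R : realType} {V : normedVectType R} {m : nat}.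
Local Notation dimV := (\dim {:V}).
Local Notation T := (trunc_tensor R dimV m).
Local Notation G := (@free_nilpotent_group R V m).
Variable N : T -> R.
Hypothesis hN : homogeneous_norm N.
Variable M : R.
Hypothesis M0 : 0 <= M.
Hypothesis hM : forall L g, reach L g -> N g <= M * L.
Implicit Types (X : R -> T) (v : R -> V) (g : T).

Local Notation vsol a b v X := (sol a b (fun t => tensor_of (v t)) X).

Lemma sol_incr (a b s : R) (v : R -> T) X : a <= s -> s <= b -> sol a b v X ->
  sol s b v (incr X s) /\ incr X s s = 1.
Proof.
move=> as_ sb hX; have X1 : X s [bseq] = 1.
  by case: hX => _ _; apply; rewrite as_ sb.
split; last exact: tVinv.
apply: sol_mull; first exact: tinv_nil.
exact: sol_sub hX.
Qed.

Lemma incr_group (a b s t : R) v X : a <= s -> s <= t -> t <= b -> vsol a b v X -> G (incr X s t).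
Proof.
move=> as_ st tb hX; have [hs h1] := sol_incr as_ (le_trans st tb) hX.
apply: (sol_group st _ (sol_sub (lexx s) tb hs)); last by rewrite h1; exact: free_group1.
by move=> u; exact: free_lie_tensor.
Qed.

Lemma incr_trans X s u t : X u [bseq] = 1 -> incr X s u * incr X u t = incr X s t.
Proof. by move=> Xu; rewrite /incr mulrA -(mulrA _ (X u)) tinvV // mulr1. Qed.

(* Quantifying over all solutions makes the notion stable under restriction and
   concatenation; [Th] plays the role of the length of [X]. *)
Definition drives a b v g l := forall X, vsol a b v X -> incr X a b = g /\
  exists Th : R -> R, [/\ forall s t, a <= s -> s <= t -> t <= b -> Th s <= Th t,
    Th b - Th a <= l & forall s t, a <= s -> s <= t -> t <= b ->
      N (incr X s t) <= Th t - Th s].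

(** In a single direction the increment over [[s, t]] is, by uniqueness, the exponential for the
    growth of [theta], so its norm is at most [M * |q.1|] times that growth. *)
Lemma drives_exp (a b : R) (theta rho : R -> R) (q : R * 'I_dimV) : a <= b ->
  (forall t : R, is_derive t 1 theta (rho t)) -> (forall s t, s <= t -> theta s <= theta t) ->
  theta b - theta a = 1 ->
  drives a b (fun t => rho t *: (q.1 *: ebasis q.2)) (eexp q) (M * `|q.1|).
Proof.
move=> ab hth mth th1 X hX.
have E s t : a <= s -> s <= t -> t <= b -> incr X s t = eexp ((theta t - theta s) * q.1, q.2).
  move=> as_ st tb; have [hs h1] := sol_incr as_ (le_trans st tb) hX.
  rewrite /eexp /= -scalerA -tensor_ofZ.
  set c : T := tensor_of (q.1 *: ebasis q.2).
  have c1 : tge 1 c by exact: tensor_of_ge1.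
  apply: (sol_uniq st _ (sol_sub (lexx s) tb hs) (Y := fun u => texpn ((theta u - theta s) *: c))).
  - by move=> u _; exact: tensor_of_ge1.
  - have := @sol_exp R V m s t (fun u => theta u - theta s) rho c c1.
    have hd (u : R) : is_derive u 1 (fun u => theta u - theta s) (rho u).
      by apply: is_derive_eq (is_deriveD (hth u) (is_derive_cst (- theta s) u 1)) _; rewrite addr0.
    move=> /(_ (fun u _ => hd u)) h.
    apply: sol_eq (h _) => [u _|]; first by rewrite -tensor_ofZ.
    by apply: continuous_subspaceT => u; exact: is_derive_cont (hd u).
  - by rewrite h1 subrr scale0r texpn0.
split; first by rewrite E // th1 mul1r; case: q {E hX}.
exists (fun t => M * `|q.1| * theta t); split.
- by move=> s t _ st _; rewrite ler_wpM2l ?mulr_ge0 // mth.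
- by rewrite -mulrBr th1 mulr1.
move=> s t as_ st tb; rewrite E //.
apply: (le_trans (hM (reach_exp (m := m) ((theta t - theta s) * q.1) q.2))).
by rewrite normrM ger0_norm ?subr_ge0 ?mth //; lra.
Qed.

Lemma drives0 (a b : R) : a <= b -> drives a b (fun=> 0) 1 0.
Proof.
move=> ab X hX.
have E s t : a <= s -> s <= t -> t <= b -> incr X s t = 1.
  move=> as_ st tb; have [hs h1] := sol_incr as_ (le_trans st tb) hX.
  apply: (sol_uniq st _ (sol_sub (lexx s) tb hs) (Y := fun=> 1)) => //.
    by move=> u _; exact: tensor_of_ge1.
  split; first exact: tcont_cst.
    by move=> u _; rewrite tensor_of0 mulr0; exact: tderiv_cst.
  by move=> u _; rewrite tone_coef.
split; first exact: E.
exists (fun=> 0); split; [by []|by rewrite subrr|].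
by move=> s t as_ st tb; rewrite E // (hnorm1 hN) subrr.
Qed.

Lemma drives_eq (a b : R) v v' g l : (forall t, a < t < b -> v t = v' t) ->
  drives a b v g l -> drives a b v' g l.
Proof.
move=> vv' h X hX; apply: h; apply: sol_eq hX => t tab.
by rewrite vv'.
Qed.

Lemma drives_cat (a c b : R) v g h l l' : a <= c -> c <= b ->
  drives a c v g l -> drives c b v h l' -> drives a b v (g * h) (l + l').
Proof.
move=> ac cb d1 d2 X hX.
have [e1 [Th1 [mo1 t1 n1]]] := d1 X (sol_sub (lexx a) cb hX).
have [e2 [Th2 [mo2 t2 n2]]] := d2 X (sol_sub ac (lexx b) hX).
have X1 t : a <= t -> t <= b -> X t [bseq] = 1 by move=> h1 h2; case: hX => _ _; apply; rewrite h1 h2.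
split; first by rewrite -e1 -e2 incr_trans // X1.
(* Clamping at [c] handles the three positions of [c] relative to [s] and [t] with one
   factorization, in which a degenerate increment is 1. *)
pose lo t := Num.min t c; pose hi t := Num.max t c.
have lo1 t : lo t <= c by rewrite ge_min lexx orbT.
have lo2 t : a <= t -> a <= lo t by move=> at_; rewrite le_min at_.
have lo3 s t : s <= t -> lo s <= lo t.
  by move=> st; rewrite le_min !ge_min st lexx orbT.
have hi1 t : c <= hi t by rewrite le_max lexx orbT.
have hi2 t : t <= b -> hi t <= b by move=> tb; rewrite ge_max tb.
have hi3 s t : s <= t -> hi s <= hi t.
  by move=> st; rewrite ge_max !le_max st lexx orbT.
exists (fun t => Th1 (lo t) + Th2 (hi t)); split.
- move=> s t as_ st tb; apply: lerD.
    by apply: mo1; [exact: lo2|exact: lo3|].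
  by apply: mo2; [|exact: hi3|exact: hi2].
- rewrite /lo /hi min_r // min_l // max_l // max_r //; lra.
move=> s t as_ st tb.
have -> : incr X s t = incr X (lo s) (lo t) * incr X (hi s) (hi t).
  have at_ := le_trans as_ st; have sb := le_trans st tb.
  have I1 : incr X c c = 1 by apply/tVinv/X1.
  have [tc|ct] := leP t c.
    by rewrite /lo /hi !min_l ?(le_trans st tc) // !max_r ?(le_trans st tc) // I1 mulr1.
  have [sc|cs] := leP s c.
    by rewrite /lo /hi min_l // min_r ?(ltW ct) // max_r // max_l ?(ltW ct) // incr_trans // X1.
  by rewrite /lo /hi !min_r ?(ltW ct) ?(ltW cs) // !max_l ?(ltW ct) ?(ltW cs) // I1 mul1r.
have G1 : G (incr X (lo s) (lo t)).
  by apply: incr_group (hX); [exact: lo2|exact: lo3|exact: le_trans (lo1 _) cb].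
have G2 : G (incr X (hi s) (hi t)).
  by apply: incr_group (hX); [exact: le_trans ac (hi1 _)|exact: hi3|exact: hi2].
rewrite (le_trans (hnormM hN G1 G2)) //.
have := n1 (lo s) (lo t) (lo2 _ as_) (lo3 _ _ st) (lo1 _).
have := n2 (hi s) (hi t) (hi1 _) (hi3 _ _ st) (hi2 _ tb).
lra.
Qed.

(** Each factor takes the first half of the interval that remains. The speeds vanish outside their
    own parts, so they can simply be added. *)
Lemma drive_list (s : seq (R * 'I_dimV)) (a b : R) : a < b -> exists v, [/\ flat v,
  forall t, ~~ (a < t < b) -> v t = 0 &
  drives a b v (\prod_(q <- s) eexp q) (M * \sum_(q <- s) `|q.1|)].
Proof.
elim: s a b => [|q s IH] a b ab.
  exists (fun=> 0); split => //; first exact: flat0.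
  by rewrite !big_nil mulr0; apply: drives0; exact: ltW.
pose c := (a + b) / 2.
have ac : a < c by rewrite midf_lt.
have cb : c < b by rewrite midf_lt.
have [th [rho [rf hd r0 mth th1]]] := bump ac.
have [v [vf v0 dv]] := IH c b cb.
pose v1 t := rho t *: (q.1 *: ebasis q.2).
exists (fun t => v1 t + v t); split.
- by apply: flat_add => //; exact: rf.
- move=> t tab; rewrite /v1 r0 ?v0 ?scale0r ?addr0 //.
    by apply: contra tab => /andP[ct ->]; rewrite (lt_trans ac ct).
  by apply: contra tab => /andP[-> tc]; rewrite (lt_trans tc cb).
rewrite !big_cons mulrDr; apply: (drives_cat (ltW ac) (ltW cb)).
  apply: (drives_eq (v := v1)).
    by move=> t /andP[_ tc]; rewrite v0 ?addr0 // negb_and -leNgt (ltW tc).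
  exact: drives_exp (ltW ac) hd mth th1.
apply: drives_eq dv => t /andP[ct _].
by rewrite /v1 r0 ?scale0r ?add0r // negb_and -!leNgt (ltW ct) orbT.
Qed.

Lemma flat_path v : flat v -> (forall t, t <= 0 -> v t = 0) ->
  exists2 y : R -> V, smooth y & derive1 y = v.
Proof.
move=> fv v0; have cv i : continuous (fun t => vcoord i (v t)).
  move=> t; apply: continuous_comp; first exact: flat_cont.
  exact: vcoord_continuous.
have /choice[P hP] : forall i, exists P : R -> R, forall t : R, is_derive t 1 P (vcoord i (v t)).
  by move=> i; apply: (@primitive R 0) => // t /v0 ->; rewrite /vcoord linear0.
pose y t := \sum_i P i t *: ebasis i : V.
have hy (t : R) : is_derive t 1 y (v t).
  rewrite (vec_sum (v t)).
  have := is_derive_sum (fun i => is_derive_scalel (ebasis i) (hP i t)).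
  by rewrite (_ : \sum_i _ = y) //; apply/funext => u; rewrite fct_sumE.
exists y; first exact: flat_primitive_smooth fv hy.
by apply/funext => t; rewrite derive1E; exact: (@derive_val _ _ _ _ _ _ _ (hy t)).
Qed.

Lemma build_path D (s : nat -> seq (R * 'I_dimV)) : itv_partition 0 1 D ->
  exists2 y : R -> V, smooth y & forall i, (i < size D)%N ->
    drives (nth 0 (0 :: D) i) (nth 0 (0 :: D) i.+1) (derive1 y)
      (\prod_(q <- s i) eexp q) (M * \sum_(q <- s i) `|q.1|).
Proof.
move=> hD.
have /choice[v hv] : forall i : 'I_(size D), exists v, [/\ flat v,
  forall t, ~~ (nth 0 (0 :: D) i < t < nth 0 (0 :: D) i.+1) -> v t = 0 &
  drives (nth 0 (0 :: D) i) (nth 0 (0 :: D) i.+1) v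
    (\prod_(q <- s i) eexp q) (M * \sum_(q <- s i) `|q.1|)].
  by move=> i; apply: drive_list; exact: itv_partition_nth.
have [|t t0|y sy yE] := @flat_path (fun t => \sum_i v i t).
- by apply: flat_sum => i; case: (hv i).
- rewrite big1 // => i _; case: (hv i) => _ h _; apply: h.
  rewrite negb_and -!leNgt (le_trans t0) //.
  by case/andP: (itv_partition_nth01 hD (ltnW (ltn_ord i))).
exists y => // i iD; have [_ _ d] := hv (Ordinal iD).
apply: drives_eq d => t /andP[it ti]; rewrite yE (bigD1 (Ordinal iD)) //= big1 ?addr0 // => j ji.
case: (hv j) => _ h _; apply: h; apply/negP => /andP[jt tj].
have [ij|ij|ij] := ltngtP (j : nat) i.
- have := itv_partition_mono hD ij (ltnW iD).
  by rewrite leNgt (lt_trans it tj).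
- have := itv_partition_mono hD ij (ltnW (ltn_ord j)).
  by rewrite leNgt (lt_trans jt ti).
- by move/eqP: ji; apply; apply: val_inj.
Qed.

End Drive.

(** * The two implications *)

Section ExtendedReal.
Context {R : realType}.

Lemma cvge0P (F : set_system R) (FF : Filter F) (f : R -> \bar R) :
  (forall e : R, 0 < e -> \forall x \near F, (0 <= f x <= e%:E)%E) -> f x @[x --> F] --> 0%E.
Proof.
move=> h; apply/fine_cvgP; split.
  apply: filterS (h 1 ltr01) => x /andP[x0 x1].
  by rewrite ge0_fin_numE // (le_lt_trans x1) // ltry.
apply/cvgrPdist_le => e e0; apply: filterS (h e e0) => x /andP[x0 xe] /=.
have fx : f x \is a fin_num by rewrite ge0_fin_numE // (le_lt_trans xe) // ltry.
rewrite sub0r normrN ger0_norm; first by rewrite -lee_fin fineK.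
by rewrite fine_ge0.
Qed.

Lemma cvge0_le (F : set_system R) (FF : Filter F) (f : R -> \bar R) (e : R) :
  f x @[x --> F] --> 0%E -> 0 < e -> \forall x \near F, (f x <= e%:E)%E.
Proof.
move=> /fine_cvgP[h1 /cvgrPdist_le h2] e0.
apply: filterS2 h1 (h2 e e0) => x fx /=; rewrite sub0r normrN => h.
by rewrite -(fineK fx) lee_fin (le_trans (ler_norm _)).
Qed.

Lemma sum_consecutive_EFin (f : R -> R -> R) a D :
  sum_consecutive (fun s t => (f s t)%:E) a D = (sum_consecutive f a D)%:E.
Proof. by rewrite /sum_consecutive sumEFin. Qed.

Lemma powRVK (p x : R) : 0 < p -> 0 <= x -> (x `^ p^-1) `^ p = x.
Proof. by move=> p0 x0; rewrite -powRrM mulVf ?gt_eqF // powRr1. Qed.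

Lemma powRKV (p x : R) : 0 < p -> 0 <= x -> (x `^ p) `^ p^-1 = x.
Proof. by move=> p0 x0; rewrite -powRrM mulfV ?gt_eqF // powRr1. Qed.

End ExtendedReal.

(** * Variations, and the estimate for the direct implication *)

Section Variations.
Context {R : realType} {V : normedVectType R} {m : nat}.
Local Notation dimV := (\dim {:V}).
Local Notation T := (trunc_tensor R dimV m).
Local Notation G := (@free_nilpotent_group R V m).
Variables (N : T -> R) (p : R).
Hypothesis hN : homogeneous_norm N.
Hypothesis p1 : 1 < p.
Implicit Types (X Y : R -> T).

Let p0 : 0 < p. Proof. exact: lt_trans p1. Qed.

Definition on_group X := forall t, 0 <= t <= 1 -> G (X t).

Lemma incr_on_group X s t : on_group X -> 0 <= s -> s <= t -> t <= 1 -> G (incr X s t).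
Proof.
move=> hX s0 st t1; rewrite /incr; apply: free_groupM; first by apply/free_groupV/hX; rewrite s0 (le_trans st).
by apply: hX; rewrite t1 (le_trans s0).
Qed.

Lemma incr_mul X s u t : on_group X -> 0 <= u <= 1 -> incr X s t = incr X s u * incr X u t.
Proof. by move=> hX u01; rewrite incr_trans //; exact/free_group_nil/hX. Qed.

Lemma incr_refl X s : on_group X -> 0 <= s <= 1 -> incr X s s = 1.
Proof. by move=> hX s01; apply/tVinv/free_group_nil/hX. Qed.

Lemma gdist_ge0 g h : G g -> G h -> 0 <= gdist N g h.
Proof.
by move=> Gg Gh; rewrite /gdist; apply: (hnorm_ge0 hN); apply: free_groupM => //; exact: free_groupV.
Qed.

Lemma gdist_le g h : G g -> G h -> gdist N g h <= N g + N h.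
Proof.
move=> Gg Gh; rewrite /gdist -(hnormV hN Gg); apply: hnormM => //; exact: free_groupV.
Qed.

Lemma norm_gdist g h : G g -> G h -> N g <= N h + gdist N g h.
Proof.
move=> Gg Gh; have g1 := free_group_nil Gg; have h1 := free_group_nil Gh.
have Gd : G (tinv g * h) by apply: free_groupM => //; exact: free_groupV.
have e : g = h * tinv (tinv g * h) by rewrite tinvM ?tinv_nil // tinvK // mulrA tinvV // mul1r.
by rewrite {1}e (le_trans (hnormM hN Gh (free_groupV Gd))) // (hnormV hN Gd).
Qed.

Lemma gdist1 g : G g -> gdist N g 1 = N g.
Proof. by move=> Gg; rewrite /gdist mulr1 hnormV. Qed.

Lemma dpvar_sum_le X Y (c : R) : 0 <= c -> (dpvar N p X Y <= c%:E)%E ->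
  forall D, itv_partition 0 1 D ->
  sum_consecutive (fun s t => gdist N (incr X s t) (incr Y s t) `^ p) 0 D <= c `^ p.
Proof.
move=> c0 hc D hD; set S := sum_consecutive _ _ _.
have S0 : 0 <= S by apply: sumr_ge0 => i _; exact: powR_ge0.
have : (S `^ p^-1 <= c).
  rewrite -lee_fin; apply: le_trans hc; apply: ereal_sup_ubound.
  by exists D.
move=> h; rewrite -(powRVK p0 S0); apply: ge0_ler_powR; rewrite ?nnegrE ?powR_ge0 //.
exact: ltW.
Qed.

Lemma dpvar_le X Y (c : R) : 0 <= c -> (forall D, itv_partition 0 1 D ->
    sum_consecutive (fun s t => gdist N (incr X s t) (incr Y s t) `^ p) 0 D <= c `^ p) ->
  (dpvar N p X Y <= c%:E)%E.
Proof.
move=> c0 h; apply: ge_ereal_sup => _ [D hD <-]; rewrite lee_fin.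
rewrite -[leRHS](powRKV p0 c0); apply: ge0_ler_powR; rewrite ?nnegrE ?powR_ge0 //.
- by rewrite invr_ge0 ltW.
- by apply: sumr_ge0 => i _; exact: powR_ge0.
- exact: h.
Qed.

Lemma pvar_chain_bound Y : on_group Y -> (pvar N p Y < +oo)%E ->
  exists B, forall u D, 0 <= u -> path <%R u D -> last u D <= 1 ->
    sum_consecutive (fun s t => N (incr Y s t) `^ p) u D <= B.
Proof.
move=> hY Yfin.
have G1 : on_group (fun=> 1 : T) by move=> t _; exact: free_group1.
have [c c0 hc] : exists2 c : R, 0 <= c & (pvar N p Y <= c%:E)%E.
  case E : (pvar N p Y) Yfin => [r| |] // _; last by exists 0 => //; rewrite leNye.
  by exists `|r| => //; rewrite lee_fin ler_norm.
exists (c `^ p) => u D u0 uD uD1.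
have [|D' hD' le] := @chain_partition R (fun s t => N (incr Y s t) `^ p) u D _ u0 uD uD1.
  by move=> *; exact: powR_ge0.
apply: le_trans le _; apply: le_trans (dpvar_sum_le c0 hc hD').
apply: sum_consecutive_le; first by case: hD'.
move=> s t s0 st; have [_ /eqP ->] := hD' => t1.
rewrite (_ : incr (fun=> 1) s t = 1) ?gdist1 //; last by rewrite /incr tinv1 mulr1.
by apply: incr_on_group => //; exact: ltW.
Qed.

Lemma delta_pvar_ge0 Y s t : s <= t -> (0 <= delta_pvar N p Y s t)%E.
Proof.
move=> st; apply: ereal_sup_ubound; exists (s, [::]) => //=.
by rewrite sum_consecutive_nil.
Qed.

Lemma delta_pvar_le Y s t (c : R) :
  (forall u D, s <= u -> path <%R u D -> last u D <= t ->
    sum_consecutive (fun a b => N (incr Y a b) `^ p) u D <= c) ->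
  (delta_pvar N p Y s t <= c%:E)%E.
Proof.
move=> h; apply: ge_ereal_sup => _ [[u D] [/= su uD ut] <-].
by rewrite lee_fin; exact: h.
Qed.

Lemma mesh_sup_le Y delta (h : R -> R -> R) (c : R) :
  (forall s t, 0 <= s -> s < t -> t <= 1 -> t - s <= delta -> (delta_pvar N p Y s t <= (h s t)%:E)%E) ->
  (forall D, itv_partition 0 1 D -> sum_consecutive h 0 D <= c) ->
  (mesh_sup N p Y delta <= c%:E)%E.
Proof.
move=> hd hc; apply: ge_ereal_sup => _ [D [hD mD] <-].
apply: (@le_trans _ _ (sum_consecutive (fun s t => (h s t)%:E) 0 D)); last first.
  by rewrite sum_consecutive_EFin lee_fin; exact: hc.
rewrite /sum_consecutive !big_mkord; apply: lee_sum => i _; apply: hd.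
- by case/andP: (itv_partition_nth01 hD (ltnW (ltn_ord i))).
- exact: itv_partition_nth.
- by case/andP: (itv_partition_nth01 hD (ltn_ord i)).
- exact: mesh_le.
Qed.

Lemma mesh_sup_ge0 Y delta : 0 < delta -> (0 <= mesh_sup N p Y delta)%E.
Proof.
move=> d0; have [D hD mD] := fine_partition d0.
apply: (@le_trans _ _ (sum_consecutive (delta_pvar N p Y) 0 D)); last first.
  by apply: ereal_sup_ubound; exists D.
rewrite /sum_consecutive big_mkord; apply: sume_ge0 => i _.
by apply: delta_pvar_ge0; apply: ltW; exact: itv_partition_nth.
Qed.

Lemma smooth_vcoord_cont (y : R -> V) i : smooth y -> continuous (fun t => vcoord i (derive1 y t)).
Proof.
move=> sy t; apply: continuous_comp; last exact: vcoord_continuous.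
by apply: differentiable_continuous; apply/derivable1_diffP; have := sy 1%N t.
Qed.

Lemma signature_on_group (y : R -> V) : smooth y -> on_group (signature_path y).
Proof.
move=> sy t /andP[t0 t1].
have hs := @signature_sol _ _ m y (fun i => smooth_vcoord_cont sy).
apply: (sol_group t0 _ (sol_sub (lexx 0) t1 hs)); last first.
  by rewrite signature_path0; exact: free_group1.
by move=> u; exact: free_lie_tensor.
Qed.

Lemma signature_lipschitz (y : R -> V) : smooth y -> exists2 K : R, 0 <= K &
  forall s t, 0 <= s -> s <= t -> t <= 1 -> N (incr (signature_path y) s t) <= K * (t - s).
Proof.
move=> sy; have cy i : continuous (fun t => vcoord i (derive1 y t)) by exact: smooth_vcoord_cont.
have [M M0 hM] : exists2 M : R, 0 <= M &
    forall t i, 0 <= t <= 1 -> `|vcoord i (derive1 y t)| <= M.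
  have /choice[c hc] : forall i, exists c : R, forall t, 0 <= t <= 1 -> `|vcoord i (derive1 y t)| <= c.
    move=> i; have [|c _ hc] := @EVT_max R (fun t => `|vcoord i (derive1 y t)|) 0 1 ler01.
      by apply: continuous_subspaceT; exact: cont_norm (cy i).
    by exists `|vcoord i (derive1 y c)| => t t01; apply: hc; rewrite in_itv.
  exists (\sum_i `|c i|) => [|t i t01]; first exact: sumr_ge0.
  rewrite (le_trans (hc i t t01)) // (le_trans (ler_norm _)) //.
  by rewrite (bigD1 i) //= lerDl; exact: sumr_ge0.
have [C C0 hC] := hnorm_box hN.
exists (C * M); first by rewrite mulr_ge0 // ltW.
move=> s t s0 st t1.
have hs := @signature_sol _ _ m y cy.
have [hi h1] := sol_incr s0 (le_trans st t1) hs.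
rewrite -mulrA; apply: hC; first by rewrite mulr_ge0 // subr_ge0.
  by apply: incr_on_group => //; exact: signature_on_group.
apply: (sol_bound st M0 _ (sol_sub (lexx s) t1 hi) h1) => u /andP[su ut] i.
by apply: hM; rewrite (le_trans s0 (ltW su)) (le_trans (ltW ut) t1).
Qed.

(** On an interval [[a, b]] of length at most [delta], the p-th power of the norm of the signature
    increment is at most [K ^ p * delta ^ (p - 1) * (b - a)], and that of the distance to the
    increment of [Y] is controlled by a function of total growth [c ^ p]. Both bounds are additive,
    hence survive the two suprema. *)
Lemma mesh_sup_bound Y (y : R -> V) (c : R) : on_group Y -> smooth y -> 0 <= c ->
  (dpvar N p Y (signature_path y) <= c%:E)%E -> exists2 K : R, 0 <= K &
  forall delta, 0 < delta ->
    (mesh_sup N p Y delta <= (2 `^ p * (K * delta `^ (p - 1) + c `^ p))%:E)%E.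
Proof.
move=> hY sy c0 hc; set X := signature_path y in hc.
have hX : on_group X by exact: signature_on_group.
have [K K0 hK] := signature_lipschitz sy.
exists (K `^ p) => [|delta d0]; first exact: powR_ge0.
pose d s t := gdist N (incr Y s t) (incr X s t) `^ p.
have [||H [Hm Hc Hd]] := @control R d 0 1 (c `^ p) ler01.
- by move=> *; exact: powR_ge0.
- move=> u D u0 uD uD1.
  have [|D' hD' le] := @chain_partition R d u D _ u0 uD uD1.
    by move=> *; exact: powR_ge0.
  by apply: le_trans le _; exact: dpvar_sum_le.
pose E s t := 2 `^ p * (K `^ p * delta `^ (p - 1) * (t - s) + (H t - H s)).
apply: (@mesh_sup_le _ _ E); last first.
  move=> D [_ /eqP hD]; rewrite /E sum_consecutiveZ ler_wpM2l ?powR_ge0 //.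
  rewrite sum_consecutiveD sum_consecutiveZ (sum_consecutive_telescope id).
  rewrite sum_consecutive_telescope hD subr0 mulr1 lerD2l //.
move=> s t s0 st t1 std; apply: delta_pvar_le => u D su uD uDt.
apply: (@le_trans _ _ (sum_consecutive E u D)).
  apply: sum_consecutive_le => // a b ua ab bD.
  have a0 : 0 <= a by rewrite (le_trans s0) // (le_trans su).
  have b1 : b <= 1 by rewrite (le_trans bD) // (le_trans uDt).
  have bad : b - a <= delta.
    apply: le_trans std; apply: lerB; [exact: le_trans bD uDt|exact: le_trans su ua].
  have GY := incr_on_group hY a0 (ltW ab) b1.
  have GX := incr_on_group hX a0 (ltW ab) b1.
  have le1 := norm_gdist GY GX.
  have nX := hnorm_ge0 hN GX; have nY := hnorm_ge0 hN GY; have nd := gdist_ge0 GY GX.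
  apply: (@le_trans _ _ ((N (incr X a b) + gdist N (incr Y a b) (incr X a b)) `^ p)).
    by apply: ge0_ler_powR; rewrite ?nnegrE ?addr_ge0 ?(ltW p0).
  apply: (le_trans (powR_add (ltW p0) nX nd)); rewrite /E ler_wpM2l ?powR_ge0 //.
  apply: lerD; last exact: Hd.
  have ba0 : 0 <= b - a by rewrite subr_ge0 ltW.
  apply: (@le_trans _ _ ((K * (b - a)) `^ p)).
    apply: ge0_ler_powR; rewrite ?nnegrE ?mulr_ge0 ?(ltW p0) //.
    by apply: hK => //; exact: ltW.
  rewrite powRM // -(mulr_powRB1 ba0 p0) [(b - a) * _]mulrC mulrA.
  rewrite ler_wpM2r // ler_wpM2l ?powR_ge0 //.
  by apply: ge0_ler_powR; rewrite ?nnegrE ?subr_ge0 ?(ltW p1) // ltW.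
rewrite /E sum_consecutiveZ ler_wpM2l ?powR_ge0 //.
rewrite sum_consecutiveD sum_consecutiveZ (sum_consecutive_telescope id).
have ul := path_le_last uD.
rewrite sum_consecutive_telescope; apply: lerD.
  by rewrite ler_wpM2l ?mulr_ge0 ?powR_ge0 // lerB.
apply: lerB; first by apply: Hm; rewrite ?(le_trans s0) // (le_trans su).
by apply: Hm => //; rewrite (le_trans ul) // (le_trans uDt).
Qed.

End Variations.

(** * The converse implication *)

Section Converse.
Context {R : realType} {V : normedVectType R} {m : nat}.
Local Notation dimV := (\dim {:V}).
Local Notation T := (trunc_tensor R dimV m).
Local Notation G := (@free_nilpotent_group R V m).
Variables (N : T -> R) (p : R).
Hypothesis hN : homogeneous_norm N.
Hypothesis p1 : 1 < p.
Implicit Types (X Y : R -> T).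

Let p0 : 0 < p. Proof. exact: lt_trans p1. Qed.

(** The outer factors [b] and [b'] cost their norms; what remains of the quotient is the conjugate
    by [h] of [tinv a * a']. *)
Lemma gdist_mul3 (eta C : R) a b h a' b' :
  (forall g h, G g -> G h -> N (tinv h * g * h) <= C * N g + eta * N h) -> 0 <= C ->
  G a -> G b -> G h -> G a' -> G b' ->
  gdist N (a * h * b) (a' * h * b') <= (N b + N b' + C * (N a + N a')) + eta * N h.
Proof.
move=> hC C0 Ga Gb Gh Ga' Gb'.
have [a1 b1 h1] := And3 (free_group_nil Ga) (free_group_nil Gb) (free_group_nil Gh).
have Gg : G (tinv a * a') by apply: free_groupM => //; exact: free_groupV.
have GVb := free_groupV Gb; have GVh := free_groupV Gh.
have Gc : G (tinv h * (tinv a * a') * h) by apply: free_groupM => //; exact: free_groupM.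
have -> : gdist N (a * h * b) (a' * h * b') =
    N (tinv b * (tinv h * (tinv a * a') * h) * b').
  by rewrite /gdist !tinvM ?coef_nil_mul ?a1 ?h1 ?mulr1 // !mulrA.
have s1 := hnormM hN (free_groupM GVb Gc) Gb'.
have s2 := hnormM hN GVb Gc; rewrite (hnormV hN Gb) in s2.
have s3 := hC _ _ Gg Gh.
have s4 : C * N (tinv a * a') <= C * (N a + N a').
  rewrite ler_wpM2l //; have := hnormM hN (free_groupV Ga) Ga'.
  by rewrite (hnormV hN Ga).
lra.
Qed.

(* If [s] and [t] lie in different intervals of [D], write
   [Y_st = a h b] and [X_st = a' h b'], where [h] is the common increment between
   two points of [D]: only [h] is not small, and it enters through a conjugation. *)
Lemma gdist_control X Y D (F H : R -> R) (eta C : R) : 0 <= eta -> 0 <= C ->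
  (forall g h, G g -> G h -> N (tinv h * g * h) <= C * N g + eta * N h) ->
  on_group X -> on_group Y -> itv_partition 0 1 D ->
  (forall i, (i <= size D)%N -> X (nth 0 (0 :: D) i) = Y (nth 0 (0 :: D) i)) ->
  (forall s t, s <= t -> F s <= F t) ->
  (forall i s t, (i < size D)%N -> nth 0 (0 :: D) i <= s -> s < t -> t <= nth 0 (0 :: D) i.+1 ->
    N (incr X s t) `^ p + N (incr Y s t) `^ p <= F t - F s) ->
  (forall s t, 0 <= s -> s <= t -> t <= 1 -> H s <= H t) ->
  (forall s t, 0 <= s -> s < t -> t <= 1 -> N (incr Y s t) `^ p <= H t - H s) ->
  forall s t, 0 <= s -> s < t -> t <= 1 ->
  gdist N (incr Y s t) (incr X s t) `^ p <=
    2 `^ p * (2 `^ p * (2 `^ p * (1 + C `^ p))) * (F t - F s) + 2 `^ p * eta `^ p * (H t - H s).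
Proof.
move=> eta0 C0 hC hX hY hD XY Fm FXY Hm HY s t s0 st t1.
set K := 2 `^ p.
have K1 : 1 <= K.
  by rewrite -(powRr0 2) /K; apply: ler_powR; [rewrite ler1n|exact: ltW].
have K0 : 0 <= K by exact: le_trans K1.
have Cp0 : 0 <= C `^ p by exact: powR_ge0.
have s01 : 0 <= s <= 1 by rewrite s0 (le_trans (ltW st)).
have t01 : 0 <= t <= 1 by rewrite t1 (le_trans s0 (ltW st)).
have F0 : 0 <= F t - F s by rewrite subr_ge0 Fm // ltW.
have H0 : 0 <= H t - H s by rewrite subr_ge0 Hm // ltW.
have padd x y : 0 <= x -> 0 <= y -> (x + y) `^ p <= K * (x `^ p + y `^ p).
  by move=> x0 y0; apply: powR_add => //; exact: ltW.
have pmono x y : 0 <= x -> x <= y -> x `^ p <= y `^ p.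
  by move=> x0 xy; apply: ge0_ler_powR; rewrite ?nnegrE ?(ltW p0) // (le_trans x0).
have GYst := incr_on_group hY s0 (ltW st) t1.
have GXst := incr_on_group hX s0 (ltW st) t1.
have [i iD /andP[is_ si]] := itv_partition_locate hD s01.
have [j jD /andP[jt tj]] := itv_partition_locate hD t01.
have ij : (i <= j)%N.
  rewrite leqNgt; apply/negP => ji.
  have := itv_partition_mono hD ji (ltnW iD).
  by rewrite leNgt (le_lt_trans is_ (lt_le_trans st tj)).
(* Inside a single interval of [D] the triangle inequality suffices, and [K >= 1] brings its
   constant under the stated one. *)
move: ij; rewrite leq_eqVlt => /orP[/eqP ij|ij].
  have {}tj : t <= nth 0 (0 :: D) i.+1 by rewrite ij.
  have nX := hnorm_ge0 hN GXst; have nY := hnorm_ge0 hN GYst.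
  apply: (@le_trans _ _ (K * (F t - F s))).
    apply: le_trans (pmono _ _ (gdist_ge0 hN GYst GXst) (gdist_le hN GYst GXst)) _.
    apply: le_trans (padd _ _ nY nX) _; rewrite ler_wpM2l // addrC.
    exact: FXY iD is_ st tj.
  rewrite -[leLHS]addr0; apply: lerD; last by rewrite !mulr_ge0 ?powR_ge0.
  rewrite ler_wpM2r // -[leLHS]mulr1 ler_wpM2l // mulr_ege1 // mulr_ege1 //.
  by rewrite lerDl.
set a := nth 0 (0 :: D) i.+1 in si.
set b := nth 0 (0 :: D) j in jt.
have ab : a <= b by exact: (itv_partition_mono hD ij (ltnW jD)).
have /andP[a0 a1] : 0 <= a <= 1 by exact: (itv_partition_nth01 hD iD).
have /andP[b0 b1] : 0 <= b <= 1 by exact: (itv_partition_nth01 hD (ltnW jD)).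
have a01 : 0 <= a <= 1 by rewrite a0 a1.
have b01 : 0 <= b <= 1 by rewrite b0 b1.
have split3 Z : on_group Z -> incr Z s t = incr Z s a * incr Z a b * incr Z b t.
  by move=> hZ; rewrite (incr_mul s t hZ b01) (incr_mul s b hZ a01).
have Eab : incr X a b = incr Y a b.
  by rewrite /incr (XY i.+1 iD) (XY j (ltnW jD)).
have GYa := incr_on_group hY s0 si a1; have GXa := incr_on_group hX s0 si a1.
have GYb := incr_on_group hY b0 jt t1; have GXb := incr_on_group hX b0 jt t1.
have Gh := incr_on_group hY a0 ab b1.
have := gdist_mul3 hC C0 GYa GYb Gh GXa GXb.
rewrite -{2}Eab -!split3 //.
set y1 := N (incr Y s a); set x1 := N (incr X s a); set y2 := N (incr Y b t).
set x2 := N (incr X b t); set h := N (incr Y a b).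
have y10 : 0 <= y1 by exact: hnorm_ge0. have x10 : 0 <= x1 by exact: hnorm_ge0.
have y20 : 0 <= y2 by exact: hnorm_ge0. have x20 : 0 <= x2 by exact: hnorm_ge0.
have h0 : 0 <= h by exact: hnorm_ge0.
have pz : 0 `^ p = 0 :> R by rewrite powR0 // gt_eqF.
have e1 : x1 `^ p + y1 `^ p <= F a - F s.
  move: (si); rewrite le_eqVlt => /orP[/eqP sa|sa]; last exact: FXY iD is_ sa (lexx _).
  by rewrite /x1 /y1 -sa !incr_refl // (hnorm1 hN) pz addr0 subrr.
have e2 : x2 `^ p + y2 `^ p <= F t - F b.
  move: (jt); rewrite le_eqVlt => /orP[/eqP bt|bt]; last exact: FXY jD (lexx _) bt tj.
  by rewrite /x2 /y2 bt !incr_refl // (hnorm1 hN) pz addr0 subrr.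
have e3 : h `^ p <= H t - H s.
  have : h `^ p <= H b - H a.
    move: (ab); rewrite le_eqVlt => /orP[/eqP ab'|ab']; last exact: HY.
    by rewrite /h ab' incr_refl // (hnorm1 hN) pz subrr.
  have := Hm _ _ b0 jt t1; have := Hm _ _ s0 si a1; lra.
have Fab := Fm _ _ ab; have Fsa := Fm _ _ si; have Fbt := Fm _ _ jt.
have W0 : 0 <= y2 + x2 + C * (y1 + x1) by rewrite !addr_ge0 // mulr_ge0 // addr_ge0.
have W : (y2 + x2 + C * (y1 + x1)) `^ p <= K * (K * (1 + C `^ p)) * (F t - F s).
  apply: le_trans (padd _ _ _ _) _; rewrite ?addr_ge0 ?mulr_ge0 ?addr_ge0 //.
  rewrite -mulrA ler_wpM2l // powRM ?addr_ge0 //.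
  have q1 := padd _ _ y10 x10; have q2 := padd _ _ y20 x20.
  have r1 : C `^ p * (y1 + x1) `^ p <= C `^ p * (K * (F t - F s)).
    rewrite ler_wpM2l // (le_trans q1) // ler_wpM2l //; lra.
  have r2 : (y2 + x2) `^ p <= K * (F t - F s).
    by rewrite (le_trans q2) // ler_wpM2l //; lra.
  lra.
move=> dle.
apply: le_trans (pmono _ _ (gdist_ge0 hN GYst GXst) dle) _.
apply: le_trans (padd _ _ W0 (mulr_ge0 eta0 h0)) _.
rewrite powRM // -!mulrA -mulrDr ler_wpM2l //.
rewrite !mulrA in W *; apply: lerD; first by [].
by rewrite ler_wpM2l ?powR_ge0.
Qed.

End Converse.

Section Main.
Context {R : realType} {V : normedVectType R} {m : nat}.
Local Notation dimV := (\dim {:V}).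
Local Notation T := (trunc_tensor R dimV m).
Local Notation G := (@free_nilpotent_group R V m).
Variables (N : T -> R) (p : R).
Hypothesis hN : homogeneous_norm N.
Hypothesis p1 : 1 < p.
Implicit Types (X Y : R -> T).

Let p0 : 0 < p. Proof. exact: lt_trans p1. Qed.

(* The path follows in turn, on each interval of D, a smooth reparametrization
   of a broken line with the same increment as Y and a comparable length. *)
Lemma interpolating_path : exists2 K : R, 0 <= K & forall Y D, on_group Y -> Y 0 = 1 ->
  itv_partition 0 1 D -> exists2 y : R -> V, smooth y &
  (forall i, (i <= size D)%N ->
    (signature_path y : R -> T) (nth 0 (0 :: D) i) = Y (nth 0 (0 :: D) i)) /\
  forall i, (i < size D)%N -> exists Th : R -> R,
    let a := nth 0 (0 :: D) i in let b := nth 0 (0 :: D) i.+1 in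
    [/\ forall s t, a <= s -> s <= t -> t <= b -> Th s <= Th t,
      Th b - Th a <= K * N (incr Y a b) & forall s t, a <= s -> s <= t -> t <= b ->
      N (incr (signature_path y) s t) <= Th t - Th s].
Proof.
have [M M0 hM] := hnorm_reach hN; have [C C0 hC] := reach_hnorm hN.
exists (M * C); first exact: mulr_ge0.
move=> Y D hY Y0 hD.
pose ti i := nth 0 (0 :: D) i.
have [s hs] : exists s : nat -> seq (R * 'I_dimV), forall i, (i < size D)%N ->
    incr Y (ti i) (ti i.+1) = \prod_(q <- s i) eexp q /\
    \sum_(q <- s i) `|q.1| <= C * N (incr Y (ti i) (ti i.+1)).
  have /choice[s hs] : forall i, exists s : seq (R * 'I_dimV), (i < size D)%N ->
    incr Y (ti i) (ti i.+1) = \prod_(q <- s) eexp q /\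
    \sum_(q <- s) `|q.1| <= C * N (incr Y (ti i) (ti i.+1)).
    move=> i; have [iD|iD] := ltnP i (size D); last by exists [::].
    have /andP[a0 _] := itv_partition_nth01 hD (ltnW iD).
    have /andP[_ b1] := itv_partition_nth01 hD iD.
    have [s e l] := hC _ (incr_on_group hY a0 (ltW (itv_partition_nth hD iD)) b1).
    by exists s.
  by exists s.
have [y sy hy] := build_path hN M0 hM s hD.
exists y => //; set X := signature_path y : R -> T.
have hX : on_group X by exact: signature_on_group.
have sol01 := @signature_sol _ _ m y (fun i => smooth_vcoord_cont sy).
have dr i (iD : (i < size D)%N) := hy i iD X (sol_sub
   (proj1 (andP (itv_partition_nth01 hD (ltnW iD))))
   (proj2 (andP (itv_partition_nth01 hD iD))) sol01).
split.
  elim=> [|i IH] iD; first by rewrite /= Y0; exact: signature_path0.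
  have [e _] := dr i iD.
  have {}IH := IH (ltnW iD); have t01 := itv_partition_nth01 hD (ltnW iD).
  have XE : X (ti i.+1) = X (ti i) * incr X (ti i) (ti i.+1).
    by rewrite /incr mulrA tinvV ?mul1r //; exact/free_group_nil/hX.
  rewrite -/(ti _) XE /ti e -(hs i iD).1 IH /incr mulrA tinvV ?mul1r //.
  exact/free_group_nil/hY.
move=> i iD; have [_ [Th [h1 h2 h3]]] := dr i iD; exists Th; split => //.
by apply: le_trans h2 _; rewrite -mulrA ler_wpM2l //; case: (hs i iD).
Qed.

Lemma approximation Y : on_group Y -> Y 0 = 1 -> (pvar N p Y < +oo)%E ->
  mesh_sup N p Y delta @[delta --> 0^'+] --> 0%E ->
  forall e : R, 0 < e ->
  exists2 y : R -> V, smooth y & (dpvar N p Y (signature_path y) <= e%:E)%E.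
Proof.
move=> hY Y0 Yfin hmesh e e0.
have [B hB] := pvar_chain_bound hN p1 hY Yfin.
have B0 : 0 <= B by have := hB 0 [::]; rewrite sum_consecutive_nil /=; apply => //; exact: ler01.
have fge0 (s t : R) : 0 <= N (incr Y s t) `^ p by exact: powR_ge0.
have [//||H [Hm Hc Hf]] := @control R (fun s t => N (incr Y s t) `^ p) 0 1 B ler01.
  by move=> u D u0 uD uD1; exact: hB.
set k := 2 `^ p.
have k0 : 0 < k by rewrite powR_gt0.
pose e' := e `^ p; have e'0 : 0 < e' by rewrite powR_gt0.
(* Chosen so that [k * eta ^ p * B] is at most half of [e ^ p]; the [+ 1] avoids dividing by
   zero. *)
pose eta := (e' / (2 * (k * B + 1))) `^ p^-1.
have kB : 0 < k * B + 1 by rewrite ltr_wpDl // mulr_ge0 // ltW.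
have eta0 : 0 < eta by rewrite powR_gt0 // divr_gt0 // mulr_gt0.
have [C C0 hC] := hnorm_conj hN eta0.
have [K K0 hK] := interpolating_path.
pose A := k * (k * (k * (1 + C `^ p))).
have A0 : 0 <= A by rewrite !mulr_ge0 ?(ltW k0) // addr_ge0 // powR_ge0.
pose A' := A * (K `^ p + 1).
have A'0 : 0 <= A' by rewrite mulr_ge0 // addr_ge0 // powR_ge0.
(* Chosen so that [A' * rho] is at most half of [e ^ p]. Since [C], and hence [A'], depends on
   [eta], the subdivision can only be selected now. *)
pose rho := e' / (2 * (A' + 1)).
have rho0 : 0 < rho by rewrite divr_gt0 // mulr_gt0 // ltr_wpDl.
have [D hD Drho] : exists2 D, itv_partition 0 1 D &
    (sum_consecutive (delta_pvar N p Y) 0 D <= rho%:E)%E.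
  near (0 : R)^'+ => delta.
  have d0 : 0 < delta by near: delta; exact: nbhs_right_gt.
  have [D hD mD] := fine_partition d0; exists D => //.
  apply: (@le_trans _ _ (mesh_sup N p Y delta)).
    by apply: ereal_sup_ubound; exists D.
  by near: delta; exact: (cvge0_le _ hmesh rho0).
pose ti i := nth 0 (0 :: D) i.
have t01 i : (i <= size D)%N -> 0 <= ti i <= 1 by exact: itv_partition_nth01.
have tlt i : (i < size D)%N -> ti i < ti i.+1 by exact: itv_partition_nth.
pose r i := fine (delta_pvar N p Y (ti i) (ti i.+1)).
have rE i : (i < size D)%N -> delta_pvar N p Y (ti i) (ti i.+1) = (r i)%:E.
  move=> iD; rewrite /r fineK // ge0_fin_numE; last exact/delta_pvar_ge0/ltW/tlt.
  apply: (@le_lt_trans _ _ B%:E); last exact: ltry.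
  apply: delta_pvar_le => u E su uE uEt; apply: hB => //.
    by apply: le_trans su; case/andP: (t01 i (ltnW iD)).
  by apply: (le_trans uEt); case/andP: (t01 i.+1 iD).
have rsum : \sum_(i < size D) r i <= rho.
  rewrite -lee_fin -sumEFin; apply: le_trans Drho.
  rewrite /sum_consecutive big_mkord; apply: lee_sum => i _.
  by rewrite -rE.
have /choice[h hh] : forall i, exists h : R -> R, (i < size D)%N ->
   [/\ forall s t, ti i <= s -> s <= t -> t <= ti i.+1 -> h s <= h t,
   h (ti i.+1) - h (ti i) <= r i & forall s t, ti i <= s -> s < t -> t <= ti i.+1 ->
      N (incr Y s t) `^ p <= h t - h s].
  move=> i; have [iD|iD] := ltnP i (size D); last by exists (fun=> 0).
  have [//||h hh] := @control R (fun s t => N (incr Y s t) `^ p) (ti i) (ti i.+1) (r i) (ltW (tlt i iD)).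
    move=> u E su uE uEt; rewrite -lee_fin -rE //; apply: ereal_sup_ubound.
    by exists (u, E).
  by exists h.
have [y sy [XY hTh]] := hK Y D hY Y0 hD.
set X := signature_path y : R -> T in XY hTh.
have hX : on_group X by exact: signature_on_group.
have {hTh}/choice[Th hTh] : forall i, exists Th : R -> R, (i < size D)%N ->
    [/\ forall s t, ti i <= s -> s <= t -> t <= ti i.+1 -> Th s <= Th t,
      Th (ti i.+1) - Th (ti i) <= K * N (incr Y (ti i) (ti i.+1)) &
      forall s t, ti i <= s -> s <= t -> t <= ti i.+1 -> N (incr X s t) <= Th t - Th s].
  move=> i; have [iD|iD] := ltnP i (size D); last by exists (fun=> 0).
  by have [th hth] := hTh i iD; exists th.
pose l i := K * N (incr Y (ti i) (ti i.+1)).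
have l0 i : (i < size D)%N -> 0 <= l i.
  move=> iD; rewrite mulr_ge0 //; apply: (hnorm_ge0 hN); apply: incr_on_group => //.
  - by case/andP: (t01 i (ltnW iD)).
  - exact/ltW/tlt.
  - by case/andP: (t01 i.+1 iD).
(* The length increment [Th] is at most [l], so its p-th power is at most [l ^ (p - 1)] times
   itself, which is additive. The total [l ^ p] is at most [K ^ p * r i]; adding [h] controls [Y] as
   well. *)
pose F0 i t := l i `^ (p - 1) * Th i t + h i t.
have F0m i s t : (i < size D)%N -> ti i <= s -> s <= t -> t <= ti i.+1 -> F0 i s <= F0 i t.
  move=> iD is_ st ti_; have [m1 _ _] := hTh i iD; have [m2 _ _] := hh i iD.
  apply: lerD; last exact: m2.
  by rewrite ler_wpM2l ?powR_ge0 // m1.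
have [F [Fm F1 F2]] := glue hD F0m.
have Ftot : F 1 - F 0 <= (K `^ p + 1) * rho.
  rewrite F2; apply: (@le_trans _ _ (\sum_(i < size D) (K `^ p + 1) * r i)); last first.
    by rewrite -mulr_sumr ler_wpM2l // addr_ge0 // powR_ge0.
  apply: ler_sum => i _; have iD := ltn_ord i.
  have [_ th1 _] := hTh i iD; have [_ h1 h2] := hh i iD.
  rewrite -!/(ti _) /F0.
  have le1 : l i `^ (p - 1) * (Th i (ti i.+1) - Th i (ti i)) <= l i `^ p.
    by rewrite -(mulr_powRB1 (l0 i iD) p0) [l i * _]mulrC ler_wpM2l ?powR_ge0.
  have le2 : l i `^ p <= K `^ p * r i.
    rewrite powRM //; last first.
      apply: (hnorm_ge0 hN); apply: incr_on_group => //; last exact: (proj2 (andP (t01 i.+1 iD))).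
        exact: (proj1 (andP (t01 i (ltnW iD)))).
      exact/ltW/tlt.
    by rewrite ler_wpM2l ?powR_ge0 // (le_trans _ h1) // h2 // tlt.
  lra.
have FXY i s t : (i < size D)%N -> ti i <= s -> s < t -> t <= ti i.+1 ->
    N (incr X s t) `^ p + N (incr Y s t) `^ p <= F t - F s.
  move=> iD is_ st tle; apply: le_trans (F1 i s t iD is_ (ltW st) tle).
  have [_ th1 th2] := hTh i iD; have [_ _ h2] := hh i iD; have [thm _ _] := hTh i iD.
  have z1 := th2 s t is_ (ltW st) tle.
  have s0 : 0 <= s by apply: le_trans is_; case/andP: (t01 i (ltnW iD)).
  have t1 : t <= 1 by apply: (le_trans tle); case/andP: (t01 i.+1 iD).
  have NX := hnorm_ge0 hN (incr_on_group hX s0 (ltW st) t1).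
  have z2 : Th i t - Th i s <= l i.
    have := thm (ti i) s (lexx _) is_ (le_trans (ltW st) tle).
    by have := thm t (ti i.+1) (le_trans is_ (ltW st)) tle (lexx _); rewrite /l; lra.
  have z3 : N (incr X s t) `^ p <= l i `^ (p - 1) * (Th i t - Th i s).
    rewrite -(mulr_powRB1 NX p0) mulrC; apply: ler_pM => //; first exact: powR_ge0.
    apply: ge0_ler_powR; rewrite ?nnegrE ?subr_ge0 ?(ltW p1) //; first exact: l0.
    exact: le_trans z2.
  have := h2 s t is_ st tle; rewrite /F0; lra.
exists y => //; apply: dpvar_le => //; first exact: ltW.
move=> E hE.
have ctl := gdist_control hN p1 (ltW eta0) C0 hC hX hY hD XY Fm FXY Hm Hf.
have [Ep /eqP El] := hE.
apply: (@le_trans _ _ (sum_consecutive (fun s t => A * (F t - F s) + k * eta `^ p * (H t - H s)) 0 E)).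
  by apply: sum_consecutive_le => // s t; rewrite El; exact: ctl.
rewrite sum_consecutiveD !sum_consecutiveZ !sum_consecutive_telescope El.
have b1 : A * (F 1 - F 0) <= e' / 2.
  apply: (@le_trans _ _ (A' * rho)).
    by rewrite /A' -mulrA ler_wpM2l.
  have -> : A' * rho = e' / 2 * (A' / (A' + 1)) by rewrite /rho; field; rewrite gt_eqF // ltr_wpDl.
  rewrite -[leRHS]mulr1 ler_wpM2l ?divr_ge0 ?(ltW e'0) //.
  by rewrite ler_pdivrMr ?mul1r ?lerDl // ltr_wpDl.
have b2 : k * eta `^ p * (H 1 - H 0) <= e' / 2.
  rewrite /eta powRVK //; last by rewrite divr_ge0 ?mulr_ge0 ?(ltW e'0) ?(ltW kB).
  apply: (@le_trans _ _ (k * (e' / (2 * (k * B + 1))) * B)).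
    by rewrite ler_wpM2l // mulr_ge0 ?divr_ge0 ?mulr_ge0 ?(ltW e'0) ?(ltW kB) ?(ltW k0).
  have -> : k * (e' / (2 * (k * B + 1))) * B = e' / 2 * (k * B / (k * B + 1)).
    by field; rewrite gt_eqF.
  rewrite -[leRHS]mulr1 ler_wpM2l ?divr_ge0 ?(ltW e'0) //.
  by rewrite ler_pdivrMr ?mul1r ?lerDl.
rewrite -/e'; lra.
Unshelve. all: by end_near. Qed.

Lemma mesh_sup_cvg Y : on_group Y ->
  (forall e : R, 0 < e ->
    exists2 y : R -> V, smooth y & (dpvar N p Y (signature_path y) < e%:E)%E) ->
  mesh_sup N p Y delta @[delta --> 0^'+] --> 0%E.
Proof.
move=> hY happ; apply: cvge0P => e e0.
have k0 : 0 < 2 `^ p :> R by rewrite powR_gt0.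
(* With this precision the term [2 ^ p * c ^ p] of [mesh_sup_bound] is [e / 2]; the other term
   vanishes with [delta] because [p - 1] is positive. *)
pose c := (e / 2 / 2 `^ p) `^ p^-1.
have ek : 0 < e / 2 / 2 `^ p by rewrite !divr_gt0.
have c0 : 0 < c by rewrite powR_gt0.
have [y sy hy] := happ c c0.
have [K K0 hK] := mesh_sup_bound hN p1 hY sy (ltW c0) (ltW hy).
have kK : 0 < 2 `^ p * K + 1 by rewrite ltr_wpDl // mulr_ge0 // ltW.
near=> delta.
have d0 : 0 < delta by near: delta; exact: nbhs_right_gt.
rewrite mesh_sup_ge0 //=; apply: le_trans (hK delta d0) _; rewrite lee_fin.
rewrite /c powRVK // ?(ltW ek) //.
have small : delta `^ (p - 1) <= e / 2 / (2 `^ p * K + 1).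
  have : `|0 - delta `^ (p - 1)| <= e / 2 / (2 `^ p * K + 1).
    near: delta; have p10 : 0 < p - 1 by rewrite subr_gt0.
    have /cvgrPdist_le := @powR_cvg0 R (p - 1) p10; apply.
    by rewrite !divr_gt0.
  by rewrite sub0r normrN ger0_norm // powR_ge0.
have -> : 2 `^ p * (K * delta `^ (p - 1) + e / 2 / 2 `^ p) =
    2 `^ p * K * delta `^ (p - 1) + e / 2 by field; rewrite gt_eqF.
have : (2 `^ p * K + 1) * delta `^ (p - 1) <= e / 2.
  by rewrite mulrC -ler_pdivlMr.
have := powR_ge0 delta (p - 1); lra.
Unshelve. all: by end_near. Qed.

End Main.

Theorem theorem21 (R : realType) (V : normedVectType R) (m : nat) (p : R)
    (N : trunc_tensor R (\dim {:V}) m -> R)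
    (Y : R -> trunc_tensor R (\dim {:V}) m)
    (hm : (1 <= m)%N) (hp : 1 < p)
    (hN : homogeneous_norm N) (hY : Cpvar N p Y) :
  C0pvar N p Y <->
  mesh_sup N p Y delta @[delta --> 0^'+] --> 0%E.
Proof.
have [gY Yfin] := hY; have [YG Y0 _] := gY.
split=> [[_ h]|h]; first exact: mesh_sup_cvg.
split=> // e e0; have e2 : 0 < e / 2 by rewrite divr_gt0.
have [y sy hy] := approximation hN hp YG Y0 Yfin h e2.
by exists y => //; apply: (le_lt_trans hy); rewrite lte_fin ltr_pdivrMr // ltr_pMr // ltr1n.
Qed.
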